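(* Let $\alpha>0$ and $x_0>0$ be fixed. \begin{enumerate} \item If $u$ is a solution of $u''+c^{-2}(x)u=0$ with $c^{-2}(x)=1+\theta x_+^\alpha$, then the pair $(a^>,a^<)$ associated with $u$ on $[0,x_0]$ solves \[ \begin{pmatrix} a^> \\ a^< \end{pmatrix}(y)=\begin{pmatrix} a^> \\ a^< \end{pmatrix}(x_0)+\mathcal{V}\!\left(\begin{pmatrix} a^> \\ a^< \end{pmatrix}\right)(y),\qquad \forall y\in[0,x_0]. \] \item There exists $\theta_1>0$ such that, for all $0<\theta<\theta_1$, the reflection coefficient $R$ satisfies \[ R=\frac{\left[\left((\mathrm{Id}-\mathcal{V})^{-1}\begin{pmatrix} 1 \\ k \end{pmatrix}\right)(0)\right]_2}{\left[\left((\mathrm{Id}-\mathcal{V})^{-1}\begin{pmatrix} 1 \\ k \end{pmatrix}\right)(0)\right]_1}, \] where $\begin{pmatrix} 1 \\ k \end{pmatrix}$ is viewed as a constant function on $[0,x_0]$ and $[\cdot]_j$ denotes the $j$-th component. \item For $0<\theta<\min(\theta_0(x_0),\theta_1)$, \[ R=R_{x_0}+\frac{b(x_0)b'(x_0)}{2i}e^{-2i\phi(x_0)}+\int_0^{x_0}\frac{b'(y)}{b(y)}e^{-2i\phi(y)}\,dy+O(\theta^2). \] \end{enumerate}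
   Context: Notation: $x_+=\max(x,0)$, $\theta>0$, $c(x)=(1+\theta x_+^\alpha)^{-1/2}$, $\phi(x)=\int_0^x\frac{dy}{c(y)}$, $b(x)=c(x)^{1/2}$, $M(x)=c^{1/2}(x)(c^{1/2})''(x)$ for $x>0$, $M_{x_0}=\int_{x_0}^\infty|M(x)|dx$. The number $\theta_0(x_0)>0$ is such that $M_{x_0}<2$ for all $0<\theta<\theta_0(x_0)$ (such a number exists). Let $w^>(x)=e^{-i\phi(x)}$, $w^<(x)=e^{i\phi(x)}$. For a $C^1$ solution $u$, the functions $a^>,a^<$ on $[0,x_0]$ are defined by $u=a^>w^>+a^<w^<$ and $(a^>)'w^>+(a^<)'w^<=0$; equivalently $u=a^>w^>+a^<w^<$ and $u'=a^>(w^>)'+a^<(w^<)'$. The operator $\mathcal{V}$ acts on $\mathbb{C}^2$-valued continuous functions $f$ on $[0,x_0]$ by \[ \mathcal{V}(f)(x)=\int_{x_0}^x\frac{\phi''(y)}{2\phi'(y)}\begin{pmatrix} -1 & e^{2i\phi(y)} \\ e^{-2i\phi(y)} & -1 \end{pmatrix}f(y)\,dy . \] When $M_{x_0}<2$, $S^>$ is the unique bounded continuous solution on $[x_0,\infty)$ of $S^>(x)=e^{-2i\phi(x)}+\frac{1}{2i}\left[\int_{x_0}^xM(y)S^>(y)e^{-2i(\phi(x)-\phi(y))}dy+\int_x^{+\infty}M(y)S^>(y)dy\right]$, and \[ R_{x_0}=\frac1{2i}\int_{x_0}^{+\infty}M(y)S^>(y)\,dy,\qquad k=e^{-2i\phi(x_0)}\,\frac{1-i\,b(x_0)b'(x_0)+q}{1+i\,b(x_0)b'(x_0)-q},\qquad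 q=\frac{R_{x_0}e^{i\phi(x_0)}-e^{-i\phi(x_0)}}{R_{x_0}e^{i\phi(x_0)}+e^{-i\phi(x_0)}} . \] (In item 2, $\theta_1$ is understood to be small enough that $k$ is defined.) Outgoing solutions and $R$: a nonzero solution $u$ of $u''+c^{-2}(x)u=0$ on $\mathbb{R}$ is outgoing to $+\infty$ if there is a sequence of solutions $u(\cdot;\sigma)$ of $u''+(1+i\sigma)^2c^{-2}(x)u=0$, with real $\sigma<0$ tending to $0$, such that $u(x;\sigma)\to u(x)$ as $\sigma\to0^-$ uniformly on compact sets and $\lim_{x\to+\infty}u(x;\sigma)=0$ for each such $\sigma$. Such a solution is unique up to a multiplicative constant; writing it as $A e^{ix}+B e^{-ix}$ for $x<0$, the reflection coefficient is $R=A/B$. The constant in $O(\theta^2)$ may depend on $\alpha$ and $x_0$ but not on $\theta$. *)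

(* Defs.v *)
From Stdlib Require Import Reals ClassicalEpsilon.
From Coquelicot Require Import Coquelicot.

Local Open Scope R_scope.

(* [Rpower 0 alpha] is [1] in the standard library, hence the case distinction. *)
Definition pos_pow (alpha x : R) : R :=
  if Rlt_dec 0 x then Rpower x alpha else 0.

Definition c (alpha theta x : R) : R :=
  Rpower (1 + theta * pos_pow alpha x) (- (1 / 2)).

Definition phi (alpha theta x : R) : R :=
  RInt (fun y => / c alpha theta y) 0 x.

Definition b (alpha theta x : R) : R := sqrt (c alpha theta x).

(* Only meaningful for [0 < x], where [b] is smooth. *)
Definition M (alpha theta x : R) : R :=
  b alpha theta x * Derive_n (b alpha theta) 2 x.

Definition M_tail (alpha theta x0 : R) : R :=
  RInt_gen (fun x => Rabs (M alpha theta x)) (at_point x0) (Rbar_locally p_infty).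

(* [exp (i t)] *)
Definition cis (t : R) : C := (cos t, sin t).

(* [C] is canonically a normed module over itself; derivatives and integrals
   along the real line need its structure over [R]. *)
Definition is_derive_RC (f : R -> C) (x : R) (l : C) : Prop :=
  @is_derive R_AbsRing C_R_NormedModule f x l.

Definition Derive_RC (f : R -> C) (x : R) : C :=
  (Derive (fun y => Re (f y)) x, Derive (fun y => Im (f y)) x).

Definition RInt_RC (f : R -> C) (a d : R) : C :=
  @RInt C_R_CompleteNormedModule f a d.

Definition RInt_gen_RC (f : R -> C) (Fa Fd : (R -> Prop) -> Prop) : C :=
  @RInt_gen C_R_CompleteNormedModule f Fa Fd.

Definition is_solution (alpha theta : R) (z : C) (u : R -> C) : Prop :=
  exists u' : R -> C, forall x : R,
    is_derive_RC u x (u' x) /\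
    is_derive_RC u' x (- (z * z * RtoC (/ (c alpha theta x) ^ 2) * u x))%C.

Definition w_gt (alpha theta x : R) : C := cis (- phi alpha theta x).
Definition w_lt (alpha theta x : R) : C := cis (phi alpha theta x).

(* Variation of constants.  The condition on [u'] replaces
   [a_gt' w_gt + a_lt' w_lt = 0], since for [alpha < 1] the functions
   [a_gt] and [a_lt] need not be differentiable at [0]. *)
Definition is_wave_pair (alpha theta x0 : R) (u a_gt a_lt : R -> C) : Prop :=
  forall x : R, 0 <= x <= x0 ->
    u x = (a_gt x * w_gt alpha theta x + a_lt x * w_lt alpha theta x)%C /\
    is_derive_RC u x
      (a_gt x * Derive_RC (w_gt alpha theta) x
       + a_lt x * Derive_RC (w_lt alpha theta) x)%C.

(* The coefficient [phi'' / (2 phi')] is unbounded but integrable near [0] when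
   [alpha < 1].  The integral from [x0] to [x] is therefore the limit of the
   integrals from [x0] to [y] as [y] tends to [x] inside [(0, x0]]; for
   [0 < x <= x0] this is the ordinary integral. *)
Definition V_int (x0 : R) (h : R -> C) (x : R) : C :=
  RInt_gen_RC h (at_point x0) (within (fun y => 0 < y <= x0) (locally x)).

Definition V (alpha theta x0 : R) (f : R -> C * C) (x : R) : C * C :=
  let g y := RtoC (Derive_n (phi alpha theta) 2 y
                   / (2 * Derive (phi alpha theta) y)) in
  (V_int x0 (fun y =>
     g y * (- fst (f y) + cis (2 * phi alpha theta y) * snd (f y)))%C x,
   V_int x0 (fun y =>
     g y * (cis (- 2 * phi alpha theta y) * fst (f y) - snd (f y)))%C x).

Definition add2 (v w : C * C) : C * C :=
  ((fst v + fst w)%C, (snd v + snd w)%C).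

Definition continuous_seg (x0 : R) (f : R -> C * C) : Prop :=
  continuous_on (fun x => 0 <= x <= x0) f.

(* [f] is continuous on [0, x0] and [(Id - V) f = g] there. *)
Definition solves_Id_sub_V
    (alpha theta x0 : R) (g f : R -> C * C) : Prop :=
  continuous_seg x0 f /\
  forall x : R, 0 <= x <= x0 -> f x = add2 (g x) (V alpha theta x0 f x).

Definition Id_sub_V_invertible (alpha theta x0 : R) : Prop :=
  forall g : R -> C * C, continuous_seg x0 g ->
    (exists f, solves_Id_sub_V alpha theta x0 g f) /\
    (forall f1 f2, solves_Id_sub_V alpha theta x0 g f1 ->
       solves_Id_sub_V alpha theta x0 g f2 ->
       forall x : R, 0 <= x <= x0 -> f1 x = f2 x).

(* Values outside [0, x0] are irrelevant. *)
Definition Id_sub_V_inv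
    (alpha theta x0 : R) (g : R -> C * C) : R -> C * C :=
  epsilon (inhabits (fun _ => (RtoC 0, RtoC 0)))
    (solves_Id_sub_V alpha theta x0 g).

Definition is_S_gt (alpha theta x0 : R) (S : R -> C) : Prop :=
  (exists B : R, forall x : R, x0 <= x -> Cmod (S x) <= B) /\
  @continuous_on R_UniformSpace C_UniformSpace (fun x => x0 <= x) S /\
  forall x : R, x0 <= x ->
    S x = (cis (- 2 * phi alpha theta x)
      + / (2 * Ci) *
        (RInt_RC (fun y => RtoC (M alpha theta y) * S y *
             cis (- 2 * (phi alpha theta x - phi alpha theta y))) x0 x
         + RInt_gen_RC (fun y => RtoC (M alpha theta y) * S y)
             (at_point x) (Rbar_locally p_infty)))%C.

(* Determined on [x0, +oo) when [M_tail alpha theta x0 < 2]. *)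
Definition S_gt (alpha theta x0 : R) : R -> C :=
  epsilon (inhabits (fun _ => RtoC 0)) (is_S_gt alpha theta x0).

Definition R_tail (alpha theta x0 : R) : C :=
  (/ (2 * Ci) *
   RInt_gen_RC (fun y => RtoC (M alpha theta y) * S_gt alpha theta x0 y)
     (at_point x0) (Rbar_locally p_infty))%C.

Definition bb' (alpha theta x : R) : R :=
  b alpha theta x * Derive (b alpha theta) x.

Definition q_num (alpha theta x0 : R) : C :=
  (R_tail alpha theta x0 * cis (phi alpha theta x0)
   - cis (- phi alpha theta x0))%C.

Definition q_den (alpha theta x0 : R) : C :=
  (R_tail alpha theta x0 * cis (phi alpha theta x0)
   + cis (- phi alpha theta x0))%C.

Definition q (alpha theta x0 : R) : C :=
  (q_num alpha theta x0 / q_den alpha theta x0)%C.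

Definition k_num (alpha theta x0 : R) : C :=
  (1 - Ci * RtoC (bb' alpha theta x0) + q alpha theta x0)%C.

Definition k_den (alpha theta x0 : R) : C :=
  (1 + Ci * RtoC (bb' alpha theta x0) - q alpha theta x0)%C.

Definition k (alpha theta x0 : R) : C :=
  (cis (- 2 * phi alpha theta x0)
   * (k_num alpha theta x0 / k_den alpha theta x0))%C.

Definition k_defined (alpha theta x0 : R) : Prop :=
  M_tail alpha theta x0 < 2 /\
  q_den alpha theta x0 <> 0%C /\ k_den alpha theta x0 <> 0%C.

Definition outgoing (alpha theta : R) (u : R -> C) : Prop :=
  is_solution alpha theta 1%C u /\
  (exists x : R, u x <> 0%C) /\
  exists (sigma : nat -> R) (U : nat -> R -> C),
    (forall n, sigma n < 0) /\
    is_lim_seq sigma 0 /\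
    (forall n, is_solution alpha theta (1 + Ci * RtoC (sigma n))%C (U n)) /\
    (forall r s eps : R, 0 < eps ->
       exists N : nat, forall n : nat, (N <= n)%nat ->
       forall x : R, r <= x <= s -> Cmod (U n x - u x)%C < eps) /\
    (forall n, is_lim (fun x => Cmod (U n x)) p_infty 0).

Definition is_reflection_coefficient (alpha theta : R) (r : C) : Prop :=
  exists (u : R -> C) (A B : C),
    outgoing alpha theta u /\
    (forall x : R, x < 0 -> u x = (A * cis x + B * cis (- x))%C) /\
    B <> 0%C /\ r = (A / B)%C.

(* Main.v *)
(** Write [P = c^-2], so that [phi' = sqrt P], and [zeta = 1 + i sigma].  In the
    variable [t = phi x] the substitution [u = b v] turns the equation into
    [v'' + (zeta^2 + m) v = 0] with [m dt = M dx].  Since [M] is integrable at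
    infinity, for [sigma <= 0] there is a Jost solution
    [v = exp (- i zeta t) s] with [s -> 1], obtained by a contraction and
    continuous in [sigma] up to [0].  For [sigma < 0] it spans the decaying
    solutions, by a Wronskian argument; letting [sigma] tend to [0], the Jost
    solution at [sigma = 0] spans the outgoing solutions.  It is a multiple of
    [b exp (i phi) S^>] on [x0, +oo), which identifies [k] with the ratio
    of its two amplitudes at [x0].  On [0, x0] the amplitudes satisfy the
    Volterra equation of [V], whose kernel has total mass [O(theta)] after the
    substitution [z = y^alpha], and on the negative axis they are constant.

    The expansion needs [ds/dt = O(theta)] at [x0], although the integral of
    [|M|] is only [O(theta^(1/alpha))] when [alpha > 1].  The oscillation gives
    the missing decay: [ds/dt] follows [eta s], where [eta] solves the Riccati
    equation [eta' + eta^2 - 2 i eta + m = 0] up to a residual whose integral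
    is [O(theta)] once enough correction steps have been made, and
    [eta = O(theta)] at [x0]. *)

Require Import Defs.
From Stdlib Require Import Reals Lra Lia Psatz ClassicalEpsilon FunctionalExtensionality.
From Coquelicot Require Import Coquelicot.

Local Open Scope R_scope.

(** * Calculus for functions from R to C *)

(** The Jost amplitude [s] is normalised at infinity, where solutions for different [sigma] are
    compared; [S^>] carries its inhomogeneous term from [x0] and is recovered afterwards by division
    by a constant. The analysis at infinity starts from [a = x0 / 2], so that [x0] is interior to
    the region where the equations hold and two-sided derivatives exist there.

    One threshold in [theta] must serve all [x >= a], although [h = theta x^alpha] is unbounded. The
    interpolation [h / (1 + h) <= h^delta] with [delta = 1 / (2 alpha + 1)] gives
    [|M| <= K theta^delta x^(-3/2)]: part of the power of [theta] is given up for decay in [x]. This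
    makes the contractions work but loses the order in [theta] that item 3 requires.

    At [x0] all quantities are rational in [xi = r / (i s)] and [psi = xi - i b b']: [q = xi - 1],
    [R_{x0} = exp(-2 i phi) xi / (2 - xi)], [k = exp(-2 i phi) psi / (2 - psi)]. The linear parts of
    the last two differ by [b b' / (2 i) exp(-2 i phi)], the second term of the expansion; the third
    is the first Volterra iterate of the data [(1, 0)]. *)

Lemma continuous_plus_R (f g : R -> R) (x : R) :
  continuous f x -> continuous g x -> continuous (fun y => f y + g y) x.
Proof. apply (@continuous_plus R_UniformSpace R_AbsRing R_NormedModule). Qed.

Lemma continuous_minus_R (f g : R -> R) (x : R) :
  continuous f x -> continuous g x -> continuous (fun y => f y - g y) x.
Proof. apply (@continuous_minus R_UniformSpace R_AbsRing R_NormedModule). Qed.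

Lemma continuous_opp_R (f : R -> R) (x : R) :
  continuous f x -> continuous (fun y => - f y) x.
Proof. apply (@continuous_opp R_UniformSpace R_AbsRing R_NormedModule). Qed.

Lemma continuous_scal_R (k : R) (f : R -> R) (x : R) :
  continuous f x -> continuous (fun y => k * f y) x.
Proof. apply (@continuous_scal_r R_UniformSpace R_AbsRing R_NormedModule). Qed.

Lemma continuous_mult_R (f g : R -> R) (x : R) :
  continuous f x -> continuous g x -> continuous (fun y => f y * g y) x.
Proof. apply (@continuous_mult R_UniformSpace R_AbsRing). Qed.

Lemma exp_le_compat (x y : R) : x <= y -> exp x <= exp y.
Proof. intros [H| ->]; [apply Rlt_le, exp_increasing, H|apply Rle_refl]. Qed.

Lemma Rpower_opp_le (k x y : R) : 0 <= k -> 0 < x <= y -> Rpower y (- k) <= Rpower x (- k).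
Proof.
  intros Hk H. rewrite !Rpower_Ropp. apply Rinv_le_contravar; [apply exp_pos|].
  now apply Rle_Rpower_l.
Qed.

Lemma Rpower_opp_le_1 (k x : R) : 0 <= k -> 1 <= x -> 0 < Rpower x (- k) <= 1.
Proof.
  intros Hk Hx. split; [apply exp_pos|]. rewrite <- (Rpower_O x) by lra.
  apply Rle_Rpower; lra.
Qed.

Lemma Cmod_minus_le_0 (z w : C) : Cmod (z - w)%C <= 0 -> z = w.
Proof.
  intros H. replace z with (z - w + w)%C by ring. rewrite (Cmod_eq_0 (z - w)%C); [ring|].
  generalize (Cmod_ge_0 (z - w)%C); lra.
Qed.

Lemma Cmod_le_0 (z : C) : Cmod z <= 0 -> z = RtoC 0.
Proof. intros H. apply Cmod_eq_0. generalize (Cmod_ge_0 z); lra. Qed.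

Lemma is_derive_RC_iff (f : R -> C) (x : R) (l : C) :
  is_derive_RC f x l <->
  is_derive (fun y => Re (f y)) x (Re l) /\ is_derive (fun y => Im (f y)) x (Im l).
Proof.
  unfold is_derive_RC, is_derive. split.
  - intros H; split.
    + apply (filterdiff_ext_lin _ (fun y : R => fst (scal y l))).
      * apply (filterdiff_comp' f (fun z : C_R_NormedModule => fst z) x
          (fun y => scal y l) (fun z => fst z)); [exact H|].
        apply filterdiff_linear, is_linear_fst.
      * reflexivity.
    + apply (filterdiff_ext_lin _ (fun y : R => snd (scal y l))).
      * apply (filterdiff_comp' f (fun z : C_R_NormedModule => snd z) x
          (fun y => scal y l) (fun z => snd z)); [exact H|].
        apply filterdiff_linear, is_linear_snd.
      * reflexivity.
  - intros [H1 H2].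
    apply (filterdiff_ext (fun y => (Re (f y), Im (f y)) : C_R_NormedModule)).
    { intros y; destruct (f y); reflexivity. }
    apply (filterdiff_ext_lin _ (fun y : R => (scal y (Re l), scal y (Im l)) : C_R_NormedModule)).
    2: intros y; destruct l; reflexivity.
    apply (filterdiff_comp'_2 (fun y => Re (f y)) (fun y => Im (f y))
      (fun a b => (a, b) : C_R_NormedModule) x _ _ (fun a b => (a, b) : C_R_NormedModule));
      [exact H1|exact H2|].
    apply (filterdiff_ext (fun z => z)). intros [? ?]; reflexivity.
    apply (filterdiff_ext_lin _ (fun z => z)). 2: intros [? ?]; reflexivity.
    apply filterdiff_id.
Qed.

Lemma continuous_C_iff (f : R -> C) (x : R) :
  @continuous R_UniformSpace C_UniformSpace f x <->
  continuous (fun y => Re (f y)) x /\ continuous (fun y => Im (f y)) x.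
Proof.
  split.
  - intros H; split.
    + apply (continuous_comp f fst); [exact H|apply continuous_fst].
    + apply (continuous_comp f snd); [exact H|apply continuous_snd].
  - intros [H1 H2].
    apply (continuous_ext (fun y => (Re (f y), Im (f y)))).
    { intros y; destruct (f y); reflexivity. }
    apply (continuous_comp_2 (fun y => Re (f y)) (fun y => Im (f y)) (fun a b => (a,b)));
      [exact H1|exact H2|].
    apply (continuous_ext (fun z => z)). intros [? ?]; reflexivity. apply continuous_id.
Qed.

Definition cont_RC (f : R -> C) (x : R) : Prop :=
  @continuous R_UniformSpace C_UniformSpace f x.

Lemma C_eta (z w : C) : Re z = Re w -> Im z = Im w -> z = w.
Proof. destruct z, w; simpl; congruence. Qed.

Lemma is_derive_RC_eq (f : R -> C) (x : R) (l l' : C) :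
  is_derive_RC f x l -> l = l' -> is_derive_RC f x l'.
Proof. intros H <-; exact H. Qed.

Lemma is_derive_eq (f : R -> R) (x l l' : R) :
  is_derive f x l -> l = l' -> is_derive f x l'.
Proof. intros H <-; exact H. Qed.

Lemma is_derive_RC_ext_loc (f g : R -> C) (x : R) (l : C) :
  locally x (fun y => f y = g y) -> is_derive_RC f x l -> is_derive_RC g x l.
Proof. apply (@is_derive_ext_loc R_AbsRing C_R_NormedModule). Qed.

Lemma is_derive_RC_ext (f g : R -> C) (x : R) (l : C) :
  (forall y, f y = g y) -> is_derive_RC f x l -> is_derive_RC g x l.
Proof. apply (@is_derive_ext R_AbsRing C_R_NormedModule). Qed.

Lemma is_derive_RC_unique (f : R -> C) (x : R) (l l' : C) :
  is_derive_RC f x l -> is_derive_RC f x l' -> l = l'.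
Proof.
  intros H H'. apply is_derive_RC_iff in H. apply is_derive_RC_iff in H'.
  destruct H as [A B], H' as [A' B'].
  apply C_eta; [rewrite <- (is_derive_unique _ _ _ A) | rewrite <- (is_derive_unique _ _ _ B)];
    now apply is_derive_unique.
Qed.

Lemma is_derive_RC_const (z : C) (x : R) : is_derive_RC (fun _ => z) x (RtoC 0).
Proof. apply (@is_derive_const R_AbsRing C_R_NormedModule). Qed.

Lemma is_derive_RC_plus (f g : R -> C) (x : R) (a b : C) :
  is_derive_RC f x a -> is_derive_RC g x b ->
  is_derive_RC (fun y => f y + g y)%C x (a + b)%C.
Proof. apply (@is_derive_plus R_AbsRing C_R_NormedModule). Qed.

Lemma is_derive_RC_opp (f : R -> C) (x : R) (a : C) :
  is_derive_RC f x a -> is_derive_RC (fun y => - f y)%C x (- a)%C.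
Proof. apply (@is_derive_opp R_AbsRing C_R_NormedModule). Qed.

Lemma is_derive_RC_minus (f g : R -> C) (x : R) (a b : C) :
  is_derive_RC f x a -> is_derive_RC g x b ->
  is_derive_RC (fun y => f y - g y)%C x (a - b)%C.
Proof. apply (@is_derive_minus R_AbsRing C_R_NormedModule). Qed.

Lemma is_derive_RC_mult (f g : R -> C) (x : R) (a b : C) :
  is_derive_RC f x a -> is_derive_RC g x b ->
  is_derive_RC (fun y => f y * g y)%C x (a * g x + f x * b)%C.
Proof.
  rewrite !is_derive_RC_iff. intros [A1 A2] [B1 B2]. split; simpl.
  - eapply is_derive_eq.
    + apply @is_derive_minus; apply Derive.is_derive_mult; eassumption.
    + unfold minus, plus, opp; simpl; unfold Re, Im; ring.
  - eapply is_derive_eq.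
    + apply @is_derive_plus; apply Derive.is_derive_mult; eassumption.
    + unfold plus; simpl; unfold Re, Im; ring.
Qed.

Lemma is_derive_RC_RtoC (f : R -> R) (x l : R) :
  is_derive f x l -> is_derive_RC (fun y => RtoC (f y)) x (RtoC l).
Proof.
  intros H. apply is_derive_RC_iff; split; simpl; [exact H|apply @is_derive_const].
Qed.

Lemma Ci_sqr : (Ci * Ci)%C = (- RtoC 1)%C.
Proof. apply C_eta; simpl; ring. Qed.

(* [wave a b t] is [exp ((a + i b) t)]. *)
Definition wave (a b t : R) : C := (RtoC (exp (a * t)) * cis (b * t))%C.

Lemma is_derive_RC_cis (f : R -> R) (x l : R) :
  is_derive f x l -> is_derive_RC (fun y => cis (f y)) x (Ci * RtoC l * cis (f x))%C.
Proof.
  intros H. apply is_derive_RC_iff; split; simpl.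
  - eapply is_derive_eq. apply (is_derive_comp cos f). apply is_derive_cos. exact H.
    unfold scal; simpl; unfold mult; simpl; ring.
  - eapply is_derive_eq. apply (is_derive_comp sin f). apply is_derive_sin. exact H.
    unfold scal; simpl; unfold mult; simpl; ring.
Qed.

Lemma is_derive_RC_wave (a b : R) (f : R -> R) (x l : R) :
  is_derive f x l ->
  is_derive_RC (fun y => wave a b (f y)) x
    ((RtoC a + Ci * RtoC b) * RtoC l * wave a b (f x))%C.
Proof.
  intros H. unfold wave. eapply is_derive_RC_eq.
  - apply is_derive_RC_mult.
    + apply is_derive_RC_RtoC. apply (is_derive_comp exp (fun y => a * f y)).
      apply is_derive_exp. apply is_derive_scal. exact H.
    + apply (is_derive_RC_cis (fun y => b * f y)). apply is_derive_scal. exact H.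
  - unfold scal; simpl; unfold mult; simpl. apply C_eta; simpl; ring.
Qed.

Lemma Cmod_cis (t : R) : Cmod (cis t) = 1.
Proof.
  transitivity (sqrt 1); [|apply sqrt_1]. unfold Cmod, cis; simpl. f_equal.
  generalize (sin2_cos2 t); unfold Rsqr; lra.
Qed.

Lemma cis_plus (s t : R) : cis (s + t) = (cis s * cis t)%C.
Proof.
  unfold cis. apply C_eta; simpl; [rewrite cos_plus|rewrite sin_plus]; ring.
Qed.

Lemma cis_0 : cis 0 = RtoC 1.
Proof. unfold cis, RtoC. now rewrite cos_0, sin_0. Qed.

Lemma cis_neq_0 (t : R) : cis t <> RtoC 0.
Proof. intros H. generalize (Cmod_cis t). rewrite H, Cmod_0. lra. Qed.

Lemma Cmod_wave (a b t : R) : Cmod (wave a b t) = exp (a * t).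
Proof.
  unfold wave. rewrite Cmod_mult, Cmod_cis, Cmod_R, Rabs_right; [ring|].
  apply Rle_ge, Rlt_le, exp_pos.
Qed.

Lemma wave_0_r (a b : R) : wave a b 0 = RtoC 1.
Proof. unfold wave. rewrite !Rmult_0_r, exp_0, cis_0. ring. Qed.

Lemma wave_neq_0 (a b t : R) : wave a b t <> RtoC 0.
Proof.
  intros H. generalize (Cmod_wave a b t). rewrite H, Cmod_0.
  generalize (exp_pos (a * t)); lra.
Qed.

Lemma wave_imag (b t : R) : wave 0 b t = cis (b * t).
Proof. unfold wave. rewrite Rmult_0_l, exp_0. ring. Qed.

Lemma is_derive_RC_continuous (f : R -> C) (x : R) (l : C) :
  is_derive_RC f x l -> cont_RC f x.
Proof.
  intros H. apply is_derive_RC_iff in H. destruct H as [A B].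
  apply continuous_C_iff. split; apply (ex_derive_continuous (V := R_NormedModule)); eexists; eassumption.
Qed.

Lemma cont_RC_plus (f g : R -> C) (x : R) :
  cont_RC f x -> cont_RC g x -> cont_RC (fun y => f y + g y)%C x.
Proof.
  unfold cont_RC. rewrite !continuous_C_iff. intros [A1 A2] [B1 B2]. split; simpl;
  apply continuous_plus_R; assumption.
Qed.

Lemma cont_RC_opp (f : R -> C) (x : R) :
  cont_RC f x -> cont_RC (fun y => - f y)%C x.
Proof.
  unfold cont_RC. rewrite !continuous_C_iff. intros [A1 A2]. split; simpl;
  apply continuous_opp_R; assumption.
Qed.

Lemma cont_RC_minus (f g : R -> C) (x : R) :
  cont_RC f x -> cont_RC g x -> cont_RC (fun y => f y - g y)%C x.
Proof. intros A B. apply cont_RC_plus; [exact A|]. now apply cont_RC_opp. Qed.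

Lemma cont_RC_mult (f g : R -> C) (x : R) :
  cont_RC f x -> cont_RC g x -> cont_RC (fun y => f y * g y)%C x.
Proof.
  unfold cont_RC. rewrite !continuous_C_iff. intros [A1 A2] [B1 B2]. split; simpl.
  - apply continuous_minus_R;
      apply continuous_mult_R; assumption.
  - apply continuous_plus_R;
      apply continuous_mult_R; assumption.
Qed.

Lemma cont_RC_const (z : C) (x : R) : cont_RC (fun _ => z) x.
Proof. apply continuous_const. Qed.

Lemma cont_RC_RtoC (f : R -> R) (x : R) :
  continuous f x -> cont_RC (fun y => RtoC (f y)) x.
Proof.
  intros H. apply continuous_C_iff. split; simpl; [exact H|apply continuous_const].
Qed.

Lemma cont_RC_comp (g : R -> R) (f : R -> C) (x : R) :
  continuous g x -> cont_RC f (g x) -> cont_RC (fun y => f (g y)) x.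
Proof. intros Hg Hf. now apply (continuous_comp g f). Qed.

Lemma cont_RC_cis (f : R -> R) (x : R) :
  continuous f x -> cont_RC (fun y => cis (f y)) x.
Proof.
  intros H. apply continuous_C_iff. split; simpl.
  - apply (continuous_comp f cos); [exact H|apply continuous_cos].
  - apply (continuous_comp f sin); [exact H|apply continuous_sin].
Qed.

Lemma cont_RC_wave (a b : R) (f : R -> R) (x : R) :
  continuous f x -> cont_RC (fun y => wave a b (f y)) x.
Proof.
  intros H. apply (cont_RC_comp f (wave a b)); [exact H|].
  apply (is_derive_RC_continuous _ _ ((RtoC a + Ci * RtoC b) * RtoC 1 * wave a b (f x))%C).
  apply (is_derive_RC_wave a b (fun y => y)). apply @is_derive_id.
Qed.

Lemma cont_RC_ext (f g : R -> C) (x : R) :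
  (forall y, f y = g y) -> cont_RC f x -> cont_RC g x.
Proof. apply (@continuous_ext R_UniformSpace C_UniformSpace). Qed.

Lemma cont_RC_ext_loc (f g : R -> C) (x : R) :
  locally x (fun y => f y = g y) -> cont_RC f x -> cont_RC g x.
Proof. apply (@continuous_ext_loc R_UniformSpace C_UniformSpace). Qed.

Lemma Cmod_Re (z : C) : Rabs (Re z) <= Cmod z.
Proof. eapply Rle_trans; [|apply Rmax_Cmod]. apply Rmax_l. Qed.

Lemma Cmod_Im (z : C) : Rabs (Im z) <= Cmod z.
Proof. eapply Rle_trans; [|apply Rmax_Cmod]. apply Rmax_r. Qed.

Lemma Cmod_le_abs (z : C) : Cmod z <= Rabs (Re z) + Rabs (Im z).
Proof.
  destruct z as [a b]; simpl. unfold Cmod; simpl.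
  apply Rsqr_incr_0_var.
  - rewrite Rsqr_sqrt by nra. unfold Rsqr.
    generalize (Rabs_pos a) (Rabs_pos b); intros.
    assert (a * a = Rabs a * Rabs a) by (rewrite <- Rabs_mult, Rabs_right; nra).
    assert (b * b = Rabs b * Rabs b) by (rewrite <- Rabs_mult, Rabs_right; nra).
    nra.
  - generalize (Rabs_pos a) (Rabs_pos b); lra.
Qed.

Lemma cont_RC_eps (f : R -> C) (x : R) :
  cont_RC f x <->
  forall eps : R, 0 < eps -> exists d : R, 0 < d /\
    forall y, Rabs (y - x) < d -> Cmod (f y - f x)%C < eps.
Proof.
  unfold cont_RC. rewrite continuous_C_iff. split.
  - intros [A B] eps He.
    assert (A' := proj1 (filterlim_locally _ _) A (mkposreal (eps / 2) ltac:(lra))).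
    assert (B' := proj1 (filterlim_locally _ _) B (mkposreal (eps / 2) ltac:(lra))).
    destruct (filter_and _ _ A' B') as [d Hd].
    exists d. split; [apply cond_pos|]. intros y Hy.
    destruct (Hd y Hy) as [H1 H2].
    eapply Rle_lt_trans; [apply Cmod_le_abs|].
    change (Rabs (Re (f y) - Re (f x)) < eps / 2) in H1.
    change (Rabs (Im (f y) - Im (f x)) < eps / 2) in H2.
    change (Rabs (Re (f y) - Re (f x)) + Rabs (Im (f y) - Im (f x)) < eps). lra.
  - intros H; split; apply filterlim_locally; intros [e He];
      destruct (H e He) as [d [Hd Hd']]; exists (mkposreal d Hd); intros y Hy;
      specialize (Hd' y Hy).
    + eapply Rle_lt_trans; [|exact Hd']. apply (Cmod_Re (f y - f x)%C).
    + eapply Rle_lt_trans; [|exact Hd']. apply (Cmod_Im (f y - f x)%C).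
Qed.

Lemma Cmod_triangle_le (z w : C) (K : R) : Cmod z + Cmod w <= K -> Cmod (z + w)%C <= K.
Proof. apply Rle_trans, Cmod_triangle. Qed.

Lemma Cmod_Re_conj_mult (z w : C) : Rabs (Re z * Re w + Im z * Im w) <= Cmod z * Cmod w.
Proof.
  replace (Re z * Re w + Im z * Im w) with (Re (z * Cconj w)%C)
    by (destruct z, w; simpl; ring).
  eapply Rle_trans; [apply Cmod_Re|].
  rewrite Cmod_mult, Cmod_conj. apply Rle_refl.
Qed.

(** * Mean value inequalities and tail integrals *)

Lemma nondecreasing_of_derive (f df : R -> R) (a b : R) :
  a <= b ->
  (forall x, a <= x <= b -> is_derive f x (df x) /\ 0 <= df x) ->
  f a <= f b.
Proof.
  intros Hab Hd.
  destruct (MVT_gen f a b df) as [c [Hc1 Hc2]]; rewrite ?Rmin_left, ?Rmax_right in * by lra.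
  - intros x Hx. apply Hd. lra.
  - intros x Hx. apply continuity_pt_filterlim.
    eapply (ex_derive_continuous (V := R_NormedModule)). eexists. apply Hd, Hx.
  - destruct (Hd c Hc1). nra.
Qed.

(** Pairing [H] with the fixed direction [w = H b - H a] reduces the complex case to the
    monotonicity of one real function, by Cauchy-Schwarz. Pointwise derivatives suffice, so no
    integral of [h] has to exist. *)
Lemma mean_value_inequality (H h : R -> C) (G g : R -> R) (a b : R) :
  a <= b ->
  (forall x, a <= x <= b ->
     is_derive_RC H x (h x) /\ is_derive G x (g x) /\ Cmod (h x) <= g x) ->
  Cmod (H b - H a)%C <= G b - G a.
Proof.
  intros Hab Hd.
  set (w := (H b - H a)%C).
  set (psi := fun x => Cmod w * G x - (Re w * Re (H x) + Im w * Im (H x))).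
  assert (Hpsi : psi a <= psi b).
  { apply (nondecreasing_of_derive psi
      (fun x => Cmod w * g x - (Re w * Re (h x) + Im w * Im (h x))) a b Hab).
    intros x Hx. destruct (Hd x Hx) as [H1 [H2 H3]].
    apply is_derive_RC_iff in H1. destruct H1 as [Hr Hi]. split.
    - unfold psi. apply @is_derive_minus; [now apply is_derive_scal|].
      apply @is_derive_plus; now apply is_derive_scal.
    - generalize (Cmod_Re_conj_mult w (h x)) (Cmod_ge_0 w); intros Hw Hw0.
      apply Rabs_le_between in Hw. nra. }
  assert (HG : G a <= G b).
  { apply (nondecreasing_of_derive G g a b Hab).
    intros x Hx. destruct (Hd x Hx) as [_ [H2 H3]]. split; [exact H2|].
    eapply Rle_trans; [apply Cmod_ge_0|exact H3]. }
  destruct (Rle_lt_or_eq_dec 0 (Cmod w) (Cmod_ge_0 w)) as [Hw|Hw]; [|lra].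
  assert (Hsq : Re w * (Re (H b) - Re (H a)) + Im w * (Im (H b) - Im (H a)) = Cmod w * Cmod w).
  { change (Re (H b) - Re (H a)) with (Re w). change (Im (H b) - Im (H a)) with (Im w).
    unfold Cmod. rewrite sqrt_sqrt by nra. unfold Re, Im. ring. }
  unfold psi in Hpsi.
  apply Rmult_le_reg_l with (Cmod w); [exact Hw|]. lra.
Qed.

Lemma lipschitz_bound (H h : R -> C) (K a b : R) :
  a <= b ->
  (forall x, a <= x <= b -> is_derive_RC H x (h x) /\ Cmod (h x) <= K) ->
  Cmod (H b - H a)%C <= K * (b - a).
Proof.
  intros Hab Hd. rewrite Rmult_minus_distr_l.
  apply (mean_value_inequality H h (fun t => K * t) (fun _ => K) a b Hab).
  intros x Hx. destruct (Hd x Hx) as [H1 H2]. split; [exact H1|]. split; [|exact H2].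
  auto_derive; [exact Logic.I|ring].
Qed.

Definition vanishes_at_infinity (f : R -> C) : Prop :=
  forall eps : R, 0 < eps -> exists A : R, forall x, A <= x -> Cmod (f x) <= eps.

Lemma Rpower_opp_vanishes (kappa eps : R) :
  0 < kappa -> 0 < eps ->
  exists A : R, 0 < A /\ forall x, A <= x -> Rpower x (- kappa) <= eps.
Proof.
  intros Hk He. exists (Rpower eps (- / kappa)). split; [apply exp_pos|].
  intros x Hx.
  assert (H : Rpower (Rpower eps (- / kappa)) kappa <= Rpower x kappa).
  { apply Rle_Rpower_l; [lra|]. split; [apply exp_pos|exact Hx]. }
  rewrite Rpower_mult in H.
  replace (- / kappa * kappa) with (- (1)) in H by (field; lra).
  rewrite Rpower_Ropp, Rpower_1 in H by exact He.
  rewrite Rpower_Ropp. rewrite <- (Rinv_inv eps). apply Rinv_le_contravar; [|exact H].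
  now apply Rinv_0_lt_compat.
Qed.

Lemma is_derive_Rpower (a x : R) :
  0 < x -> is_derive (fun y => Rpower y a) x (a * Rpower x (a - 1)).
Proof. intros Hx. apply is_derive_Reals. now apply derivable_pt_lim_power. Qed.

Lemma vanishes_0 : vanishes_at_infinity (fun _ => RtoC 0).
Proof. intros eps He. exists 0. intros. rewrite Cmod_0. lra. Qed.

Lemma vanishes_scal (z : C) (f : R -> C) :
  vanishes_at_infinity f -> vanishes_at_infinity (fun x => z * f x)%C.
Proof.
  intros Hf eps He. assert (Hz := Cmod_ge_0 z).
  destruct (Hf (eps / (Cmod z + 1))) as [A HA]; [apply Rdiv_lt_0_compat; lra|].
  exists A. intros x Hx. specialize (HA x Hx). apply Rle_div_r in HA; [|lra].
  rewrite Cmod_mult. generalize (Cmod_ge_0 (f x)). nra.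
Qed.

Lemma vanishes_minus (f g : R -> C) :
  vanishes_at_infinity f -> vanishes_at_infinity g ->
  vanishes_at_infinity (fun x => f x - g x)%C.
Proof.
  intros Hf Hg eps He.
  destruct (Hf (eps / 2)) as [A HA]; [lra|]. destruct (Hg (eps / 2)) as [B HB]; [lra|].
  exists (Rmax A B). intros x Hx.
  specialize (HA x (Rle_trans _ _ _ (Rmax_l _ _) Hx)).
  specialize (HB x (Rle_trans _ _ _ (Rmax_r _ _) Hx)).
  apply Cmod_triangle_le. rewrite Cmod_opp. lra.
Qed.

(** The bound is the exact increment of the primitive [-(K / kappa) t^(-kappa)]. The negative term
    is kept so that an increment from [x0] to [x] and a tail from [x] add up to the tail from [x0]
    without loss. *)
Lemma power_increment_bound (H h : R -> C) (kappa K x y : R) :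
  0 < kappa -> 0 < x -> x <= y ->
  (forall t, x <= t <= y ->
     is_derive_RC H t (h t) /\ Cmod (h t) <= K * Rpower t (- (1 + kappa))) ->
  Cmod (H y - H x)%C <= K / kappa * Rpower x (- kappa) - K / kappa * Rpower y (- kappa).
Proof.
  intros Hk Hx Hxy Hd.
  apply Rle_trans with ((fun t => - (K / kappa) * Rpower t (- kappa)) y
    - (fun t => - (K / kappa) * Rpower t (- kappa)) x); [|simpl; lra].
  apply (mean_value_inequality H h (fun t => - (K / kappa) * Rpower t (- kappa))
    (fun t => K * Rpower t (- (1 + kappa)))); [exact Hxy|].
  intros t Ht. destruct (Hd t Ht) as [H1 H2]. split; [exact H1|]. split; [|exact H2].
  eapply is_derive_eq.
  - apply is_derive_scal, is_derive_Rpower. lra.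
  - replace (- kappa - 1) with (- (1 + kappa)) by ring. field. lra.
Qed.

(** Limit of the increment bound as the right end goes to infinity. All later estimates of integrals
    up to infinity go through this lemma, applied to a primitive that vanishes there. *)
Lemma tail_bound (H h : R -> C) (a kappa K : R) :
  0 < a -> 0 < kappa ->
  (forall x, a <= x -> is_derive_RC H x (h x)) ->
  (forall x, a <= x -> Cmod (h x) <= K * Rpower x (- (1 + kappa))) ->
  vanishes_at_infinity H ->
  forall x, a <= x -> Cmod (H x) <= K / kappa * Rpower x (- kappa).
Proof.
  intros Ha Hk Hd Hb Hv x Hx.
  assert (HK : 0 <= K).
  { generalize (Hb a (Rle_refl a)) (Cmod_ge_0 (h a)) (exp_pos (- (1 + kappa) * ln a)).
    unfold Rpower; intros; nra. }
  apply le_epsilon. intros eps He.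
  destruct (Hv eps He) as [A HA].
  set (y := Rmax A x).
  assert (Hy : x <= y) by apply Rmax_r.
  specialize (HA y (Rmax_l _ _)).
  assert (Hm : Cmod (H y - H x)%C <= K / kappa * Rpower x (- kappa) - K / kappa * Rpower y (- kappa)).
  { apply (power_increment_bound H h); try lra. intros t Ht. split; [apply Hd|apply Hb]; lra. }
  assert (Hp : 0 <= K / kappa * Rpower y (- kappa)).
  { apply Rmult_le_pos; [|apply Rlt_le, exp_pos]. apply Rdiv_le_0_compat; lra. }
  replace (H x) with (H y - (H y - H x))%C by ring.
  apply Cmod_triangle_le. rewrite Cmod_opp. lra.
Qed.

(** * Primitives vanishing at infinity and improper integrals *)

Definition primitive_RC (f : R -> C) (x : R) : C := RInt_RC f 0 x.

Lemma is_derive_primitive_RC (f : R -> C) (x : R) :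
  (forall y, cont_RC f y) -> is_derive_RC (primitive_RC f) x (f x).
Proof.
  intros Hf. apply (@is_derive_RInt C_R_CompleteNormedModule f (primitive_RC f) 0 x).
  - exists (mkposreal 1 Rlt_0_1). intros y _.
    apply (@RInt_correct C_R_CompleteNormedModule).
    apply (@ex_RInt_continuous C_R_CompleteNormedModule). intros z _. apply Hf.
  - apply Hf.
Qed.

Lemma cauchy_limit (f : R -> R) :
  (forall eps, 0 < eps -> exists A, forall x y, A <= x -> A <= y -> Rabs (f y - f x) < eps) ->
  exists l : R, forall eps, 0 < eps -> exists A, forall x, A <= x -> Rabs (f x - l) < eps.
Proof.
  intros H.
  destruct (proj1 (@filterlim_locally_cauchy R R_CompleteSpace (Rbar_locally p_infty) _ f)) as [l Hl].
  - intros eps. destruct (H eps (cond_pos eps)) as [A HA].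
    exists (fun x => A <= x). split.
    + exists A. intros; lra.
    + intros u v Hu Hv. apply HA; assumption.
  - exists l. intros eps He.
    destruct (proj1 (filterlim_locally f l) Hl (mkposreal eps He)) as [A HA].
    exists (A + 1). intros x Hx. apply (HA x). lra.
Qed.

(** The primitive from [0] is Cauchy at infinity by the increment bound; subtracting its limit,
    taken on real and imaginary parts, normalises it. *)
Lemma exists_primitive_vanishing (f : R -> C) (a kappa K : R) :
  0 < a -> 0 < kappa ->
  (forall y, cont_RC f y) ->
  (forall x, a <= x -> Cmod (f x) <= K * Rpower x (- (1 + kappa))) ->
  exists H : R -> C,
    (forall x, is_derive_RC H x (f x)) /\ vanishes_at_infinity H.
Proof.
  intros Ha Hk Hf Hb.
  assert (HK : 0 <= K).
  { generalize (Hb a (Rle_refl a)) (Cmod_ge_0 (f a)) (exp_pos (- (1 + kappa) * ln a)).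
    unfold Rpower; intros; nra. }
  set (F := primitive_RC f).
  assert (HF : forall x, is_derive_RC F x (f x)) by (intros; now apply is_derive_primitive_RC).
  assert (Hm : forall x y, a <= x -> x <= y ->
     Cmod (F y - F x)%C <= K / kappa * Rpower x (- kappa)).
  { intros x y Hx Hxy.
    assert (Hp : 0 <= K / kappa * Rpower y (- kappa)).
    { apply Rmult_le_pos; [|apply Rlt_le, exp_pos]. apply Rdiv_le_0_compat; lra. }
    apply Rle_trans with (K / kappa * Rpower x (- kappa) - K / kappa * Rpower y (- kappa)); [|lra].
    apply (power_increment_bound F f); try lra. intros t Ht. split; [apply HF|apply Hb; lra]. }
  assert (Hc : forall eps, 0 < eps -> exists A, forall x y, A <= x -> A <= y ->
     Cmod (F y - F x)%C < eps).
  { intros eps He.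
    destruct (Rpower_opp_vanishes kappa (eps / 2 / (K / kappa + 1)) Hk) as [A [HA0 HA]].
    { assert (0 <= K / kappa) by (apply Rdiv_le_0_compat; lra).
      repeat apply Rdiv_lt_0_compat; lra. }
    assert (Hs : forall x y, Rmax A a <= x -> x <= y -> Cmod (F y - F x)%C < eps).
    { intros x y Hx Hxy. eapply Rle_lt_trans.
      - apply Hm; [|exact Hxy]. eapply Rle_trans; [apply Rmax_r|exact Hx].
      - assert (0 <= K / kappa) by (apply Rdiv_le_0_compat; lra).
        assert (Hq : Rpower x (- kappa) <= eps / 2 / (K / kappa + 1)).
        { apply HA. eapply Rle_trans; [apply Rmax_l|exact Hx]. }
        apply Rle_lt_trans with (K / kappa * (eps / 2 / (K / kappa + 1))).
        + now apply Rmult_le_compat_l.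
        + apply Rle_lt_trans with (eps / 2); [|lra].
          set (u := K / kappa) in *.
          replace (u * (eps / 2 / (u + 1))) with (eps / 2 - eps / 2 / (u + 1)) by (field; lra).
          assert (0 < eps / 2 / (u + 1)) by (apply Rdiv_lt_0_compat; lra). lra. }
    exists (Rmax A a). intros x y Hx Hy. destruct (Rle_dec x y) as [Hxy|Hxy].
    - now apply Hs.
    - replace (F y - F x)%C with (- (F x - F y))%C by ring. rewrite Cmod_opp.
      apply Hs; lra. }
  destruct (cauchy_limit (fun x => Re (F x))) as [l1 Hl1].
  { intros eps He. destruct (Hc eps He) as [A HA]. exists A. intros x y Hx Hy.
    eapply Rle_lt_trans; [apply (Cmod_Re (F y - F x)%C)|]. now apply HA. }
  destruct (cauchy_limit (fun x => Im (F x))) as [l2 Hl2].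
  { intros eps He. destruct (Hc eps He) as [A HA]. exists A. intros x y Hx Hy.
    eapply Rle_lt_trans; [apply (Cmod_Im (F y - F x)%C)|]. now apply HA. }
  exists (fun x => F x - (l1, l2))%C. split.
  - intros x. eapply is_derive_RC_eq.
    + apply is_derive_RC_minus; [apply HF|apply is_derive_RC_const].
    + ring.
  - intros eps He. destruct (Hl1 (eps / 2)) as [A1 HA1]; [lra|].
    destruct (Hl2 (eps / 2)) as [A2 HA2]; [lra|].
    exists (Rmax A1 A2). intros x Hx.
    eapply Rle_trans; [apply Cmod_le_abs|].
    specialize (HA1 x (Rle_trans _ _ _ (Rmax_l _ _) Hx)).
    specialize (HA2 x (Rle_trans _ _ _ (Rmax_r _ _) Hx)).
    change (Rabs (Re (F x) - l1) + Rabs (Im (F x) - l2) <= eps). lra.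
Qed.

(** Chosen by [epsilon] to be a total operator on functions, so that an integral operator can be
    written down for every [f]. Its value is meaningful for integrands that decay as in
    [prim_inf_spec]. *)
Definition prim_inf (f : R -> C) : R -> C :=
  epsilon (inhabits (fun _ => RtoC 0))
    (fun H => (forall x, is_derive_RC H x (f x)) /\ vanishes_at_infinity H).

Lemma prim_inf_spec (f : R -> C) (a kappa K : R) :
  0 < a -> 0 < kappa ->
  (forall y, cont_RC f y) ->
  (forall x, a <= x -> Cmod (f x) <= K * Rpower x (- (1 + kappa))) ->
  (forall x, is_derive_RC (prim_inf f) x (f x)) /\ vanishes_at_infinity (prim_inf f).
Proof.
  intros. unfold prim_inf. apply epsilon_spec. eapply (exists_primitive_vanishing f a kappa K); assumption.
Qed.

(** Newton-Leibniz with limits at both ends. The filters are left general because three kinds occur: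
    infinity, the right neighbourhood of [0], and the [within] filter of [V_int]. *)
Lemma is_RInt_gen_primitive {V : CompleteNormedModule R_AbsRing} (f H : R -> V)
  (Fa Fb : (R -> Prop) -> Prop) {FFa : Filter Fa} {FFb : Filter Fb} (la lb : V) :
  filter_prod Fa Fb (fun ab => forall x, Rmin (fst ab) (snd ab) <= x <= Rmax (fst ab) (snd ab) ->
     is_derive H x (f x) /\ continuous f x) ->
  filterlim H Fa (locally la) -> filterlim H Fb (locally lb) ->
  is_RInt_gen f Fa Fb (minus lb la).
Proof.
  intros Hd Ha Hb. unfold is_RInt_gen.
  apply (filterlimi_lim_ext_loc (fun ab => minus (H (snd ab)) (H (fst ab)))).
  - revert Hd. apply filter_imp. intros [a b]; simpl. intros Hd.
    apply (is_RInt_derive H f); intros x Hx; apply Hd; exact Hx.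
  - unfold minus. apply (filterlim_comp_2 (F := filter_prod Fa Fb) (G := locally lb) (H := locally (opp la))).
    + apply (filterlim_comp _ _ _ snd H _ Fb); [apply filterlim_snd|exact Hb].
    + apply (filterlim_comp _ _ _ (fun ab => H (fst ab)) opp _ (locally la)).
      * apply (filterlim_comp _ _ _ fst H _ Fa); [apply filterlim_fst|exact Ha].
      * exact (@filterlim_opp R_AbsRing (CompleteNormedModule.NormedModule R_AbsRing V) la).
    + exact (@filterlim_plus R_AbsRing (CompleteNormedModule.NormedModule R_AbsRing V) lb (opp la)).
Qed.

Lemma vanishes_filterlim (H : R -> C) :
  vanishes_at_infinity H ->
  filterlim H (Rbar_locally p_infty) (@locally C_UniformSpace (RtoC 0)).
Proof.
  intros Hv. apply filterlim_locally. intros eps.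
  destruct (Hv (eps / 2)) as [A HA]; [generalize (cond_pos eps); lra|].
  exists A. intros x Hx. specialize (HA x (Rlt_le _ _ Hx)).
  generalize (cond_pos eps); intros He.
  split; [change (Rabs (Re (H x) - 0) < eps)|change (Rabs (Im (H x) - 0) < eps)];
    rewrite Rminus_0_r.
  - generalize (Cmod_Re (H x)); lra.
  - generalize (Cmod_Im (H x)); lra.
Qed.

Lemma is_RInt_gen_tail (f H : R -> C) (x : R) :
  (forall y, x <= y -> is_derive_RC H y (f y) /\ cont_RC f y) ->
  vanishes_at_infinity H ->
  @is_RInt_gen C_R_CompleteNormedModule f (at_point x) (Rbar_locally p_infty) (- H x)%C.
Proof.
  intros Hd Hv.
  replace (- H x)%C with (minus (RtoC 0 : C_R_CompleteNormedModule) (H x))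
    by (change ((RtoC 0) - H x = - H x)%C; ring).
  apply (is_RInt_gen_primitive (V := C_R_CompleteNormedModule) f H); [typeclasses eauto|typeclasses eauto| | |].
  - apply (Filter_prod _ _ _ (fun a => a = x) (fun b => x < b)).
    + reflexivity.
    + exists x. intros; assumption.
    + intros a b -> Hb y. simpl. rewrite Rmin_left by lra. intros Hy. apply Hd. lra.
  - intros P HP. apply (locally_singleton _ _ HP).
  - now apply vanishes_filterlim.
Qed.

Lemma RInt_RC_primitive (f H : R -> C) (a b : R) :
  a <= b ->
  (forall y, a <= y <= b -> is_derive_RC H y (f y) /\ cont_RC f y) ->
  RInt_RC f a b = (H b - H a)%C.
Proof.
  intros Hab Hd. apply (@is_RInt_unique C_R_CompleteNormedModule).
  apply (is_RInt_derive (V := C_R_CompleteNormedModule) H f); rewrite Rmin_left, Rmax_right by lra;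
    intros x Hx; apply Hd; exact Hx.
Qed.

(** Properness makes the limit that defines [V_int] unique; at [x = 0] it holds because [0] is an
    accumulation point of [(0, x0]]. *)
Lemma within_proper (x0 x : R) : 0 < x0 -> 0 <= x <= x0 ->
  ProperFilter (within (fun y => 0 < y <= x0) (locally x)).
Proof.
  intros H0 Hx. constructor; [|apply within_filter, locally_filter].
  intros P [eps HP].
  destruct (Rle_lt_or_eq_dec 0 x (proj1 Hx)) as [Hp|Hp].
  - exists x. apply (HP x); [apply ball_center|lra].
  - generalize (cond_pos eps); intros He.
    exists (Rmin x0 (eps / 2)). apply HP.
    + change (Rabs (Rmin x0 (eps / 2) - x) < eps). subst x.
      rewrite Rminus_0_r, Rabs_right.
      * eapply Rle_lt_trans; [apply Rmin_r|lra].
      * apply Rle_ge, Rmin_glb; lra.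
    + split; [apply Rmin_glb_lt; lra|apply Rmin_l].
Qed.

(** Continuity of the primitive [H] at [x] takes the place of integrability of the integrand, which
    may blow up at [x = 0]. The function [ht] is a closed form of the integrand where the latter is
    meaningful. *)
Lemma V_int_primitive (x0 : R) (h ht H : R -> C) (x : R) :
  0 < x0 -> 0 <= x <= x0 ->
  (forall y, 0 < y <= x0 -> h y = ht y) ->
  (forall y, 0 < y -> is_derive_RC H y (ht y) /\ cont_RC ht y) ->
  cont_RC H x ->
  V_int x0 h x = (H x - H x0)%C.
Proof.
  intros H0 Hx Hh Hd Hc. unfold V_int, RInt_gen_RC.
  assert (Hp := within_proper x0 x H0 Hx).
  apply (is_RInt_gen_unique (V := C_R_CompleteNormedModule)).
  apply (is_RInt_gen_ext ht).
  { apply (Filter_prod _ _ _ (fun a => a = x0) (fun b => 0 < b <= x0)).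
    - reflexivity.
    - exists (mkposreal 1 Rlt_0_1). intros y _ Hy; exact Hy.
    - intros a b -> Hb y. simpl. rewrite Rmin_right, Rmax_left by lra. intros Hy.
      symmetry; apply Hh. lra. }
  apply (is_RInt_gen_primitive (V := C_R_CompleteNormedModule) ht H); [typeclasses eauto|typeclasses eauto| | |].
  - apply (Filter_prod _ _ _ (fun a => a = x0) (fun b => 0 < b <= x0)).
    + reflexivity.
    + exists (mkposreal 1 Rlt_0_1). intros y _ Hy; exact Hy.
    + intros a b -> Hb y. simpl. rewrite Rmin_right, Rmax_left by lra. intros Hy.
      apply Hd. lra.
  - intros P HP. apply (locally_singleton _ _ HP).
  - intros P HP. specialize (Hc P HP). unfold filtermap, within in *.
    revert Hc. apply filter_imp. intros; assumption.
Qed.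

Lemma RInt_gen_at_right_primitive (x0 : R) (h H : R -> C) :
  0 < x0 ->
  (forall y, 0 < y -> is_derive_RC H y (h y) /\ cont_RC h y) ->
  cont_RC H 0 ->
  RInt_gen_RC h (at_right 0) (at_point x0) = (H x0 - H 0)%C.
Proof.
  intros H0 Hd Hc. apply (is_RInt_gen_unique (V := C_R_CompleteNormedModule)).
  apply (is_RInt_gen_primitive (V := C_R_CompleteNormedModule) h H); [typeclasses eauto|typeclasses eauto| | |].
  - apply (Filter_prod _ _ _ (fun a => 0 < a) (fun b => b = x0)).
    + exists (mkposreal 1 Rlt_0_1). intros y _ Hy; exact Hy.
    + reflexivity.
    + intros a b Ha -> y. simpl. intros Hy. apply Hd.
      eapply Rlt_le_trans; [|apply Hy]. apply Rmin_glb_lt; assumption.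
  - intros P HP. specialize (Hc P HP). unfold filtermap, at_right, within in *.
    revert Hc. apply filter_imp. intros; assumption.
  - intros P HP. apply (locally_singleton _ _ HP).
Qed.

(** * Fixed points of contractions *)

Lemma series_limit (f : nat -> R) (B : R) :
  (forall n, Rabs (f (S n) - f n) <= B * (/ 2) ^ n) ->
  exists l, forall n, Rabs (l - f n) <= 2 * B * (/ 2) ^ n.
Proof.
  intros H.
  assert (HB : 0 <= B).
  { generalize (H O) (Rabs_pos (f 1%nat - f O)); simpl; lra. }
  assert (Hpow : forall n, 0 < (/ 2) ^ n) by (intros; apply pow_lt; lra).
  assert (Hd : forall n m, Rabs (f (n + m)%nat - f n) <= 2 * B * ((/ 2) ^ n - (/ 2) ^ (n + m))).
  { intros n m. induction m as [|m IH].
    - rewrite Nat.add_0_r, Rminus_diag, Rabs_R0. lra.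
    - rewrite Nat.add_succ_r.
      replace (f (S (n + m)) - f n) with ((f (S (n + m)) - f (n + m)%nat) + (f (n + m)%nat - f n)) by ring.
      eapply Rle_trans; [apply Rabs_triang|]. specialize (H (n + m)%nat).
      simpl. lra. }
  destruct (Rcomplete.R_complete f) as [l Hl].
  - intros eps He.
    assert (Hlim : is_lim_seq (fun n => (/ 2) ^ n) 0).
    { apply is_lim_seq_geom. rewrite Rabs_right; lra. }
    assert (Hq : 0 < eps / (2 * B + 1) / 2) by (repeat apply Rdiv_lt_0_compat; lra).
    destruct (proj1 (filterlim_locally _ _) Hlim (mkposreal _ Hq)) as [N HN].
    exists N.
    assert (Hn : forall n, (N <= n)%nat -> Rabs (f n - f N) < eps / 2).
    { intros n Hn. replace n with (N + (n - N))%nat by lia.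
      eapply Rle_lt_trans; [apply Hd|].
      specialize (HN N (le_n N)). change (Rabs ((/ 2) ^ N - 0) < eps / (2 * B + 1) / 2) in HN.
      rewrite Rminus_0_r, Rabs_right in HN by (apply Rle_ge, Rlt_le, Hpow).
      assert (H1 := Hpow (N + (n - N))%nat).
      apply Rle_lt_trans with (2 * B * (/ 2) ^ N); [nra|].
      apply Rle_lt_trans with (2 * B * (eps / (2 * B + 1) / 2)); [nra|].
      assert (H2 : 0 < eps / (2 * B + 1)) by (apply Rdiv_lt_0_compat; lra).
      replace (2 * B * (eps / (2 * B + 1) / 2)) with (eps / 2 - eps / (2 * B + 1) / 2) by (field; lra).
      lra. }
    intros n m Hn1 Hm1. unfold Rdist.
    replace (f n - f m) with ((f n - f N) - (f m - f N)) by ring.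
    eapply Rle_lt_trans; [apply Rabs_triang|]. rewrite Rabs_Ropp.
    generalize (Hn n Hn1) (Hn m Hm1); lra.
  - exists l. intros n. apply le_epsilon. intros eps He.
    destruct (Hl eps He) as [N HN].
    specialize (HN (n + N)%nat ltac:(lia)). unfold Rdist in HN.
    replace (l - f n) with ((l - f (n + N)%nat) + (f (n + N)%nat - f n)) by ring.
    eapply Rle_trans; [apply Rabs_triang|]. rewrite (Rabs_minus_sym l).
    generalize (Hd n N) (Hpow n) (Hpow (n + N)%nat); intros. nra.
Qed.

(** Ball of a weighted sup norm over an arbitrary index type: [X] is the line for differential
    equations and [bool * R] for pairs of amplitudes, so one fixed point lemma serves both. *)
Definition bounded_by {X : Type} (W : X -> R) (B : R) (f : X -> C) : Prop :=
  forall x, Cmod (f x) <= B * W x.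

Lemma half_pow_small (B eps : R) : 0 < eps -> exists n : nat, B * (/ 2) ^ n < eps.
Proof.
  intros He.
  assert (Hlim : is_lim_seq (fun n => (/ 2) ^ n) 0).
  { apply is_lim_seq_geom. rewrite Rabs_right; lra. }
  assert (Hq : 0 < eps / (Rabs B + 1)) by (apply Rdiv_lt_0_compat; generalize (Rabs_pos B); lra).
  destruct (proj1 (filterlim_locally _ _) Hlim (mkposreal _ Hq)) as [N HN].
  exists N. specialize (HN N (le_n N)).
  change (Rabs ((/ 2) ^ N - 0) < eps / (Rabs B + 1)) in HN.
  assert (Hp : 0 < (/ 2) ^ N) by (apply pow_lt; lra).
  rewrite Rminus_0_r, Rabs_right in HN by lra.
  apply Rle_lt_trans with (Rabs B * (/ 2) ^ N).
  - apply Rmult_le_compat_r; [lra|]. apply Rle_abs.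
  - apply Rlt_div_r in HN; [|generalize (Rabs_pos B); lra]. lra.
Qed.

(** Iterating [L -> L / 2 + eta] converges to its fixed point [2 * eta]. The a priori bound [K] only
    starts the iteration and leaves no trace in the conclusion, so it may depend on [theta] or
    [sigma] in any way. *)
Lemma halving_bound (f : R -> R) (x0 K eta : R) :
  0 <= K -> 0 <= eta ->
  (forall x, x0 <= x -> f x <= K) ->
  (forall L, 0 <= L -> (forall x, x0 <= x -> f x <= L) ->
     forall x, x0 <= x -> f x <= L / 2 + eta) ->
  forall x, x0 <= x -> f x <= 2 * eta.
Proof.
  intros HK He H0 Hstep.
  assert (Hn : forall n x, x0 <= x -> f x <= K * (/ 2) ^ n + 2 * eta).
  { induction n as [|n IH]; intros x Hx.
    - rewrite pow_O. specialize (H0 x Hx). lra.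
    - assert (Hp : 0 <= (/ 2) ^ n) by (apply pow_le; lra).
      assert (Hst := Hstep (K * (/ 2) ^ n + 2 * eta) ltac:(nra) IH x Hx).
      change ((/ 2) ^ S n) with (/ 2 * (/ 2) ^ n). lra. }
  intros x Hx. apply le_epsilon. intros e He'.
  destruct (half_pow_small K e He') as [n Hn']. specialize (Hn n x Hx). lra.
Qed.

Lemma contraction_unique {X : Type} (W : X -> R) (g f1 f2 : X -> C)
  (Tf1 Tf2 : X -> C) (B : R) :
  (forall x, 0 <= W x) ->
  (forall B, bounded_by W B (fun x => f1 x - f2 x)%C ->
     bounded_by W (B / 2) (fun x => Tf1 x - Tf2 x)%C) ->
  (forall x, f1 x = g x + Tf1 x)%C -> (forall x, f2 x = g x + Tf2 x)%C ->
  bounded_by W B (fun x => f1 x - f2 x)%C ->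
  forall x, f1 x = f2 x.
Proof.
  intros HW HT H1 H2 HB.
  assert (Hn : forall n, bounded_by W (B * (/ 2) ^ n) (fun x => f1 x - f2 x)%C).
  { induction n as [|n IH].
    - simpl. now rewrite Rmult_1_r.
    - apply HT in IH. intros x. specialize (IH x). rewrite H1, H2.
      replace (g x + Tf1 x - (g x + Tf2 x))%C with (Tf1 x - Tf2 x)%C by ring.
      simpl. lra. }
  intros x.
  assert (Hz : Cmod (f1 x - f2 x)%C <= 0).
  { apply le_epsilon. intros eps He.
    destruct (half_pow_small (B * W x) eps He) as [n Hn'].
    specialize (Hn n x). simpl in Hn. lra. }
  now apply Cmod_minus_le_0.
Qed.

(* [P] is the class of admissible functions. *)
Lemma contraction_fixpoint {X : Type} (W : X -> R) (P : (X -> C) -> Prop)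
  (T : (X -> C) -> X -> C) (g : X -> C) (B : R) :
  (forall x, 0 <= W x) -> 0 <= B ->
  P (fun _ => RtoC 0) ->
  (forall fn f K, (forall n, P (fn n)) ->
     (forall n : nat, bounded_by W (K * (/ 2) ^ n) (fun x => f x - fn n x)%C) -> P f) ->
  (forall f K, P f -> bounded_by W K f -> P (fun x => g x + T f x)%C) ->
  (forall f1 f2 K1 K2 K, P f1 -> P f2 -> bounded_by W K1 f1 -> bounded_by W K2 f2 ->
     bounded_by W K (fun x => f1 x - f2 x)%C ->
     bounded_by W (K / 2) (fun x => T f1 x - T f2 x)%C) ->
  (forall x, T (fun _ => RtoC 0) x = RtoC 0) ->
  bounded_by W B g ->
  exists f, P f /\ bounded_by W (2 * B) f /\ forall x, f x = (g x + T f x)%C.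
Proof.
  intros HW HB P0 Plim PT HT T0 Hg.
  set (F := fix F n := match n with O => fun _ => RtoC 0 | S n => fun x => (g x + T (F n) x)%C end).
  (* The factor [1 - (1/2)^n] is the partial geometric sum of the increments listed third; it keeps
     every iterate in the ball of radius [2 * B]. *)
  assert (HF : forall n, P (F n) /\ bounded_by W (2 * B * (1 - (/ 2) ^ n)) (F n) /\
     bounded_by W (B * (/ 2) ^ n) (fun x => F (S n) x - F n x)%C).
  { induction n as [|n [IH1 [IH2 IH3]]].
    - split; [exact P0|]. split; intros x; simpl.
      + rewrite Cmod_0. lra.
      + rewrite T0. specialize (Hg x). replace (g x + 0 - 0)%C with (g x) by ring. lra.
    - assert (PS : P (F (S n))) by (apply (PT _ _ IH1 IH2)).
      assert (BS : bounded_by W (2 * B * (1 - (/ 2) ^ (S n))) (F (S n))).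
      { intros x. replace (F (S n) x) with (F n x + (F (S n) x - F n x))%C by ring.
        apply Cmod_triangle_le. generalize (IH2 x) (IH3 x); simpl. lra. }
      split; [exact PS|]. split; [exact BS|].
      intros x.
      assert (H := HT (F (S n)) (F n) _ _ _ PS IH1 BS IH2 IH3 x).
      replace (F (S (S n)) x - F (S n) x)%C with (T (F (S n)) x - T (F n) x)%C
        by (simpl; ring).
      simpl in *. lra. }
  (* Real and imaginary parts each contribute a remainder [2 * B * W x * (1/2)^n], hence the [4]. *)
  assert (Hlim : forall x, exists l : C, forall n, Cmod (l - F n x)%C <= 4 * B * W x * (/ 2) ^ n).
  { intros x.
    destruct (series_limit (fun n => Re (F n x)) (B * W x)) as [l1 H1].
    { intros n. eapply Rle_trans; [apply (Cmod_Re (F (S n) x - F n x)%C)|].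
      destruct (HF n) as [_ [_ H]]. specialize (H x). simpl in *. lra. }
    destruct (series_limit (fun n => Im (F n x)) (B * W x)) as [l2 H2].
    { intros n. eapply Rle_trans; [apply (Cmod_Im (F (S n) x - F n x)%C)|].
      destruct (HF n) as [_ [_ H]]. specialize (H x). simpl in *. lra. }
    exists (l1, l2). intros n. eapply Rle_trans; [apply Cmod_le_abs|].
    specialize (H1 n). specialize (H2 n).
    change (Rabs (l1 - Re (F n x)) + Rabs (l2 - Im (F n x)) <= 4 * B * W x * (/ 2) ^ n). lra. }
  apply choice in Hlim. destruct Hlim as [f Hf].
  assert (Hfn : forall n : nat, bounded_by W (4 * B * (/ 2) ^ n) (fun x => f x - F n x)%C).
  { intros n x. specialize (Hf x n). simpl in *. lra. }
  assert (Pf : P f) by (apply (Plim F f (4 * B)); [apply HF|exact Hfn]).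
  assert (Bf : bounded_by W (2 * B) f).
  { intros x. apply le_epsilon. intros eps He.
    destruct (half_pow_small (4 * B * W x) eps He) as [n Hn].
    replace (f x) with (f x - F n x + F n x)%C by ring.
    apply Cmod_triangle_le.
    destruct (HF n) as [_ [H2 _]]. specialize (H2 x). specialize (Hf x n).
    assert (0 <= B * W x * (/ 2) ^ n).
    { apply Rmult_le_pos; [apply Rmult_le_pos; auto|]. apply pow_le; lra. }
    lra. }
  exists f. split; [exact Pf|]. split; [exact Bf|].
  intros x.
  assert (Hz : Cmod (f x - (g x + T f x))%C <= 0).
  { apply le_epsilon. intros eps He.
    destruct (half_pow_small (4 * B * W x) eps He) as [n Hn].
    destruct (HF n) as [Pn [Bn _]].
    assert (H := HT f (F n) _ _ _ Pf Pn Bf Bn (Hfn n) x).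
    assert (H' := Hf x (S n)).
    replace (f x - (g x + T f x))%C with ((f x - F (S n) x) - (T f x - T (F n) x))%C
      by (simpl; ring).
    apply Cmod_triangle_le. rewrite Cmod_opp. simpl in *. lra. }
  now apply Cmod_minus_le_0.
Qed.

(** The convergence is locally uniform: near [x] the continuous weight stays below [W x + 1]. *)
Lemma cont_RC_limit (W : R -> R) (fn : nat -> R -> C) (f : R -> C) (K : R) :
  (forall x, continuous W x) -> (forall x, 0 <= W x) ->
  (forall n x, cont_RC (fn n) x) ->
  (forall n : nat, bounded_by W (K * (/ 2) ^ n) (fun x => f x - fn n x)%C) ->
  forall x, cont_RC f x.
Proof.
  intros HW HW0 Hfn Hb x. apply cont_RC_eps. intros eps He.
  assert (HW1 := proj1 (filterlim_locally _ _) (HW x) (mkposreal 1 Rlt_0_1)).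
  destruct HW1 as [d1 Hd1].
  destruct (half_pow_small (Rabs K * (W x + 1)) (eps / 3)) as [n Hn]; [lra|].
  destruct (proj1 (cont_RC_eps _ _) (Hfn n x) (eps / 3)) as [d2 [Hd2 Hd2']]; [lra|].
  exists (Rmin d1 d2). split; [apply Rmin_glb_lt; [apply cond_pos|exact Hd2]|].
  intros y Hy.
  assert (Hyb : forall z, W z <= W x + 1 -> Cmod (f z - fn n z)%C < eps / 3).
  { intros z Hz. eapply Rle_lt_trans; [apply (Hb n z)|].
    eapply Rle_lt_trans; [|exact Hn].
    assert (0 <= (/ 2) ^ n) by (apply pow_le; lra).
    generalize (Rle_abs K) (HW0 z) (Rabs_pos K); intros.
    assert (K * (/ 2) ^ n <= Rabs K * (/ 2) ^ n) by nra.
    apply Rle_trans with (Rabs K * (/ 2) ^ n * W z); [nra|].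
    assert (0 <= Rabs K * (/ 2) ^ n) by nra. nra. }
  specialize (Hd1 y (Rlt_le_trans _ _ _ Hy (Rmin_l _ _))).
  change (Rabs (W y - W x) < 1) in Hd1. apply Rabs_lt_between in Hd1.
  specialize (Hd2' y (Rlt_le_trans _ _ _ Hy (Rmin_r _ _))).
  assert (A1 := Hyb y ltac:(lra)). assert (A2 := Hyb x ltac:(lra)).
  replace (f y - f x)%C with ((f y - fn n y) + (fn n y - fn n x) - (f x - fn n x))%C by ring.
  eapply Rle_lt_trans; [apply Cmod_triangle|]. rewrite Cmod_opp.
  generalize (Cmod_triangle (f y - fn n y) (fn n y - fn n x)); lra.
Qed.

Lemma is_derive_primitive_R (f : R -> R) (a x : R) :
  (forall y, continuous f y) -> is_derive (fun x => RInt f a x) x (f x).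
Proof.
  intros Hf. apply (is_derive_RInt f (fun x => RInt f a x) a x).
  - exists (mkposreal 1 Rlt_0_1). intros y _.
    apply (@RInt_correct R_CompleteNormedModule).
    apply (@ex_RInt_continuous R_CompleteNormedModule). intros z _. apply Hf.
  - apply Hf.
Qed.

Lemma continuous_of_derive (f : R -> R) (x l : R) : is_derive f x l -> continuous f x.
Proof.
  intros H. apply (ex_derive_continuous (V := R_NormedModule)). now exists l.
Qed.

Lemma is_derive_exp_comp (f : R -> R) (x l : R) :
  is_derive f x l -> is_derive (fun y => exp (f y)) x (l * exp (f x)).
Proof. intros H. apply (is_derive_comp exp f); [apply is_derive_exp|exact H]. Qed.

(** * Linear second order equations *)

Section WeightedPrimitive.

Variables (L Q : R -> R) (x0 : R).
Hypothesis L_derive : forall x, is_derive L x (1 + Q x).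
Hypothesis L_x0 : L x0 = 0.
Hypothesis Q_pos : forall x, 0 <= Q x.

(** Bielecki weight. Since [L' = 1 + Q], integrating [(1 + Q) * exp_weight] from [x0] gains a factor
    [1 / 2], so Picard iteration contracts on the whole line at once. *)
Definition exp_weight (x : R) : R := exp (2 * Rabs (L x)).

Lemma exp_weight_ge_1 (x : R) : 1 <= exp_weight x.
Proof.
  unfold exp_weight. rewrite <- exp_0. apply exp_le_compat. generalize (Rabs_pos (L x)); lra.
Qed.

Lemma exp_weight_continuous (x : R) : continuous exp_weight x.
Proof.
  unfold exp_weight. apply (continuous_comp (fun x => 2 * Rabs (L x)) exp).
  - apply continuous_scal_R.
    apply (continuous_comp L Rabs); [|apply continuous_Rabs].
    eapply continuous_of_derive; apply L_derive.
  - eapply continuous_of_derive. apply is_derive_exp.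
Qed.

Lemma L_nondecreasing (x y : R) : x <= y -> L x <= L y.
Proof.
  intros Hxy. apply (nondecreasing_of_derive L (fun x => 1 + Q x) x y Hxy).
  intros t _. split; [apply L_derive|]. specialize (Q_pos t); lra.
Qed.

(** To the right of [x0] the weight is [exp(2 L)], to the left [exp(-2 L)]; in both cases [(1 + Q)]
    times the weight is half the derivative of the weight, up to sign. *)
Lemma weighted_primitive_bound (H h : R -> C) (K : R) :
  (forall x, is_derive_RC H x (h x)) ->
  (forall x, Cmod (h x) <= K * ((1 + Q x) * exp_weight x)) ->
  forall x, Cmod (H x - H x0)%C <= K / 2 * exp_weight x.
Proof.
  intros Hd Hb x.
  assert (HK : 0 <= K).
  { generalize (Hb x) (Cmod_ge_0 (h x)) (Q_pos x) (exp_weight_ge_1 x); intros.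
    assert (0 < (1 + Q x) * exp_weight x) by nra. nra. }
  assert (He1 : forall t, is_derive (fun t => exp (2 * L t)) t (2 * (1 + Q t) * exp (2 * L t))).
  { intros t. apply (is_derive_exp_comp (fun t => 2 * L t)). apply is_derive_scal, L_derive. }
  assert (He2 : forall t, is_derive (fun t => exp (-2 * L t)) t (-2 * (1 + Q t) * exp (-2 * L t))).
  { intros t. apply (is_derive_exp_comp (fun t => -2 * L t)). apply is_derive_scal, L_derive. }
  destruct (Rle_dec x0 x) as [Hx|Hx].
  - apply Rle_trans with ((fun t => K / 2 * exp (2 * L t)) x - (fun t => K / 2 * exp (2 * L t)) x0).
    + assert (HG : forall t, is_derive (fun t => K / 2 * exp (2 * L t)) t
         (K * ((1 + Q t) * exp (2 * L t)))).
      { intros t. eapply is_derive_eq; [apply is_derive_scal, He1|]. simpl; lra. }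
      apply (mean_value_inequality H h (fun t => K / 2 * exp (2 * L t))
        (fun t => K * ((1 + Q t) * exp (2 * L t)))); [exact Hx|].
      intros t Ht. split; [apply Hd|]. split; [apply HG|].
        specialize (Hb t). unfold exp_weight in Hb. rewrite (Rabs_right (L t)) in Hb; [exact Hb|].
        generalize (L_nondecreasing x0 t ltac:(lra)). lra.
    + simpl. unfold exp_weight. rewrite (Rabs_right (L x)).
      * generalize (exp_pos (2 * L x0)); nra.
      * generalize (L_nondecreasing x0 x Hx). lra.
  - apply Rnot_le_lt in Hx.
    replace (H x - H x0)%C with (- (H x0 - H x))%C by ring. rewrite Cmod_opp.
    apply Rle_trans with ((fun t => - (K / 2) * exp (-2 * L t)) x0 - (fun t => - (K / 2) * exp (-2 * L t)) x).
    + assert (HG : forall t, is_derive (fun t => - (K / 2) * exp (-2 * L t)) t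
         (K * ((1 + Q t) * exp (-2 * L t)))).
      { intros t. eapply is_derive_eq; [apply is_derive_scal, He2|]. simpl; lra. }
      apply (mean_value_inequality H h (fun t => - (K / 2) * exp (-2 * L t))
        (fun t => K * ((1 + Q t) * exp (-2 * L t)))); [lra|].
      intros t Ht. split; [apply Hd|]. split; [apply HG|].
        specialize (Hb t). unfold exp_weight in Hb. rewrite (Rabs_left1 (L t)) in Hb.
        { replace (-2 * L t) with (2 * - L t) by ring. exact Hb. }
        generalize (L_nondecreasing t x0 ltac:(lra)). lra.
    + simpl. unfold exp_weight. rewrite (Rabs_left1 (L x)).
      * replace (2 * - L x) with (-2 * L x) by ring. generalize (exp_pos (-2 * L x0)); nra.
      * generalize (L_nondecreasing x x0 ltac:(lra)). lra.
Qed.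

End WeightedPrimitive.

(** Picard iteration for the twice integrated equation. In the density [1 + Q], the summand [Q] pays
    for integrating [w * u] and the summand [1] for integrating [u']. *)
Lemma linear_ode_exists (w : R -> C) (Q : R -> R) (x0 : R) (u0 v0 : C) :
  (forall x, cont_RC w x) -> (forall x, continuous Q x) ->
  (forall x, Cmod (w x) <= Q x) ->
  exists u u' : R -> C,
    (forall x, is_derive_RC u x (u' x) /\ is_derive_RC u' x (w x * u x)%C) /\
    u x0 = u0 /\ u' x0 = v0.
Proof.
  intros Hw HQ Hb.
  set (L := fun x => RInt (fun y => 1 + Q y) x0 x).
  assert (HL : forall x, is_derive L x (1 + Q x)).
  { intros x. apply (is_derive_primitive_R (fun y => 1 + Q y)). intros y.
    apply continuous_plus_R;
      [apply continuous_const|apply HQ]. }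
  assert (HL0 : L x0 = 0) by apply (@RInt_point R_CompleteNormedModule).
  assert (HQ0 : forall x, 0 <= Q x) by (intros x; generalize (Hb x) (Cmod_ge_0 (w x)); lra).
  set (W := exp_weight L).
  assert (HW1 : forall x, 1 <= W x) by (intros; apply (exp_weight_ge_1 L)).
  assert (HWc : forall x, continuous W x) by (intros; eapply exp_weight_continuous; eassumption).
  set (I := fun (f : R -> C) x => (primitive_RC (fun y => w y * f y) x - primitive_RC (fun y => w y * f y) x0)%C).
  set (T := fun f x => (primitive_RC (I f) x - primitive_RC (I f) x0)%C).
  set (g := fun x => (u0 + v0 * RtoC (x - x0))%C).
  assert (HI : forall f, (forall x, cont_RC f x) -> forall x, is_derive_RC (I f) x (w x * f x)%C).
  { intros f Hf x. eapply is_derive_RC_eq.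
    - apply is_derive_RC_minus; [|apply is_derive_RC_const].
      apply (is_derive_primitive_RC (fun y => w y * f y)%C). intros y. now apply cont_RC_mult.
    - ring. }
  assert (HT : forall f, (forall x, cont_RC f x) -> forall x, is_derive_RC (T f) x (I f x)).
  { intros f Hf x. eapply is_derive_RC_eq.
    - apply is_derive_RC_minus; [|apply is_derive_RC_const].
      apply (is_derive_primitive_RC (I f)). intros y. eapply is_derive_RC_continuous. now apply HI.
    - ring. }
  assert (Hg : forall x, is_derive_RC g x v0).
  { intros x. unfold g. eapply is_derive_RC_eq.
    - apply is_derive_RC_plus; [apply is_derive_RC_const|].
      apply is_derive_RC_mult; [apply is_derive_RC_const|].
      apply (is_derive_RC_RtoC _ _ 1). auto_derive; [exact Logic.I|ring].
    - cbv beta. ring. }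
  assert (HT' : forall f1 f2 K, (forall x, cont_RC f1 x) -> (forall x, cont_RC f2 x) ->
     bounded_by W K (fun x => f1 x - f2 x)%C ->
     bounded_by W (K / 2) (fun x => T f1 x - T f2 x)%C).
  { intros f1 f2 K H1 H2 HK.
    assert (HK0 : 0 <= K).
    { generalize (HK x0) (Cmod_ge_0 (f1 x0 - f2 x0)%C) (HW1 x0); intros; nra. }
    assert (HIb : forall x, Cmod (I f1 x - I f2 x)%C <= K / 2 * W x).
    { intros x. replace (I f1 x - I f2 x)%C
        with ((fun x => I f1 x - I f2 x) x - (fun x => I f1 x - I f2 x) x0)%C
        by (unfold I; simpl; ring).
      apply (weighted_primitive_bound L Q x0 HL HL0 HQ0 (fun x => I f1 x - I f2 x)%C
        (fun x => w x * f1 x - w x * f2 x)%C).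
      - intros y. apply is_derive_RC_minus; now apply HI.
      - intros y. replace (w y * f1 y - w y * f2 y)%C with (w y * (f1 y - f2 y))%C by ring.
        rewrite Cmod_mult. specialize (HK y). simpl in HK. specialize (Hb y). specialize (HW1 y).
        generalize (Cmod_ge_0 (w y)) (Cmod_ge_0 (f1 y - f2 y)%C). fold W. intros.
        apply Rle_trans with (Q y * (K * W y)); [apply Rmult_le_compat; assumption|].
        assert (0 <= K * W y) by nra. lra. }
    intros x. replace (T f1 x - T f2 x)%C
        with ((fun x => T f1 x - T f2 x) x - (fun x => T f1 x - T f2 x) x0)%C
        by (unfold T; simpl; ring).
    apply Rle_trans with (K / 2 / 2 * W x).
    - apply (weighted_primitive_bound L Q x0 HL HL0 HQ0 (fun x => T f1 x - T f2 x)%C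
        (fun x => I f1 x - I f2 x)%C).
      + intros y. apply is_derive_RC_minus; now apply HT.
      + intros y. fold W. eapply Rle_trans; [apply HIb|]. specialize (HW1 y). specialize (HQ0 y).
        assert (0 <= K / 2 * W y) by nra. assert (0 <= K / 2 * W y * Q y) by nra. lra.
    - specialize (HW1 x). nra. }
  destruct (contraction_fixpoint W (fun f => forall x, cont_RC f x) T g (Cmod u0 + Cmod v0))
    as [u [Hu [_ Hfix]]].
  - intros x; specialize (HW1 x); lra.
  - generalize (Cmod_ge_0 u0) (Cmod_ge_0 v0); lra.
  - intros x; apply cont_RC_const.
  - intros fn f K Hfn Hlim. apply (cont_RC_limit W fn f K); try assumption.
    intros x; specialize (HW1 x); lra.
  - intros f K Hf _ x. apply cont_RC_plus; eapply is_derive_RC_continuous; [apply Hg|now apply HT].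
  - intros f1 f2 K1 K2 K H1 H2 _ _ HK. now apply HT'.
  - intros x.
    assert (Hz : forall x, cont_RC (fun _ => RtoC 0) x) by (intros; apply cont_RC_const).
    assert (H : forall x, I (fun _ => RtoC 0) x = RtoC 0).
    { intros y. apply Cmod_le_0, Rle_trans with (0 / 2 * exp_weight L y); [|lra].
      replace (I (fun _ => RtoC 0) y) with
        (I (fun _ => RtoC 0) y - I (fun _ => RtoC 0) x0)%C by (unfold I; ring).
      apply (weighted_primitive_bound L Q x0 HL HL0 HQ0 _ _ _ (HI _ Hz)).
      intros t. rewrite Cmult_0_r, Cmod_0. lra. }
    apply Cmod_le_0, Rle_trans with (0 / 2 * exp_weight L x); [|lra].
    replace (T (fun _ => RtoC 0) x) with
      (T (fun _ => RtoC 0) x - T (fun _ => RtoC 0) x0)%C by (unfold T; ring).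
    apply (weighted_primitive_bound L Q x0 HL HL0 HQ0 _ _ _ (HT _ Hz)).
    intros t. rewrite H, Cmod_0. lra.
  - intros x. replace (g x) with (u0 + (g x - g x0))%C.
    2: { unfold g. rewrite Rminus_diag. ring. }
    apply Cmod_triangle_le.
    assert (Cmod (g x - g x0)%C <= Cmod v0 / 2 * exp_weight L x).
    { apply (weighted_primitive_bound L Q x0 HL HL0 HQ0 g (fun _ => v0)); [exact Hg|].
      intros y. fold W. specialize (HW1 y); specialize (HQ0 y). generalize (Cmod_ge_0 v0).
      intros. assert (1 <= (1 + Q y) * W y) by nra. nra. }
    fold W in H. specialize (HW1 x). generalize (Cmod_ge_0 u0) (Cmod_ge_0 v0). nra.
  - exists u, (fun x => v0 + I u x)%C. split; [|split].
    + intros x. split.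
      * apply (is_derive_RC_ext (fun x => g x + T u x)%C); [intros; now rewrite <- Hfix|].
        apply is_derive_RC_plus; [apply Hg|now apply HT].
      * eapply is_derive_RC_eq.
        -- apply is_derive_RC_plus; [apply is_derive_RC_const|now apply HI].
        -- ring.
    + rewrite Hfix. unfold g, T. rewrite Rminus_diag. ring.
    + unfold I. ring.
Qed.

(** A bound on [|E'|] works in both directions: [(E + kappa) exp(-K t)] is nonincreasing and
    [(E + kappa) exp(K t)] is nondecreasing. The shift [kappa] absorbs a constant source. *)
Lemma gronwall (E dE : R -> R) (K kappa lo hi : R) :
  0 <= K ->
  (forall x, lo <= x <= hi -> is_derive E x (dE x) /\ Rabs (dE x) <= K * (E x + kappa)) ->
  forall x y, lo <= x <= hi -> lo <= y <= hi ->
  E x + kappa <= (E y + kappa) * exp (K * Rabs (x - y)).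
Proof.
  intros HK Hd.
  assert (Hder : forall s t, lo <= t <= hi -> is_derive (fun t => (E t + kappa) * exp (s * t)) t
     (dE t * exp (s * t) + (E t + kappa) * (s * exp (s * t)))).
  { intros s t Ht. destruct (Hd t Ht) as [H1 _]. eapply is_derive_eq.
    - apply Derive.is_derive_mult.
      + apply @is_derive_plus; [exact H1|apply @is_derive_const].
      + apply (is_derive_exp_comp (fun t => s * t) t s). auto_derive; [exact Logic.I|ring].
    - unfold plus, zero; simpl; ring. }
  assert (Hup : forall x y, lo <= x -> x <= y -> y <= hi ->
     E y + kappa <= (E x + kappa) * exp (K * (y - x))).
  { intros x y H1 H2 H3.
    assert (H : - ((E x + kappa) * exp (- K * x)) <= - ((E y + kappa) * exp (- K * y))).
    { apply (nondecreasing_of_derive (fun t => - ((E t + kappa) * exp (- K * t)))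
       (fun t => - (dE t * exp (- K * t) + (E t + kappa) * (- K * exp (- K * t)))) x y H2).
      intros t Ht. split.
        + apply (is_derive_opp (V := R_NormedModule) (fun t => (E t + kappa) * exp (- K * t))). apply Hder. lra.
        + destruct (Hd t ltac:(lra)) as [_ Hb]. apply Rabs_le_between in Hb.
          generalize (exp_pos (- K * t)); intros. nra. }
    replace (exp (K * (y - x))) with (exp (- K * x) * exp (K * y)) by (rewrite <- exp_plus; f_equal; ring).
    assert (He : exp (- K * y) * exp (K * y) = 1) by (rewrite <- exp_plus, <- exp_0; f_equal; ring).
    generalize (exp_pos (K * y)); intros.
    replace (E y + kappa) with ((E y + kappa) * exp (- K * y) * exp (K * y)) by (rewrite Rmult_assoc, He; ring).
    rewrite <- Rmult_assoc. apply Rmult_le_compat_r; lra. }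
  assert (Hdn : forall x y, lo <= x -> x <= y -> y <= hi ->
     E x + kappa <= (E y + kappa) * exp (K * (y - x))).
  { intros x y H1 H2 H3.
    assert (H : ((E x + kappa) * exp (K * x)) <= ((E y + kappa) * exp (K * y))).
    { apply (nondecreasing_of_derive (fun t => ((E t + kappa) * exp (K * t)))
       (fun t => (dE t * exp (K * t) + (E t + kappa) * (K * exp (K * t)))) x y H2).
      intros t Ht. split.
        + apply Hder. lra.
        + destruct (Hd t ltac:(lra)) as [_ Hb]. apply Rabs_le_between in Hb.
          generalize (exp_pos (K * t)); intros. nra. }
    replace (exp (K * (y - x))) with (exp (K * y) * exp (- K * x)) by (rewrite <- exp_plus; f_equal; ring).
    assert (He : exp (K * x) * exp (- K * x) = 1) by (rewrite <- exp_plus, <- exp_0; f_equal; ring).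
    generalize (exp_pos (- K * x)); intros.
    replace (E x + kappa) with ((E x + kappa) * exp (K * x) * exp (- K * x)) by (rewrite Rmult_assoc, He; ring).
    rewrite <- Rmult_assoc. apply Rmult_le_compat_r; lra. }
  intros x y Hx Hy. destruct (Rle_dec x y) as [Hxy|Hxy].
  - rewrite Rabs_left1 by lra. replace (- (x - y)) with (y - x) by ring. apply Hdn; lra.
  - rewrite Rabs_right by lra. apply Hup; lra.
Qed.

Definition energy (u v : C) : R := Cmod u ^ 2 + Cmod v ^ 2.

Lemma Cmod_sqr (z : C) : Cmod z ^ 2 = Re z * Re z + Im z * Im z.
Proof. unfold Cmod, Re, Im. rewrite pow2_sqrt by nra. ring. Qed.

(** The derivative of the energy is at most [2 |u| |v| + 2 |v| (Q |u| + delta)]. The source is split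
    as [2 delta |v| <= delta^2 + |v|^2], which explains the shift by [delta^2] and the rate
    [2 + Q]. *)
Lemma energy_estimate (u v d : R -> C) (Q delta lo hi : R) :
  0 <= Q ->
  (forall x, lo <= x <= hi -> is_derive_RC u x (v x) /\ is_derive_RC v x (d x) /\
     Cmod (d x) <= Q * Cmod (u x) + delta) ->
  forall x y, lo <= x <= hi -> lo <= y <= hi ->
  energy (u x) (v x) + delta ^ 2
  <= (energy (u y) (v y) + delta ^ 2) * exp ((2 + Q) * Rabs (x - y)).
Proof.
  intros HQ Hd.
  apply (gronwall (fun x => energy (u x) (v x))
    (fun x => 2 * (Re (u x) * Re (v x) + Im (u x) * Im (v x))
       + 2 * (Re (v x) * Re (d x) + Im (v x) * Im (d x)))); [lra|].
  intros x Hx. destruct (Hd x Hx) as [H1 [H2 H3]].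
  apply is_derive_RC_iff in H1. apply is_derive_RC_iff in H2.
  destruct H1 as [A1 A2], H2 as [B1 B2]. split.
  - apply (is_derive_ext (fun x => Re (u x) * Re (u x) + Im (u x) * Im (u x)
      + (Re (v x) * Re (v x) + Im (v x) * Im (v x)))).
    { intros t. unfold energy. now rewrite !Cmod_sqr. }
    eapply is_derive_eq.
    + apply @is_derive_plus; apply @is_derive_plus; apply Derive.is_derive_mult; eassumption.
    + unfold plus; simpl. ring.
  - unfold energy.
    generalize (Cmod_Re_conj_mult (u x) (v x)) (Cmod_Re_conj_mult (v x) (d x))
      (Cmod_ge_0 (u x)) (Cmod_ge_0 (v x)); intros P1 P2 P3 P4.
    eapply Rle_trans; [apply Rabs_triang|]. rewrite !Rabs_mult, (Rabs_right 2) by lra.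
    set (a := Cmod (u x)) in *. set (c := Cmod (v x)) in *.
    assert (c * Cmod (d x) <= c * (Q * a + delta)) by (apply Rmult_le_compat_l; lra).
    assert (0 <= (a - c) ^ 2) by apply pow2_ge_0.
    assert (0 <= (delta - c) ^ 2) by apply pow2_ge_0.
    assert (2 * (a * c) <= a ^ 2 + c ^ 2) by nra.
    assert (Q * (2 * (a * c)) <= Q * (a ^ 2 + c ^ 2)) by (apply Rmult_le_compat_l; lra).
    assert (0 <= delta ^ 2) by apply pow2_ge_0.
    assert (0 <= Q * delta ^ 2) by nra.
    assert (0 <= a ^ 2) by apply pow2_ge_0.
    nra.
Qed.

Lemma energy_eq_0 (u v : C) : energy u v <= 0 -> u = RtoC 0 /\ v = RtoC 0.
Proof.
  unfold energy. intros H.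
  generalize (pow2_ge_0 (Cmod u)) (pow2_ge_0 (Cmod v)) (Cmod_ge_0 u) (Cmod_ge_0 v); intros.
  split; apply Cmod_le_0; nra.
Qed.

Lemma locally_gt (a x : R) : a < x -> locally x (fun y => a < y).
Proof. intros H. apply (open_gt a x H). Qed.

Lemma locally_lt (a x : R) : x < a -> locally x (fun y => y < a).
Proof. intros H. apply (open_lt a x H). Qed.

Lemma is_derive_Rpower_comp (f : R -> R) (a x l : R) :
  is_derive f x l -> 0 < f x ->
  is_derive (fun y => Rpower (f y) a) x (a * l * Rpower (f x) (a - 1)).
Proof.
  intros Hf Hp. eapply is_derive_eq.
  - apply (is_derive_comp (fun y => Rpower y a) f); [now apply is_derive_Rpower|exact Hf].
  - unfold scal; simpl; unfold mult; simpl; ring.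
Qed.

(** * The potential and the coefficients of the paper *)

Definition pot (alpha theta x : R) : R := 1 + theta * pos_pow alpha x.

Lemma pos_pow_pos (alpha x : R) : 0 < x -> pos_pow alpha x = Rpower x alpha.
Proof. intros H. unfold pos_pow. destruct (Rlt_dec 0 x); [reflexivity|lra]. Qed.

Lemma pos_pow_nonpos (alpha x : R) : x <= 0 -> pos_pow alpha x = 0.
Proof. intros H. unfold pos_pow. destruct (Rlt_dec 0 x); [lra|reflexivity]. Qed.

Lemma pos_pow_ge_0 (alpha x : R) : 0 <= pos_pow alpha x.
Proof.
  unfold pos_pow. destruct (Rlt_dec 0 x); [|lra]. apply Rlt_le, exp_pos.
Qed.

Lemma pos_pow_le (alpha x y : R) : 0 < alpha -> x <= y -> pos_pow alpha x <= pos_pow alpha y.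
Proof.
  intros Ha H. destruct (Rle_dec x 0) as [Hx|Hx].
  - rewrite (pos_pow_nonpos alpha x Hx). apply pos_pow_ge_0.
  - rewrite !pos_pow_pos by lra. apply Rle_Rpower_l; lra.
Qed.

Lemma pos_pow_inverse (alpha x : R) : 0 < alpha -> 0 <= x ->
  pos_pow (/ alpha) (pos_pow alpha x) = x.
Proof.
  intros Ha Hx. destruct (Rle_lt_or_eq_dec 0 x Hx) as [H|H].
  - rewrite (pos_pow_pos alpha) by exact H. rewrite pos_pow_pos by apply exp_pos.
    rewrite Rpower_mult, Rinv_r, Rpower_1; lra.
  - subst x. rewrite (pos_pow_nonpos alpha), pos_pow_nonpos; lra.
Qed.

Lemma pos_pow_continuous (alpha x : R) : 0 < alpha -> continuous (pos_pow alpha) x.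
Proof.
  intros Ha. destruct (total_order_T x 0) as [[H|H]|H].
  - apply (continuous_ext_loc _ (fun _ => 0)); [|apply continuous_const].
    generalize (locally_lt 0 x H). apply filter_imp. intros y Hy.
    symmetry; apply pos_pow_nonpos; lra.
  - subst x. apply filterlim_locally. intros eps.
    exists (mkposreal (Rpower eps (/ alpha)) (exp_pos _)). intros y Hy.
    change (Rabs (y - 0) < Rpower eps (/ alpha)) in Hy.
    change (Rabs (pos_pow alpha y - pos_pow alpha 0) < eps).
    rewrite (pos_pow_nonpos alpha 0), Rminus_0_r by lra. rewrite Rminus_0_r in Hy.
    destruct (Rlt_dec 0 y) as [Hy0|Hy0].
    + rewrite pos_pow_pos by exact Hy0. rewrite Rabs_right by (apply Rle_ge, Rlt_le, exp_pos).
      rewrite Rabs_right in Hy by lra.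
      apply Rlt_le_trans with (Rpower (Rpower eps (/ alpha)) alpha).
      * apply Rlt_Rpower_l; lra.
      * rewrite Rpower_mult, Rinv_l, Rpower_1 by (try apply cond_pos; lra). apply Rle_refl.
    + rewrite pos_pow_nonpos, Rabs_R0 by lra. apply cond_pos.
  - apply (continuous_ext_loc _ (fun y => Rpower y alpha)).
    + generalize (locally_gt 0 x H). apply filter_imp. intros y Hy.
      symmetry; now apply pos_pow_pos.
    + eapply continuous_of_derive. now apply is_derive_Rpower.
Qed.

Section Potential.

Variables (alpha theta : R).
Hypothesis (alpha_pos : 0 < alpha) (theta_pos : 0 < theta).

Let P := pot alpha theta.

Lemma pot_ge_1 (x : R) : 1 <= P x.
Proof. unfold P, pot. generalize (pos_pow_ge_0 alpha x). nra. Qed.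

Lemma pot_nonpos (x : R) : x <= 0 -> P x = 1.
Proof. intros H. unfold P, pot. rewrite pos_pow_nonpos by exact H. ring. Qed.

Lemma pot_pos (x : R) : 0 < x -> P x = 1 + theta * Rpower x alpha.
Proof. intros H. unfold P, pot. now rewrite pos_pow_pos. Qed.

Lemma pot_continuous (x : R) : continuous P x.
Proof.
  apply continuous_plus_R;
    [apply continuous_const|].
  apply continuous_scal_R.
  now apply pos_pow_continuous.
Qed.

Lemma pot_nondecreasing (x y : R) : x <= y -> P x <= P y.
Proof.
  intros H. unfold P, pot. generalize (pos_pow_le alpha x y alpha_pos H). nra.
Qed.

Lemma c_eq (x : R) : c alpha theta x = / sqrt (P x).
Proof.
  unfold c. fold (pot alpha theta x). fold P. rewrite Rpower_Ropp.
  replace (1 / 2) with (/ 2) by lra. rewrite Rpower_sqrt; [reflexivity|].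
  generalize (pot_ge_1 x); lra.
Qed.

Lemma inv_c (x : R) : / c alpha theta x = sqrt (P x).
Proof. rewrite c_eq. apply Rinv_inv. Qed.

Lemma inv_c_sqr (x : R) : / c alpha theta x ^ 2 = P x.
Proof.
  rewrite <- pow_inv, inv_c. apply pow2_sqrt. generalize (pot_ge_1 x); lra.
Qed.

Lemma sqrt_pot_ge_1 (x : R) : 1 <= sqrt (P x).
Proof. rewrite <- sqrt_1 at 1. apply sqrt_le_1_alt, pot_ge_1. Qed.

Lemma sqrt_pot_continuous (x : R) : continuous (fun x => sqrt (P x)) x.
Proof. apply (continuous_comp P sqrt); [apply pot_continuous|apply continuous_sqrt]. Qed.

Lemma is_derive_phi (x : R) : is_derive (phi alpha theta) x (sqrt (P x)).
Proof.
  apply (is_derive_ext (fun x => RInt (fun y => sqrt (P y)) 0 x)).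
  { intros t. unfold phi. apply (@RInt_ext R_CompleteNormedModule). intros y _.
    symmetry; apply inv_c. }
  apply (is_derive_primitive_R (fun y => sqrt (P y))), sqrt_pot_continuous.
Qed.

Lemma phi_continuous (x : R) : continuous (phi alpha theta) x.
Proof. eapply continuous_of_derive, is_derive_phi. Qed.

Lemma phi_0 : phi alpha theta 0 = 0.
Proof. apply (@RInt_point R_CompleteNormedModule). Qed.

Lemma phi_increment (x y : R) : x <= y -> y - x <= phi alpha theta y - phi alpha theta x.
Proof.
  intros H.
  assert (H' : phi alpha theta x - x <= phi alpha theta y - y).
  { apply (nondecreasing_of_derive (fun t => phi alpha theta t - t) (fun t => sqrt (P t) - 1) x y H).
    intros t _. split.
    - apply @is_derive_minus; [apply is_derive_phi|apply @is_derive_id].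
    - generalize (sqrt_pot_ge_1 t); lra. }
  lra.
Qed.

Definition dpot (x : R) : R := theta * (alpha * Rpower x (alpha - 1)).
Definition ddpot (x : R) : R := theta * (alpha * ((alpha - 1) * Rpower x (alpha - 2))).

Lemma is_derive_pot (x : R) : 0 < x -> is_derive P x (dpot x).
Proof.
  intros H. apply (is_derive_ext_loc (fun y => 1 + theta * Rpower y alpha)).
  - generalize (locally_gt 0 x H). apply filter_imp. intros y Hy. symmetry; now apply pot_pos.
  - eapply is_derive_eq.
    + apply @is_derive_plus; [apply @is_derive_const|].
      apply is_derive_scal, is_derive_Rpower, H.
    + unfold plus, zero, dpot; simpl; ring.
Qed.

Lemma is_derive_dpot (x : R) : 0 < x -> is_derive dpot x (ddpot x).
Proof.
  intros H. apply is_derive_scal, is_derive_scal.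
  replace (alpha - 2) with (alpha - 1 - 1) by ring. now apply is_derive_Rpower.
Qed.

Lemma is_derive_pot_power (s x : R) : 0 < x ->
  is_derive (fun y => Rpower (P y) s) x (s * dpot x * Rpower (P x) (s - 1)).
Proof.
  intros H. apply is_derive_Rpower_comp; [now apply is_derive_pot|].
  generalize (pot_ge_1 x); lra.
Qed.

Lemma sqrt_pot (x : R) : sqrt (P x) = Rpower (P x) (/ 2).
Proof. symmetry. apply Rpower_sqrt. generalize (pot_ge_1 x); lra. Qed.

Lemma b_eq (x : R) : b alpha theta x = Rpower (P x) (- / 4).
Proof.
  unfold b, c. fold (pot alpha theta x). fold P.
  rewrite <- Rpower_sqrt by apply exp_pos. rewrite Rpower_mult. f_equal. lra.
Qed.

Lemma b_pos (x : R) : 0 < b alpha theta x.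
Proof. rewrite b_eq. apply exp_pos. Qed.

Lemma b_le_1 (x : R) : b alpha theta x <= 1.
Proof.
  rewrite b_eq. apply Rpower_opp_le_1; [lra|apply pot_ge_1].
Qed.

(** The relation [b^2 phi' = 1] is what removes the first order term in the substitution [u = b v],
    [t = phi x]. *)
Lemma b_sqr_phi' (x : R) : b alpha theta x * b alpha theta x * sqrt (P x) = 1.
Proof.
  rewrite b_eq, sqrt_pot, <- !Rpower_plus.
  replace (- / 4 + - / 4 + / 2) with 0 by lra. apply Rpower_O. generalize (pot_ge_1 x); lra.
Qed.

Definition db (x : R) : R := - / 4 * dpot x * Rpower (P x) (- (5 / 4)).
Definition ddb (x : R) : R :=
  5 / 16 * dpot x ^ 2 * Rpower (P x) (- (9 / 4)) - / 4 * ddpot x * Rpower (P x) (- (5 / 4)).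

Lemma is_derive_b (x : R) : 0 < x -> is_derive (b alpha theta) x (db x).
Proof.
  intros H. apply (is_derive_ext (fun y => Rpower (P y) (- / 4))).
  { intros t. symmetry; apply b_eq. }
  eapply is_derive_eq; [now apply is_derive_pot_power|].
  unfold db. replace (- / 4 - 1) with (- (5 / 4)) by lra. reflexivity.
Qed.

Lemma is_derive_db (x : R) : 0 < x -> is_derive db x (ddb x).
Proof.
  intros H. eapply is_derive_eq.
  - apply Derive.is_derive_mult.
    + apply is_derive_scal. now apply is_derive_dpot.
    + now apply is_derive_pot_power.
  - unfold ddb. replace (- (5 / 4) - 1) with (- (9 / 4)) by lra. field.
Qed.

Lemma Derive_b (x : R) : 0 < x -> Derive (b alpha theta) x = db x.
Proof. intros H. now apply is_derive_unique, is_derive_b. Qed.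

Lemma Derive_2_b (x : R) : 0 < x -> Derive_n (b alpha theta) 2 x = ddb x.
Proof.
  intros H. simpl. apply is_derive_unique.
  apply (is_derive_ext_loc db); [|now apply is_derive_db].
  generalize (locally_gt 0 x H). apply filter_imp. intros y Hy. symmetry; now apply Derive_b.
Qed.

Lemma Derive_phi (x : R) : Derive (phi alpha theta) x = sqrt (P x).
Proof. apply is_derive_unique, is_derive_phi. Qed.

Lemma is_derive_sqrt_pot (x : R) : 0 < x ->
  is_derive (fun y => sqrt (P y)) x (dpot x / (2 * sqrt (P x))).
Proof.
  intros H. apply (is_derive_sqrt P x); [now apply is_derive_pot|].
  generalize (pot_ge_1 x); lra.
Qed.

Lemma Derive_2_phi (x : R) : 0 < x ->
  Derive_n (phi alpha theta) 2 x = dpot x / (2 * sqrt (P x)).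
Proof.
  intros H. simpl. apply is_derive_unique.
  apply (is_derive_ext (fun y => sqrt (P y))); [|now apply is_derive_sqrt_pot].
  intros t. symmetry. apply Derive_phi.
Qed.

Lemma V_coefficient (x : R) : 0 < x ->
  Derive_n (phi alpha theta) 2 x / (2 * Derive (phi alpha theta) x) = dpot x / (4 * P x).
Proof.
  intros H. rewrite Derive_2_phi, Derive_phi by exact H.
  generalize (sqrt_pot_ge_1 x) (pot_ge_1 x); intros.
  rewrite <- (sqrt_sqrt (P x)) at 3 by lra. field. lra.
Qed.

(** The integrand [b' / b] of the expansion is minus the coefficient [phi'' / (2 phi')] of the
    operator, both being logarithmic derivatives of powers of [P]. *)
Lemma db_over_b (x : R) : db x / b alpha theta x = - (dpot x / (4 * P x)).
Proof.
  rewrite b_eq. unfold db. replace (- (5 / 4)) with (- / 4 + - (1)) by lra.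
  rewrite Rpower_plus. rewrite (Rpower_Ropp (P x) 1), Rpower_1 by (generalize (pot_ge_1 x); lra).
  assert (0 < Rpower (P x) (- / 4)) by apply exp_pos.
  generalize (pot_ge_1 x); intros. field. lra.
Qed.

Lemma M_eq (x : R) : 0 < x -> M alpha theta x = b alpha theta x * ddb x.
Proof. intros H. unfold M. now rewrite Derive_2_b. Qed.

Lemma bb'_eq (x : R) : 0 < x -> bb' alpha theta x = b alpha theta x * db x.
Proof. intros H. unfold bb'. now rewrite Derive_b. Qed.

Lemma M_continuous (x : R) : 0 < x -> continuous (M alpha theta) x.
Proof.
  intros H. apply (continuous_ext_loc _ (fun y => b alpha theta y * ddb y)).
  { generalize (locally_gt 0 x H). apply filter_imp. intros y Hy. symmetry; now apply M_eq. }
  apply continuous_mult_R; [eapply continuous_of_derive, is_derive_b, H|].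
  assert (Hd : continuous dpot x) by (eapply continuous_of_derive, is_derive_dpot, H).
  assert (HP : forall s, continuous (fun y => Rpower (P y) s) x)
    by (intros; eapply continuous_of_derive, is_derive_pot_power, H).
  unfold ddb. apply continuous_minus_R.
  - apply continuous_mult_R; [|apply HP].
    apply continuous_mult_R; [apply continuous_const|].
    apply (continuous_mult_R dpot (fun y => dpot y * 1)); [exact Hd|].
    apply (continuous_mult_R dpot (fun _ => 1)); [exact Hd|apply continuous_const].
  - apply continuous_mult_R; [|apply HP].
    apply continuous_mult_R; [apply continuous_const|].
    unfold ddpot. eapply continuous_of_derive. do 3 apply is_derive_scal.
    apply is_derive_Rpower, H.
Qed.

End Potential.

(** * Damped oscillating exponentials *)

Lemma wave_diff (a b s t : R) : (wave (- a) (- b) s * wave a b t)%C = wave a b (t - s).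
Proof.
  unfold wave. replace (a * (t - s)) with (- a * s + a * t) by ring.
  replace (b * (t - s)) with (- b * s + b * t) by ring.
  rewrite exp_plus, cis_plus, RtoC_mult. ring.
Qed.

Lemma Cmod_wave_le_1 (a b t : R) : a <= 0 -> 0 <= t -> Cmod (wave a b t) <= 1.
Proof.
  intros Ha Ht. rewrite Cmod_wave, <- exp_0.
  apply exp_le_compat. nra.
Qed.

(** The first bound serves large [t], the second serves bounded [t] with [a] near [0]; together they
    give a dominated convergence as the damping disappears. *)
Lemma wave_damping (a b t : R) : a <= 0 -> 0 <= t ->
  Cmod (wave a b t - wave 0 b t)%C <= 1 /\ Cmod (wave a b t - wave 0 b t)%C <= - a * t.
Proof.
  intros Ha Ht.
  replace (wave a b t - wave 0 b t)%C with (RtoC (exp (a * t) - 1) * cis (b * t))%C.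
  2: { unfold wave. rewrite Rmult_0_l, exp_0, RtoC_minus. ring. }
  rewrite Cmod_mult, Cmod_cis, Cmod_R, Rmult_1_r.
  generalize (exp_pos (a * t)) (exp_ineq1_le (a * t)); intros.
  assert (exp (a * t) <= 1).
  { rewrite <- exp_0. apply exp_le_compat. nra. }
  rewrite Rabs_left1 by lra. lra.
Qed.

(** * Jost solutions at infinity *)

Definition zeta (sigma : R) : C := (1 + Ci * RtoC sigma)%C.

Lemma zeta_0 : zeta 0 = RtoC 1.
Proof. unfold zeta. ring. Qed.

Lemma Cmod_zeta_ge_1 (sigma : R) : 1 <= Cmod (zeta sigma).
Proof.
  eapply Rle_trans; [|apply (Cmod_Re (zeta sigma))].
  unfold zeta; simpl. rewrite Rabs_right; lra.
Qed.

Lemma zeta_neq_0 (sigma : R) : zeta sigma <> RtoC 0.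
Proof. intros H. generalize (Cmod_zeta_ge_1 sigma). rewrite H, Cmod_0. lra. Qed.

Lemma Ci_neq_0 : Ci <> RtoC 0.
Proof. intros H. apply (f_equal snd) in H. simpl in H. lra. Qed.

Lemma two_neq_0 : RtoC 2 <> RtoC 0.
Proof. intros H. apply (f_equal fst) in H. simpl in H. lra. Qed.

Lemma two_Ci_zeta_neq_0 (sigma : R) : (2 * Ci * zeta sigma)%C <> RtoC 0.
Proof.
  apply Cmult_neq_0; [apply Cmult_neq_0|]; [apply two_neq_0|apply Ci_neq_0|apply zeta_neq_0].
Qed.

Lemma Cmod_Ci : Cmod Ci = 1.
Proof. transitivity (sqrt 1); [|apply sqrt_1]. unfold Cmod, Ci; simpl. f_equal. ring. Qed.

Lemma Cmod_half_inv_zeta (sigma : R) : Cmod (/ (2 * Ci * zeta sigma))%C <= / 2.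
Proof.
  rewrite Cmod_inv by apply two_Ci_zeta_neq_0.
  rewrite !Cmod_mult, Cmod_Ci, Cmod_R, Rabs_right by lra.
  apply Rinv_le_contravar; [lra|]. generalize (Cmod_zeta_ge_1 sigma); lra.
Qed.

Lemma Cmod_inv_zeta_diff (sigma : R) :
  Cmod (/ (2 * Ci * zeta sigma) - / (2 * Ci))%C <= Rabs sigma / 2.
Proof.
  replace (/ (2 * Ci * zeta sigma) - / (2 * Ci))%C
    with (- RtoC sigma * Ci * / (2 * Ci * zeta sigma))%C.
  2: { generalize (zeta_neq_0 sigma) Ci_neq_0 two_neq_0. unfold zeta; intros. field.
       repeat split; assumption. }
  rewrite !Cmod_mult, Cmod_opp, Cmod_Ci, Cmod_R.
  generalize (Cmod_half_inv_zeta sigma) (Rabs_pos sigma); intros. nra.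
Qed.

Section Jost.

Variables (phi omega N : R -> R) (a mu : R).
Hypothesis a_pos : 0 < a.
Hypothesis phi_derive : forall x, is_derive phi x (omega x).
Hypothesis phi_mono : forall x y, x <= y -> phi x <= phi y.
Hypothesis phi_a : 0 <= phi a.
Hypothesis N_cont : forall x, continuous N x.
Hypothesis N_bound : forall x, a <= x -> Rabs (N x) <= mu * Rpower x (- (1 + / 2)).
(** Origin of the [8]: the kernel has modulus at most [2], the integral of [x^(-3/2)] gives another
    [2], so the integral of the kernel is at most [4 mu a^(-1/2) <= 1/2]; the prefactor
    [1 / (2 i zeta)] brings the ratio down to [1/4]. *)
Hypothesis mu_small : 8 * mu * Rpower a (- / 2) <= 1.

(* In terms of [t = phi x] and [u = b exp (- i zeta t) s], the amplitude [s]
   satisfies [s'' - 2 i zeta s' + m s = 0] with [m dt = N dx], and [r] is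
   [ds / dt].  [A] and [B] are the primitives of [N s] and of
   [exp (- 2 i zeta phi) N s] that vanish at infinity. *)
Definition jost (sigma : R) (s r A B : R -> C) : Prop :=
  (forall x, cont_RC s x) /\ (forall x, Cmod (s x) <= 2) /\
  (forall x, is_derive_RC A x (RtoC (N x) * s x)%C) /\ vanishes_at_infinity A /\
  (forall x, is_derive_RC B x (wave (2 * sigma) (-2) (phi x) * (RtoC (N x) * s x))%C) /\
  vanishes_at_infinity B /\
  (forall x, r x = - (wave (- (2 * sigma)) 2 (phi x) * B x))%C /\
  (forall x, a <= x -> s x = 1 + / (2 * Ci * zeta sigma) * (A x + r x))%C.

Lemma mu_ge_0 : 0 <= mu.
Proof.
  generalize (N_bound a (Rle_refl a)) (Rabs_pos (N a)) (exp_pos (- (1 + / 2) * ln a)).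
  unfold Rpower. intros. nra.
Qed.

Lemma Rpower_a_bound (x : R) : a <= x -> Rpower x (- / 2) <= Rpower a (- / 2).
Proof. intros H. apply Rpower_opp_le; lra. Qed.

Lemma phi_ge_0 (x : R) : a <= x -> 0 <= phi x.
Proof. intros H. generalize (phi_mono a x H); lra. Qed.

Lemma phi_cont (x : R) : continuous phi x.
Proof. eapply continuous_of_derive, phi_derive. Qed.

Lemma RtoC_N_mult_bound (f : R -> C) (K : R) (x : R) :
  a <= x -> Cmod (f x) <= K -> Cmod (RtoC (N x) * f x)%C <= K * mu * Rpower x (- (1 + / 2)).
Proof.
  intros Hx Hf. rewrite Cmod_mult, Cmod_R.
  generalize (N_bound x Hx) (Rabs_pos (N x)) (Cmod_ge_0 (f x)); intros.
  apply Rle_trans with (mu * Rpower x (- (1 + / 2)) * K); [|lra].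
  apply Rmult_le_compat; lra.
Qed.

Section FixedSigma.

Variable sigma : R.
Hypothesis sigma_le_0 : sigma <= 0.

Let Af (f : R -> C) := prim_inf (fun x => RtoC (N x) * f x)%C.
Let Bf (f : R -> C) := prim_inf (fun x => wave (2 * sigma) (-2) (phi x) * (RtoC (N x) * f x))%C.
Let E (x : R) := wave (- (2 * sigma)) 2 (phi x).

Lemma Af_spec (f : R -> C) (K : R) :
  (forall x, cont_RC f x) -> (forall x, Cmod (f x) <= K) ->
  (forall x, is_derive_RC (Af f) x (RtoC (N x) * f x)%C) /\ vanishes_at_infinity (Af f).
Proof.
  intros Hf HK. apply (prim_inf_spec _ a (/ 2) (K * mu)); [exact a_pos|lra| |].
  - intros y. apply cont_RC_mult; [apply cont_RC_RtoC, N_cont|apply Hf].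
  - intros x Hx. now apply RtoC_N_mult_bound.
Qed.

Lemma Bf_spec (f : R -> C) (K : R) :
  (forall x, cont_RC f x) -> (forall x, Cmod (f x) <= K) ->
  (forall x, is_derive_RC (Bf f) x (wave (2 * sigma) (-2) (phi x) * (RtoC (N x) * f x))%C) /\
  vanishes_at_infinity (Bf f).
Proof.
  intros Hf HK. apply (prim_inf_spec _ a (/ 2) (K * mu)); [exact a_pos|lra| |].
  - intros y. apply cont_RC_mult; [apply cont_RC_wave, phi_cont|].
    apply cont_RC_mult; [apply cont_RC_RtoC, N_cont|apply Hf].
  - intros x Hx. rewrite Cmod_mult.
    generalize (Cmod_wave_le_1 (2 * sigma) (-2) (phi x) ltac:(lra) (phi_ge_0 x Hx))
      (RtoC_N_mult_bound f K x Hx (HK x)) (Cmod_ge_0 (wave (2 * sigma) (-2) (phi x)))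
      (Cmod_ge_0 (RtoC (N x) * f x)%C). intros. nra.
Qed.

(** With [E] frozen at the base point [x], the growing factor [E x] meets the decaying one as
    [exp(2 (sigma - i) (phi y - phi x))], of modulus at most [1] for [y >= x]. The kernel
    [1 - exp(...)] is then bounded by [2], and [tail_bound] applies in [y]. *)
Lemma jost_kernel_bound (f1 f2 A1 A2 B1 B2 : R -> C) (K : R) :
  (forall x, is_derive_RC A1 x (RtoC (N x) * f1 x)%C) -> vanishes_at_infinity A1 ->
  (forall x, is_derive_RC A2 x (RtoC (N x) * f2 x)%C) -> vanishes_at_infinity A2 ->
  (forall x, is_derive_RC B1 x (wave (2 * sigma) (-2) (phi x) * (RtoC (N x) * f1 x))%C) ->
  vanishes_at_infinity B1 ->
  (forall x, is_derive_RC B2 x (wave (2 * sigma) (-2) (phi x) * (RtoC (N x) * f2 x))%C) ->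
  vanishes_at_infinity B2 ->
  (forall x, Cmod (f1 x - f2 x)%C <= K) ->
  forall x, a <= x ->
  Cmod ((A1 x - E x * B1 x) - (A2 x - E x * B2 x))%C <= 4 * K * mu * Rpower x (- / 2).
Proof.
  intros HA1 VA1 HA2 VA2 HB1 VB1 HB2 VB2 HK x Hx.
  set (D := fun y => ((A1 y - E x * B1 y) - 1 * (A2 y - E x * B2 y))%C).
  replace ((A1 x - E x * B1 x) - (A2 x - E x * B2 x))%C with (D x) by (unfold D; ring).
  replace (4 * K * mu) with (2 * K * mu / / 2) by field.
  apply (tail_bound D (fun y => RtoC (N y) * (f1 y - f2 y) *
     (1 - E x * wave (2 * sigma) (-2) (phi y)))%C x (/ 2)); try lra.
  - intros y _. unfold D. eapply is_derive_RC_eq.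
    + apply is_derive_RC_minus.
      * apply is_derive_RC_minus; [apply HA1|].
        apply is_derive_RC_mult; [apply is_derive_RC_const|apply HB1].
      * apply is_derive_RC_mult; [apply is_derive_RC_const|].
        apply is_derive_RC_minus; [apply HA2|].
        apply is_derive_RC_mult; [apply is_derive_RC_const|apply HB2].
    + cbv beta. ring.
  - intros y Hy. rewrite Cmod_mult.
    assert (HN := RtoC_N_mult_bound (fun y => f1 y - f2 y)%C K y ltac:(lra) (HK y)).
    simpl in HN.
    assert (H2 : Cmod (1 - E x * wave (2 * sigma) (-2) (phi y))%C <= 2).
    { apply Cmod_triangle_le. rewrite Cmod_opp, Cmod_1. unfold E.
      replace 2 with (- (-2)) at 2 by ring. rewrite wave_diff.
      generalize (Cmod_wave_le_1 (2 * sigma) (-2) (phi y - phi x) ltac:(lra)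
        ltac:(generalize (phi_mono x y Hy); lra)). lra. }
    generalize (Cmod_ge_0 (RtoC (N y) * (f1 y - f2 y))%C)
      (Cmod_ge_0 (1 - E x * wave (2 * sigma) (-2) (phi y))%C); intros. nra.
  - apply vanishes_minus; [|apply vanishes_scal]; (apply vanishes_minus; [assumption|now apply vanishes_scal]).
Qed.

(** [Rmax x a] continues the image as a constant to the left of [a], where neither the bound on [N]
    nor the sign of [phi] is available; the iterates remain continuous on the whole line. *)
Let T (f : R -> C) (x : R) : C :=
  (/ (2 * Ci * zeta sigma) * (Af f (Rmax x a) - E (Rmax x a) * Bf f (Rmax x a)))%C.

Lemma jost_contraction (f1 f2 : R -> C) (K1 K2 K : R) :
  (forall x, cont_RC f1 x) -> (forall x, cont_RC f2 x) ->
  (forall x, Cmod (f1 x) <= K1) -> (forall x, Cmod (f2 x) <= K2) ->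
  (forall x, Cmod (f1 x - f2 x)%C <= K) ->
  forall x, Cmod (T f1 x - T f2 x)%C <= K / 4.
Proof.
  intros H1 H2 B1 B2 HK x.
  destruct (Af_spec f1 K1 H1 B1) as [P1 P2]. destruct (Af_spec f2 K2 H2 B2) as [P3 P4].
  destruct (Bf_spec f1 K1 H1 B1) as [P5 P6]. destruct (Bf_spec f2 K2 H2 B2) as [P7 P8].
  assert (Hk := jost_kernel_bound f1 f2 _ _ _ _ K P1 P2 P3 P4 P5 P6 P7 P8 HK (Rmax x a) (Rmax_r _ _)).
  unfold T.
  match goal with |- Cmod (?z * ?u - ?z * ?v)%C <= _ =>
    replace (z * u - z * v)%C with (z * (u - v))%C by ring end.
  rewrite Cmod_mult.
  assert (HK0 : 0 <= K) by (generalize (HK x) (Cmod_ge_0 (f1 x - f2 x)%C); lra).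
  assert (Hr := Rpower_a_bound (Rmax x a) (Rmax_r _ _)).
  assert (Hz := Cmod_half_inv_zeta sigma).
  match goal with |- ?u * ?v <= _ => set (U := u) in *; set (Z := v) in * end.
  assert (0 <= Z) by apply Cmod_ge_0. assert (0 <= U) by apply Cmod_ge_0.
  assert (Z <= 4 * K * (mu * Rpower a (- / 2))).
  { eapply Rle_trans; [exact Hk|]. generalize mu_ge_0; intros.
    replace (4 * K * mu * Rpower (Rmax x a) (- / 2)) with (4 * K * (mu * Rpower (Rmax x a) (- / 2))) by ring.
    apply Rmult_le_compat_l; [lra|]. apply Rmult_le_compat_l; lra. }
  assert (4 * K * (mu * Rpower a (- / 2)) <= K / 2).
  { replace (K / 2) with (K / 2 * 1) by ring.
    replace (4 * K * (mu * Rpower a (- / 2))) with (K / 2 * (8 * mu * Rpower a (- / 2))) by field.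
    apply Rmult_le_compat_l; lra. }
  nra.
Qed.

(** The primitive of the zero integrand comes from [epsilon], so its vanishing has to be derived:
    [tail_bound] with constant [0]. *)
Lemma T_zero (x : R) : T (fun _ => RtoC 0) x = RtoC 0.
Proof.
  assert (Hc : forall x, cont_RC (fun _ => RtoC 0) x) by (intros; apply cont_RC_const).
  assert (Hb : forall x : R, Cmod ((fun _ => RtoC 0) x) <= 0) by (intros; rewrite Cmod_0; lra).
  destruct (Af_spec _ 0 Hc Hb) as [P1 P2]. destruct (Bf_spec _ 0 Hc Hb) as [P3 P4].
  assert (Hm := Rmax_r x a).
  assert (HA : Af (fun _ => RtoC 0) (Rmax x a) = RtoC 0).
  { apply Cmod_le_0, Rle_trans with (0 / / 2 * Rpower (Rmax x a) (- / 2)); [|lra].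
    apply (tail_bound _ (fun x => RtoC (N x) * 0)%C a (/ 2) 0); try lra; auto.
    intros. rewrite Cmult_0_r, Cmod_0. lra. }
  assert (HB : Bf (fun _ => RtoC 0) (Rmax x a) = RtoC 0).
  { apply Cmod_le_0, Rle_trans with (0 / / 2 * Rpower (Rmax x a) (- / 2)); [|lra].
    apply (tail_bound _ _ a (/ 2) 0 a_pos ltac:(lra) (fun x _ => P3 x)); try assumption.
    intros. rewrite !Cmult_0_r, Cmod_0. lra. }
  unfold T. rewrite HA, HB. ring.
Qed.

Lemma continuous_Rmax (x : R) : continuous (fun x => Rmax x a) x.
Proof.
  apply (continuous_ext (fun x => (x + a + Rabs (x - a)) / 2)).
  - intros t. unfold Rmax. destruct (Rle_dec t a).
    + rewrite Rabs_left1; lra.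
    + rewrite Rabs_right; lra.
  - apply (continuous_mult_R (fun x => x + a + Rabs (x - a)) (fun _ => / 2));
      [|apply continuous_const].
    apply continuous_plus_R.
    + apply continuous_plus_R;
        [apply continuous_id|apply continuous_const].
    + apply (continuous_comp (fun x => x - a) Rabs); [|apply continuous_Rabs].
      apply continuous_minus_R;
        [apply continuous_id|apply continuous_const].
Qed.

Lemma jost_exists : exists s r A B : R -> C, jost sigma s r A B.
Proof.
  destruct (contraction_fixpoint (fun _ : R => 1) (fun f => forall x, cont_RC f x) T
    (fun _ => RtoC 1) 1) as [s [Hs [Hb Hfix]]].
  - intros; lra.
  - lra.
  - intros; apply cont_RC_const.
  - intros fn f K Hfn Hlim. apply (cont_RC_limit (fun _ => 1) fn f K); try assumption.
    + intros; apply continuous_const.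
    + intros; lra.
  - intros f K Hf HK x.
    assert (HK' : forall x, Cmod (f x) <= K) by (intros y; specialize (HK y); simpl in HK; lra).
    destruct (Af_spec f K Hf HK') as [P1 _]. destruct (Bf_spec f K Hf HK') as [P2 _].
    apply cont_RC_plus; [apply cont_RC_const|].
    unfold T.
    apply (cont_RC_comp (fun x => Rmax x a)
      (fun x => / (2 * Ci * zeta sigma) * (Af f x - E x * Bf f x))%C); [apply continuous_Rmax|].
    apply cont_RC_mult; [apply cont_RC_const|].
    apply cont_RC_minus; [eapply is_derive_RC_continuous, P1|].
    apply cont_RC_mult; [apply cont_RC_wave, phi_cont|eapply is_derive_RC_continuous, P2].
  - intros f1 f2 K1 K2 K H1 H2 B1 B2 HK x.
    assert (B1' : forall x, Cmod (f1 x) <= K1) by (intros y; specialize (B1 y); simpl in B1; lra).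
    assert (B2' : forall x, Cmod (f2 x) <= K2) by (intros y; specialize (B2 y); simpl in B2; lra).
    assert (HK' : forall x, Cmod (f1 x - f2 x)%C <= K) by (intros y; specialize (HK y); simpl in HK; lra).
    generalize (jost_contraction f1 f2 K1 K2 K H1 H2 B1' B2' HK' x).
    generalize (HK' x) (Cmod_ge_0 (f1 x - f2 x)%C). lra.
  - apply T_zero.
  - intros x. rewrite Cmod_1. lra.
  - assert (Hb2 : forall x, Cmod (s x) <= 2) by (intros y; specialize (Hb y); simpl in Hb; lra).
    destruct (Af_spec s 2 Hs Hb2) as [P1 P2]. destruct (Bf_spec s 2 Hs Hb2) as [P3 P4].
    exists s, (fun x => - (E x * Bf s x))%C, (Af s), (Bf s).
    do 6 (split; [assumption|]). split; [reflexivity|].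
    intros x Hx. rewrite Hfix. unfold T. rewrite Rmax_left by exact Hx. ring.
Qed.

End FixedSigma.

(** The kernel bound is applied to the pair [s], [0]: with [|s| <= 2] it gives [8 mu a^(-1/2) <= 1],
    and the prefactor halves this. *)
Lemma jost_amplitude_near_1 (sigma : R) (s r A B : R -> C) :
  sigma <= 0 -> jost sigma s r A B -> forall x, a <= x -> Cmod (s x - 1)%C <= / 2.
Proof.
  intros Hs [H1 [H2 [H3 [H4 [H5 [H6 [H7 H8]]]]]]] x Hx.
  set (z := fun _ : R => RtoC 0).
  assert (Hz : forall w : R -> C, forall x, is_derive_RC z x (w x * z x)%C).
  { intros w y. eapply is_derive_RC_eq; [apply is_derive_RC_const|unfold z; ring]. }
  assert (Vz : vanishes_at_infinity z) by apply vanishes_0.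
  assert (Hk := jost_kernel_bound sigma Hs s z A z B z 2 H3 H4 (Hz _) Vz H5 H6).
  rewrite H8 by exact Hx. rewrite H7.
  replace (1 + / (2 * Ci * zeta sigma) * (A x + - (wave (- (2 * sigma)) 2 (phi x) * B x)) - 1)%C
    with (/ (2 * Ci * zeta sigma) * (A x - wave (- (2 * sigma)) 2 (phi x) * B x))%C by ring.
  rewrite Cmod_mult.
  assert (Hz2 := Cmod_half_inv_zeta sigma).
  assert (Hb : Cmod (A x - wave (- (2 * sigma)) 2 (phi x) * B x)%C <= 1).
  { replace (A x - wave (- (2 * sigma)) 2 (phi x) * B x)%C
      with (A x - wave (- (2 * sigma)) 2 (phi x) * B x -
         (z x - wave (- (2 * sigma)) 2 (phi x) * z x))%C by (unfold z; ring).
    eapply Rle_trans; [apply Hk; try assumption|].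
    - intros y. eapply is_derive_RC_eq; [apply is_derive_RC_const|unfold z; ring].
    - intros y. unfold z. replace (s y - 0)%C with (s y) by ring. apply H2.
    - generalize (Rpower_a_bound x Hx) mu_ge_0; intros. nra. }
  generalize (Cmod_ge_0 (/ (2 * Ci * zeta sigma))%C)
    (Cmod_ge_0 (A x - wave (- (2 * sigma)) 2 (phi x) * B x)%C); intros. nra.
Qed.

Lemma jost_r_bound (sigma : R) (s r A B : R -> C) :
  sigma <= 0 -> jost sigma s r A B ->
  forall x, a <= x -> Cmod (r x) <= 4 * mu * Rpower x (- / 2).
Proof.
  intros Hs [H1 [H2 [H3 [H4 [H5 [H6 [H7 H8]]]]]]] x Hx. rewrite H7, Cmod_opp.
  replace (4 * mu) with (2 * mu / / 2) by field.
  apply (tail_bound (fun y => wave (- (2 * sigma)) 2 (phi x) * B y)%C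
    (fun y => wave (2 * sigma) (-2) (phi y - phi x) * (RtoC (N y) * s y))%C x (/ 2)); try lra.
  - intros y Hy. eapply is_derive_RC_eq.
    + apply is_derive_RC_mult; [apply is_derive_RC_const|apply H5].
    + rewrite <- wave_diff. replace (- (-2)) with 2 by ring. ring.
  - intros y Hy. rewrite Cmod_mult.
    generalize (Cmod_wave_le_1 (2 * sigma) (-2) (phi y - phi x) ltac:(lra)
        ltac:(generalize (phi_mono x y Hy); lra))
      (RtoC_N_mult_bound s 2 y ltac:(lra) (H2 y))
      (Cmod_ge_0 (wave (2 * sigma) (-2) (phi y - phi x))) (Cmod_ge_0 (RtoC (N y) * s y)%C).
    intros. nra.
  - now apply vanishes_scal.
Qed.

(** Differentiating the integral equation, the terms [N s] coming from [A] and from [r] cancel. The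
    strict inequality [a < x] is there because that equation holds on [[a, +oo)] and a neighbourhood
    of [x] is required. *)
Lemma jost_system (sigma : R) (s r A B : R -> C) :
  jost sigma s r A B -> forall x, a < x ->
  is_derive_RC s x (RtoC (omega x) * r x)%C /\
  is_derive_RC r x (2 * Ci * zeta sigma * RtoC (omega x) * r x - RtoC (N x) * s x)%C.
Proof.
  intros [H1 [H2 [H3 [H4 [H5 [H6 [H7 H8]]]]]]] x Hx.
  assert (Hr : is_derive_RC r x (2 * Ci * zeta sigma * RtoC (omega x) * r x - RtoC (N x) * s x)%C).
  { apply (is_derive_RC_ext (fun x => - (wave (- (2 * sigma)) 2 (phi x) * B x))%C).
    { intros t; now rewrite H7. }
    eapply is_derive_RC_eq.
    - apply is_derive_RC_opp, is_derive_RC_mult; [apply is_derive_RC_wave, phi_derive|apply H5].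
    - rewrite H7. unfold zeta.
      assert (Hw : (wave (- (2 * sigma)) 2 (phi x) * wave (2 * sigma) (-2) (phi x))%C = RtoC 1).
      { replace 2 with (- (-2)) at 2 by ring. rewrite wave_diff.
        rewrite Rminus_diag. apply wave_0_r. }
      match goal with |- (- (?p + ?w * (?v * ?q)))%C = _ =>
        replace (w * (v * q))%C with (w * v * q)%C by ring end.
      rewrite Hw. rewrite !RtoC_opp, !RtoC_mult.
      assert (Ci * Ci = - RtoC 1)%C by (apply C_eta; simpl; ring).
      match goal with |- ?L = ?R0 => replace R0 with
        (2 * Ci * RtoC (omega x) * (- (wave (- (2 * sigma)) 2 (phi x) * B x))
         + 2 * (Ci * Ci) * RtoC sigma * RtoC (omega x) * (- (wave (- (2 * sigma)) 2 (phi x) * B x))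
         - RtoC (N x) * s x)%C by ring end.
      rewrite H. ring. }
  split; [|exact Hr].
  apply (is_derive_RC_ext_loc (fun x => 1 + / (2 * Ci * zeta sigma) * (A x + r x))%C).
  { generalize (locally_gt a x Hx). apply filter_imp. intros y Hy. symmetry. apply H8; lra. }
  eapply is_derive_RC_eq.
  - apply is_derive_RC_plus; [apply is_derive_RC_const|].
    apply is_derive_RC_mult; [apply is_derive_RC_const|].
    apply is_derive_RC_plus; [apply H3|exact Hr].
  - cbv beta. field. split; [apply zeta_neq_0|apply Ci_neq_0].
Qed.

(** Dominated convergence by hand. The decay [y^(-3/2)] is split as [y^(-1/4) y^(-5/4)]: far out the
    first factor is small, and on the remaining bounded range [phi] is bounded, so that the wave
    difference is [O(sigma)]. The second factor stays integrable. *)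
Lemma jost_damping_small (eps : R) : 0 < eps ->
  exists delta, 0 < delta /\ forall sigma, - delta < sigma -> sigma <= 0 ->
  forall x y, a <= x -> x <= y ->
  2 * Rabs (N y) * (Rabs sigma + Cmod (wave (2 * sigma) (-2) (phi y - phi x)
                                - wave 0 (-2) (phi y - phi x))%C)
  <= eps * Rpower y (- (1 + / 4)).
Proof.
  intros He. assert (Hmu := mu_ge_0).
  (* The [4] is the prefactor [2] times the crude bound [|sigma| + |w| <= 2] used beyond [Y']. *)
  destruct (Rpower_opp_vanishes (/ 4) (eps / (4 * (mu + 1)))) as [Y [HY0 HY]]; [lra| |].
  { apply Rdiv_lt_0_compat; lra. }
  set (Y' := Rmax Y a).
  assert (HpY := phi_ge_0 Y' (Rmax_r _ _)).
  set (G := 2 * (mu + 1) * Rpower a (- / 4) * (1 + 2 * phi Y')).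
  assert (Ha4 : 0 < Rpower a (- / 4)) by apply exp_pos.
  assert (HG : 0 < G).
  { unfold G. apply Rmult_lt_0_compat; [|lra]. apply Rmult_lt_0_compat; lra. }
  exists (Rmin 1 (eps / G)). split.
  { apply Rmin_glb_lt; [lra|]. now apply Rdiv_lt_0_compat. }
  intros sigma Hs1 Hs2 x y Hx Hxy.
  assert (Hs3 : - sigma < 1) by (generalize (Rmin_l 1 (eps / G)); lra).
  assert (Hs4 : - sigma * G < eps).
  { apply Rlt_div_r; [exact HG|]. generalize (Rmin_r 1 (eps / G)); lra. }
  rewrite (Rabs_left1 sigma) by exact Hs2.
  destruct (wave_damping (2 * sigma) (-2) (phi y - phi x)) as [Hw1 Hw2];
    [lra|generalize (phi_mono x y Hxy); lra|].
  set (w := Cmod _) in *.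
  assert (Hw0 : 0 <= w) by apply Cmod_ge_0.
  assert (HNy := N_bound y ltac:(lra)).
  replace (- (1 + / 2)) with (- / 4 + - (1 + / 4)) in HNy by lra.
  rewrite Rpower_plus in HNy.
  assert (HN0 := Rabs_pos (N y)).
  set (p := Rpower y (- (1 + / 4))) in *.
  assert (Hp : 0 < p) by apply exp_pos.
  assert (Hy4 : 0 < Rpower y (- / 4)) by apply exp_pos.
  destruct (Rle_dec y Y') as [HyY|HyY].
  - assert (Hw3 : - sigma + w <= - sigma * (1 + 2 * phi Y')).
    { generalize (phi_mono y Y' HyY) (phi_ge_0 x Hx). intros. nra. }
    assert (H4 : Rpower y (- / 4) <= Rpower a (- / 4)) by (apply Rpower_opp_le; lra).
    assert (H5 : Rabs (N y) <= (mu + 1) * Rpower a (- / 4) * p).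
    { eapply Rle_trans; [exact HNy|]. rewrite <- Rmult_assoc. apply Rmult_le_compat_r; [lra|].
      apply Rmult_le_compat; lra. }
    apply Rle_trans with (2 * ((mu + 1) * Rpower a (- / 4) * p) * (- sigma * (1 + 2 * phi Y'))).
    + apply Rmult_le_compat; lra.
    + replace (2 * ((mu + 1) * Rpower a (- / 4) * p) * (- sigma * (1 + 2 * phi Y')))
        with (- sigma * G * p) by (unfold G; ring).
      apply Rmult_le_compat_r; lra.
  - assert (H4 : Rpower y (- / 4) <= eps / (4 * (mu + 1))).
    { apply HY. generalize (Rmax_l Y a). unfold Y' in HyY. lra. }
    apply Rle_div_r in H4; [|lra].
    assert (H5 : Rabs (N y) <= (mu + 1) * Rpower y (- / 4) * p).
    { eapply Rle_trans; [exact HNy|]. rewrite <- Rmult_assoc. apply Rmult_le_compat_r; [lra|].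
      apply Rmult_le_compat_r; lra. }
    apply Rle_trans with (2 * ((mu + 1) * Rpower y (- / 4) * p) * 2).
    + apply Rmult_le_compat; lra.
    + replace (2 * ((mu + 1) * Rpower y (- / 4) * p) * 2)
        with (Rpower y (- / 4) * (4 * (mu + 1)) * p) by ring.
      apply Rmult_le_compat_r; lra.
Qed.

Lemma mult_mu_small (K : R) (y : R) : 0 <= K -> a <= y ->
  K * mu * Rpower y (- (1 + / 2)) <= K * (mu * Rpower a (- / 4)) * Rpower y (- (1 + / 4)).
Proof.
  intros HK Hy. assert (Hmu := mu_ge_0).
  replace (- (1 + / 2)) with (- / 4 + - (1 + / 4)) by lra. rewrite Rpower_plus.
  replace (K * mu * (Rpower y (- / 4) * Rpower y (- (1 + / 4)))) with
   (K * (mu * Rpower y (- / 4)) * Rpower y (- (1 + / 4))) by ring.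
  apply Rmult_le_compat_r; [apply Rlt_le, exp_pos|].
  apply Rmult_le_compat_l; [exact HK|]. apply Rmult_le_compat_l; [exact Hmu|].
  apply Rpower_opp_le; lra.
Qed.

(** Subtracting the two integral equations, the difference of the amplitudes passes through the
    contraction, while the changes of [zeta] and of the damping act on the bounded [s0] and are made
    small by [jost_damping_small]. *)
Lemma jost_continuity (s0 r0 A0 B0 : R -> C) :
  jost 0 s0 r0 A0 B0 ->
  forall eps, 0 < eps -> exists delta, 0 < delta /\
  forall sigma s r A B, - delta < sigma -> sigma <= 0 -> jost sigma s r A B ->
  forall x, a <= x -> Cmod (s x - s0 x)%C <= eps /\ Cmod (r x - r0 x)%C <= eps.
Proof.
  intros [H1 [H2 [H3 [H4 [H5 [H6 [H7 H8]]]]]]] eps Heps.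
  set (q := Rpower a (- / 4)).
  assert (Hq : 0 < q) by apply exp_pos.
  assert (Hmu := mu_ge_0).
  assert (Hqq : 8 * mu * (q * q) <= 1).
  { unfold q. rewrite <- Rpower_plus. replace (- / 4 + - / 4) with (- / 2) by lra. exact mu_small. }
  (* The tail integral of [eps1 * y^(-5/4)] is at most [4 * eps1 * q], which this choice makes equal
     to [eps / 2]. *)
  set (eps1 := eps / (8 * q)).
  assert (He1 : 0 < eps1) by (apply Rdiv_lt_0_compat; lra).
  assert (He1q : 4 * eps1 * q = eps / 2) by (unfold eps1; field; lra).
  destruct (jost_damping_small eps1 He1) as [delta [Hd Hdelta]].
  exists delta. split; [exact Hd|].
  intros sigma s r A B Hs1 Hs2 [G1 [G2 [G3 [G4 [G5 [G6 [G7 G8]]]]]]].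
  assert (Hqx : forall x, a <= x -> Rpower x (- / 4) <= q).
  { intros x Hx. apply Rpower_opp_le; lra. }
  set (z := (/ (2 * Ci * zeta sigma))%C). set (z0 := (/ (2 * Ci * zeta 0))%C).
  assert (Hz0 : Cmod z0 <= / 2) by apply Cmod_half_inv_zeta.
  assert (Hz : Cmod z <= / 2) by apply Cmod_half_inv_zeta.
  assert (Hzz : Cmod (z - z0)%C <= Rabs sigma / 2).
  { unfold z0. rewrite zeta_0. replace (2 * Ci * 1)%C with (2 * Ci)%C by ring.
    apply Cmod_inv_zeta_diff. }
  assert (Hw : forall x y, x <= y -> Cmod (wave (2 * sigma) (-2) (phi y - phi x)) <= 1).
  { intros x y Hxy. apply Cmod_wave_le_1; [lra|]. generalize (phi_mono x y Hxy); lra. }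
  assert (Hstep : forall K, 0 <= K -> (forall y, a <= y -> Cmod (s y - s0 y)%C <= K) ->
     forall x, a <= x -> Cmod (s x - s0 x)%C <= K / 2 + eps / 2).
  { intros K HK0 HK x Hx.
    set (e := wave (- (2 * sigma)) 2 (phi x)). set (e0 := wave (- (2 * 0)) 2 (phi x)).
    set (D := fun y => (z * (A y - e * B y) - z0 * (A0 y - e0 * B0 y))%C).
    assert (HD : (s x - s0 x)%C = D x).
    { rewrite G8, H8, G7, H7 by exact Hx. unfold D, e, e0, z, z0. ring. }
    rewrite HD.
    apply Rle_trans with ((K * (mu * q) + eps1) / / 4 * Rpower x (- / 4)).
    - apply (tail_bound D (fun y => RtoC (N y) * ((s y - s0 y) * (z * (1 - wave (2 * sigma) (-2) (phi y - phi x)))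
         + s0 y * ((z - z0) * (1 - wave (2 * sigma) (-2) (phi y - phi x))
             - z0 * (wave (2 * sigma) (-2) (phi y - phi x) - wave 0 (-2) (phi y - phi x)))))%C x (/ 4));
        try lra.
      + intros y Hy. unfold D. eapply is_derive_RC_eq.
        * apply is_derive_RC_minus; (apply is_derive_RC_mult; [apply is_derive_RC_const|]);
          apply is_derive_RC_minus; [apply G3| |apply H3|];
          (apply is_derive_RC_mult; [apply is_derive_RC_const|]); [apply G5|apply H5].
        * cbv beta. rewrite <- !wave_diff. replace (- (-2)) with 2 by ring. unfold e, e0.
          replace (wave (2 * 0)) with (wave 0) by (f_equal; ring).
          replace (wave (- (2 * 0))) with (wave (- 0)) by (f_equal; ring). ring.
      + intros y Hy. rewrite Cmod_mult, Cmod_R.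
        set (w := wave (2 * sigma) (-2) (phi y - phi x)).
        set (w0 := wave 0 (-2) (phi y - phi x)).
        assert (Hw1 : Cmod (1 - w)%C <= 2).
        { apply Cmod_triangle_le. rewrite Cmod_opp, Cmod_1.
          generalize (Hw x y Hy); fold w; lra. }
        assert (Hsm := Hdelta sigma Hs1 Hs2 x y Hx Hy). fold w w0 in Hsm.
        assert (HN := N_bound y ltac:(lra)).
        assert (HM := mult_mu_small K y HK0 ltac:(lra)). fold q in HM.
        assert (B1 : Cmod ((s y - s0 y) * (z * (1 - w)))%C <= K).
        { rewrite !Cmod_mult. specialize (HK y ltac:(lra)).
          assert (Cmod z * Cmod (1 - w)%C <= 1).
          { generalize (Cmod_ge_0 z) (Cmod_ge_0 (1 - w)%C). nra. }
          assert (0 <= Cmod z * Cmod (1 - w)%C) by (apply Rmult_le_pos; apply Cmod_ge_0).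
          generalize (Cmod_ge_0 (s y - s0 y)%C). nra. }
        assert (B2 : Cmod (s0 y * ((z - z0) * (1 - w) - z0 * (w - w0)))%C
           <= 2 * (Rabs sigma + Cmod (w - w0)%C)).
        { rewrite Cmod_mult. apply Rmult_le_compat; try apply Cmod_ge_0; [apply H2|].
          apply Cmod_triangle_le. rewrite Cmod_opp, !Cmod_mult.
          generalize (Cmod_ge_0 (z - z0)%C) (Cmod_ge_0 (1 - w)%C) (Cmod_ge_0 (w - w0)%C) (Cmod_ge_0 z0).
          intros. apply Rplus_le_compat; nra. }
        apply Rle_trans with (Rabs (N y) * (K + 2 * (Rabs sigma + Cmod (w - w0)%C))).
        * apply Rmult_le_compat_l; [apply Rabs_pos|].
          apply Cmod_triangle_le. lra.
        * assert (Rabs (N y) * K <= K * mu * Rpower y (- (1 + / 2))).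
          { replace (K * mu * Rpower y (- (1 + / 2))) with (mu * Rpower y (- (1 + / 2)) * K) by ring.
            apply Rmult_le_compat_r; lra. }
          lra.
      + apply vanishes_minus; apply vanishes_scal; (apply vanishes_minus; [|apply vanishes_scal]); assumption.
    - replace ((K * (mu * q) + eps1) / / 4) with (4 * (K * (mu * q) + eps1)) by field.
      assert (0 <= K * (mu * q)) by (apply Rmult_le_pos; [|apply Rmult_le_pos]; lra).
      apply Rle_trans with (4 * (K * (mu * q) + eps1) * q).
      + apply Rmult_le_compat_l; [lra|]. now apply Hqx.
      + replace (4 * (K * (mu * q) + eps1) * q) with (K / 2 * (8 * mu * (q * q)) + 4 * eps1 * q) by field.
        nra. }
  assert (Hs : forall x, a <= x -> Cmod (s x - s0 x)%C <= eps).
  { replace eps with (2 * (eps / 2)) by field.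
    apply (halving_bound (fun x => Cmod (s x - s0 x)%C) a 4); try lra; [|exact Hstep].
    intros x _. apply Cmod_triangle_le. rewrite Cmod_opp.
    generalize (G2 x) (H2 x); lra. }
  intros x Hx. split; [now apply Hs|].
  set (e := wave (- (2 * sigma)) 2 (phi x)). set (e0 := wave (- (2 * 0)) 2 (phi x)).
  set (D := fun y => ((e0 * B0 y) - e * B y)%C).
  assert (HD : (r x - r0 x)%C = D x).
  { rewrite G7, H7. unfold D, e, e0. ring. }
  rewrite HD.
  apply Rle_trans with ((eps * (mu * q) + eps1) / / 4 * Rpower x (- / 4)).
  - apply (tail_bound D (fun y => - (RtoC (N y) * ((s y - s0 y) * wave (2 * sigma) (-2) (phi y - phi x)
         + s0 y * (wave (2 * sigma) (-2) (phi y - phi x) - wave 0 (-2) (phi y - phi x)))))%C x (/ 4));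
      try lra.
    + intros y Hy. unfold D. eapply is_derive_RC_eq.
      * apply is_derive_RC_minus; (apply is_derive_RC_mult; [apply is_derive_RC_const|]); [apply H5|apply G5].
      * cbv beta. rewrite <- !wave_diff. replace (- (-2)) with 2 by ring. unfold e, e0.
          replace (wave (2 * 0)) with (wave 0) by (f_equal; ring).
          replace (wave (- (2 * 0))) with (wave (- 0)) by (f_equal; ring). ring.
    + intros y Hy. rewrite Cmod_opp, Cmod_mult, Cmod_R.
      set (w := wave (2 * sigma) (-2) (phi y - phi x)).
      set (w0 := wave 0 (-2) (phi y - phi x)).
      assert (Hsm := Hdelta sigma Hs1 Hs2 x y Hx Hy). fold w w0 in Hsm.
      assert (HN := N_bound y ltac:(lra)).
      assert (HM := mult_mu_small eps y ltac:(lra) ltac:(lra)). fold q in HM.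
      apply Rle_trans with (Rabs (N y) * (eps + 2 * (Rabs sigma + Cmod (w - w0)%C))).
      * apply Rmult_le_compat_l; [apply Rabs_pos|].
        apply Cmod_triangle_le. rewrite !Cmod_mult.
        specialize (Hw x y Hy). fold w in Hw. specialize (Hs y ltac:(lra)).
        generalize (Cmod_ge_0 w) (Cmod_ge_0 (s y - s0 y)%C) (Cmod_ge_0 (s0 y)) (H2 y)
          (Cmod_ge_0 (w - w0)%C) (Rabs_pos sigma). intros.
        apply Rplus_le_compat; nra.
      * assert (Rabs (N y) * eps <= eps * mu * Rpower y (- (1 + / 2))).
        { replace (eps * mu * Rpower y (- (1 + / 2))) with (mu * Rpower y (- (1 + / 2)) * eps) by ring.
          apply Rmult_le_compat_r; lra. }
        lra.
    + apply vanishes_minus; apply vanishes_scal; assumption.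
  - replace ((eps * (mu * q) + eps1) / / 4) with (4 * (eps * (mu * q) + eps1)) by field.
    assert (0 <= eps * (mu * q)) by (apply Rmult_le_pos; [|apply Rmult_le_pos]; lra).
    apply Rle_trans with (4 * (eps * (mu * q) + eps1) * q).
    + apply Rmult_le_compat_l; [lra|]. now apply Hqx.
    + replace (4 * (eps * (mu * q) + eps1) * q) with (eps / 2 * (8 * mu * (q * q)) + 4 * eps1 * q) by field.
      nra.
Qed.

End Jost.

(** * Symbols and approximate Riccati solutions *)

Section WKB.

Variables (alpha a : R).
Hypothesis (alpha_pos : 0 < alpha) (a_pos : 0 < a).

Definition hpot (theta x : R) : R := theta * Rpower x alpha.

Lemma hpot_pos (theta x : R) : 0 < theta -> 0 < hpot theta x.
Proof. intros H. apply Rmult_lt_0_compat; [exact H|apply exp_pos]. Qed.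

Lemma pot_hpot (theta x : R) : 0 < x -> pot alpha theta x = 1 + hpot theta x.
Proof. apply pot_pos. Qed.

(** The ratio [h / P] carries the smallness in [theta] and stays below [1] for all [x]; the factor
    [P^(-1/2)] compensates the density [phi' = P^(1/2)] when a symbol is integrated in [t]. *)
Definition sym_weight (j : nat) (theta x : R) : R :=
  hpot theta x / pot alpha theta x * Rpower (pot alpha theta x) (- / 2) * (/ x) ^ j.

Definition sym_bound (j : nat) (f : R -> R -> C) : Prop :=
  exists K, 0 <= K /\ forall theta x, 0 < theta <= 1 -> a <= x ->
    Cmod (f theta x) <= K * sym_weight j theta x.

(* Symbols of order [j]: each derivative with respect to [t = phi x] gains a
   factor [1 / x], uniformly in [theta]. *)
Fixpoint symbol (N j : nat) (f : R -> R -> C) : Prop :=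
  sym_bound j f /\
  match N with
  | O => True
  | S N => exists g,
      (forall theta x, 0 < theta <= 1 -> a <= x ->
         is_derive_RC (f theta) x (RtoC (sqrt (pot alpha theta x)) * g theta x)%C) /\
      symbol N (S j) g
  end.

Lemma symbol_sym_bound (N j : nat) (f : R -> R -> C) : symbol N j f -> sym_bound j f.
Proof. destruct N; intros [H _]; exact H. Qed.

Lemma symbol_pred (N j : nat) (f : R -> R -> C) : symbol (S N) j f -> symbol N j f.
Proof.
  revert j f; induction N as [|N IH]; intros j f [H1 [g [H2 H3]]].
  - split; [exact H1|exact Logic.I].
  - split; [exact H1|]. exists g. split; [exact H2|]. now apply IH.
Qed.

Lemma sym_weight_pos (j : nat) (theta x : R) : 0 < theta -> a <= x -> 0 < sym_weight j theta x.
Proof.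
  intros Ht Hx. unfold sym_weight.
  apply Rmult_lt_0_compat; [|apply pow_lt, Rinv_0_lt_compat; lra].
  apply Rmult_lt_0_compat; [|apply exp_pos].
  apply Rdiv_lt_0_compat; [now apply hpot_pos|].
  generalize (pot_ge_1 alpha theta Ht x); lra.
Qed.

Lemma sym_bound_order_pred (j : nat) (f : R -> R -> C) : sym_bound (S j) f -> sym_bound j f.
Proof.
  intros [K [HK H]]. exists (K * / a). split.
  { apply Rmult_le_pos; [exact HK|]. apply Rlt_le, Rinv_0_lt_compat, a_pos. }
  intros theta x Ht Hx. eapply Rle_trans; [now apply H|].
  rewrite Rmult_assoc. apply Rmult_le_compat_l; [exact HK|].
  replace (sym_weight (S j) theta x) with (/ x * sym_weight j theta x) by (unfold sym_weight; simpl; ring).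
  apply Rmult_le_compat_r; [apply Rlt_le, sym_weight_pos; lra|].
  apply Rinv_le_contravar; lra.
Qed.

Lemma symbol_order_pred (N j : nat) (f : R -> R -> C) : symbol N (S j) f -> symbol N j f.
Proof.
  revert j f; induction N as [|N IH]; intros j f [H1 H2].
  - split; [now apply sym_bound_order_pred|exact H2].
  - split; [now apply sym_bound_order_pred|]. destruct H2 as [g [H2 H3]].
    exists g. split; [exact H2|]. now apply IH.
Qed.

Lemma symbol_order_le (N i j : nat) (f : R -> R -> C) :
  (i <= j)%nat -> symbol N j f -> symbol N i f.
Proof.
  induction 1 as [|j Hij IH]; intros Hf; [exact Hf|]. apply IH. now apply symbol_order_pred.
Qed.

Lemma symbol_plus (N j : nat) (f g : R -> R -> C) :
  symbol N j f -> symbol N j g -> symbol N j (fun theta x => f theta x + g theta x)%C.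
Proof.
  assert (Hb : forall j f g, sym_bound j f -> sym_bound j g ->
    sym_bound j (fun theta x => f theta x + g theta x)%C).
  { clear. intros j f g [K [HK H]] [K' [HK' H']]. exists (K + K'). split; [lra|].
    intros theta x Ht Hx. apply Cmod_triangle_le.
    rewrite Rmult_plus_distr_r. apply Rplus_le_compat; [now apply H|now apply H']. }
  revert j f g; induction N as [|N IH]; intros j f g [H1 H2] [H3 H4].
  - split; [now apply Hb|exact H2].
  - split; [now apply Hb|]. destruct H2 as [f' [H2 H2']], H4 as [g' [H4 H4']].
    exists (fun theta x => f' theta x + g' theta x)%C. split.
    + intros theta x Ht Hx. eapply is_derive_RC_eq.
      * apply is_derive_RC_plus; [now apply H2|now apply H4].
      * ring.
    + now apply IH.
Qed.

Lemma symbol_scal (N j : nat) (z : C) (f : R -> R -> C) :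
  symbol N j f -> symbol N j (fun theta x => z * f theta x)%C.
Proof.
  assert (Hb : forall j f, sym_bound j f -> sym_bound j (fun theta x => z * f theta x)%C).
  { clear. intros j f [K [HK H]]. exists (Cmod z * K). split; [apply Rmult_le_pos; [apply Cmod_ge_0|exact HK]|].
    intros theta x Ht Hx. rewrite Cmod_mult, Rmult_assoc.
    apply Rmult_le_compat_l; [apply Cmod_ge_0|now apply H]. }
  revert j f; induction N as [|N IH]; intros j f [H1 H2].
  - split; [now apply Hb|exact H2].
  - split; [now apply Hb|]. destruct H2 as [f' [H2 H2']].
    exists (fun theta x => z * f' theta x)%C. split.
    + intros theta x Ht Hx. eapply is_derive_RC_eq.
      * apply is_derive_RC_mult; [apply is_derive_RC_const|now apply H2].
      * cbv beta. ring.
    + now apply IH.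
Qed.

(** The surplus factor in the product is [(h / P) P^(-1/2)], which is at most [1]. *)
Lemma sym_weight_mult (i j : nat) (theta x : R) : 0 < theta -> a <= x ->
  sym_weight i theta x * sym_weight j theta x <= sym_weight (i + j) theta x.
Proof.
  intros Ht Hx. unfold sym_weight.
  assert (HP := pot_ge_1 alpha theta Ht x).
  assert (Hh := hpot_pos theta x Ht).
  assert (HhP := pot_hpot theta x ltac:(lra)).
  set (u := hpot theta x / pot alpha theta x). set (p := Rpower (pot alpha theta x) (- / 2)).
  assert (Hu : 0 < u <= 1).
  { split; [apply Rdiv_lt_0_compat; lra|]. unfold u. apply Rle_div_l; lra. }
  assert (Hp : 0 < p <= 1).
  { apply Rpower_opp_le_1; lra. }
  rewrite pow_add.
  assert (0 < (/ x) ^ i) by (apply pow_lt, Rinv_0_lt_compat; lra).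
  assert (0 < (/ x) ^ j) by (apply pow_lt, Rinv_0_lt_compat; lra).
  replace (u * p * (/ x) ^ i * (u * p * (/ x) ^ j)) with (u * p * (u * p) * ((/ x) ^ i * (/ x) ^ j)) by ring.
  apply Rmult_le_compat_r; [nra|].
  assert (0 < u * p) by nra. assert (u * p <= 1) by nra. nra.
Qed.

Lemma symbol_mult (N i j : nat) (f g : R -> R -> C) :
  symbol N i f -> symbol N j g -> symbol N (i + j) (fun theta x => f theta x * g theta x)%C.
Proof.
  assert (Hb : forall i j f g, sym_bound i f -> sym_bound j g ->
    sym_bound (i + j) (fun theta x => f theta x * g theta x)%C).
  { intros i' j' f' g' [K [HK H]] [K' [HK' H']]. exists (K * K'). split; [nra|].
    intros theta x Ht Hx. rewrite Cmod_mult.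
    apply Rle_trans with (K * sym_weight i' theta x * (K' * sym_weight j' theta x)).
    - apply Rmult_le_compat; try apply Cmod_ge_0; [now apply H|now apply H'].
    - replace (K * sym_weight i' theta x * (K' * sym_weight j' theta x))
        with (K * K' * (sym_weight i' theta x * sym_weight j' theta x)) by ring.
      apply Rmult_le_compat_l; [nra|]. apply sym_weight_mult; lra. }
  revert i j f g; induction N as [|N IH]; intros i j f g Hf Hg.
  - destruct Hf as [H1 H2], Hg as [H3 H4]. split; [now apply Hb|exact H2].
  - assert (Hf' := symbol_pred _ _ _ Hf). assert (Hg' := symbol_pred _ _ _ Hg).
    destruct Hf as [H1 [f' [H2 H2']]], Hg as [H3 [g' [H4 H4']]].
    split; [now apply Hb|].
    exists (fun theta x => f' theta x * g theta x + f theta x * g' theta x)%C. split.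
    + intros theta x Ht Hx. eapply is_derive_RC_eq.
      * apply is_derive_RC_mult; [now apply H2|now apply H4].
      * ring.
    + apply symbol_plus.
      * apply (IH (S i) j); assumption.
      * replace (S (i + j)) with (i + S j)%nat by lia. apply IH; assumption.
Qed.

(** These monomials [h^k x^(-j) P^(-s)] span a space that contains [m] and is stable under the
    derivative in [t]. *)
Definition sym_monomial (k j : nat) (s : R) (theta x : R) : C :=
  RtoC (hpot theta x ^ k * (/ x) ^ j * Rpower (pot alpha theta x) (- s)).

Lemma is_derive_hpot (theta x : R) : 0 < x -> is_derive (hpot theta) x (alpha * hpot theta x * / x).
Proof.
  intros Hx. eapply is_derive_eq.
  - apply is_derive_scal, is_derive_Rpower, Hx.
  - unfold hpot. replace (alpha - 1) with (alpha + - (1)) by ring.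
    rewrite Rpower_plus, Rpower_Ropp, Rpower_1 by exact Hx. ring.
Qed.

Lemma dpot_hpot (theta x : R) : 0 < x -> dpot alpha theta x = alpha * hpot theta x * / x.
Proof.
  intros Hx. unfold dpot, hpot. replace (alpha - 1) with (alpha + - (1)) by ring.
  rewrite Rpower_plus, Rpower_Ropp, Rpower_1 by exact Hx. ring.
Qed.

Lemma ddpot_hpot (theta x : R) : 0 < x ->
  ddpot alpha theta x = alpha * (alpha - 1) * hpot theta x * (/ x) ^ 2.
Proof.
  intros Hx. unfold ddpot, hpot. replace (alpha - 2) with (alpha + (- (1) + - (1))) by ring.
  rewrite !Rpower_plus, Rpower_Ropp, Rpower_1 by exact Hx. ring.
Qed.

(** The condition on [s] gives [h^k P^(-s) <= (h / P)^k P^(-1/2)], and [k >= 1] leaves at least one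
    factor [h / P]. *)
Lemma sym_monomial_bound (k j : nat) (s : R) :
  (1 <= k)%nat -> INR k + / 2 <= s -> sym_bound j (sym_monomial k j s).
Proof.
  intros Hk Hs. exists 1. split; [lra|]. intros theta x [Ht _] Hx.
  assert (HP := pot_ge_1 alpha theta Ht x).
  assert (Hh := hpot_pos theta x Ht).
  assert (HhP := pot_hpot theta x ltac:(lra)).
  unfold sym_monomial, sym_weight. rewrite Cmod_R.
  assert (Hj : 0 < (/ x) ^ j) by (apply pow_lt, Rinv_0_lt_compat; lra).
  assert (Hkp : 0 < hpot theta x ^ k) by (now apply pow_lt).
  assert (Hsp : 0 < Rpower (pot alpha theta x) (- s)) by apply exp_pos.
  rewrite Rabs_right.
  2: { apply Rle_ge, Rlt_le. apply Rmult_lt_0_compat; [nra|exact Hsp]. }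
  rewrite Rmult_1_l.
  set (u := hpot theta x / pot alpha theta x).
  assert (Hu : 0 < u <= 1).
  { split; [apply Rdiv_lt_0_compat; lra|]. unfold u. apply Rle_div_l; lra. }
  replace (hpot theta x ^ k * (/ x) ^ j * Rpower (pot alpha theta x) (- s))
    with (hpot theta x ^ k * Rpower (pot alpha theta x) (- s) * (/ x) ^ j) by ring.
  apply Rmult_le_compat_r; [lra|].
  apply Rle_trans with (u ^ k * Rpower (pot alpha theta x) (- / 2)).
  - unfold u, Rdiv. rewrite Rpow_mult_distr, Rmult_assoc. apply Rmult_le_compat_l; [lra|].
    rewrite pow_inv, <- Rpower_pow by lra. rewrite <- Rpower_Ropp, <- Rpower_plus.
    apply Rle_Rpower; lra.
  - apply Rmult_le_compat_r; [apply Rlt_le, exp_pos|].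
    destruct k as [|k]; [lia|]. simpl.
    assert (u ^ k <= 1) by (rewrite <- (pow1 k); apply pow_incr; lra).
    assert (0 < u ^ k) by (apply pow_lt; lra). nra.
Qed.

Lemma symbol_monomial (N k j : nat) (s : R) :
  (1 <= k)%nat -> INR k + / 2 <= s -> symbol N j (sym_monomial k j s).
Proof.
  revert k j s; induction N as [|N IH]; intros k j s Hk Hs.
  - split; [now apply sym_monomial_bound|exact Logic.I].
  - split; [now apply sym_monomial_bound|].
    (* Both [x h'] and [x P'] equal [alpha h], so differentiation costs one [1 / x] and yields
       either the same [k] or the pair [k + 1], [s + 1]. Passing from [x] to [t] divides by
       [P^(1/2)], hence the extra [1/2] in each exponent. *)
    exists (fun theta x => RtoC (INR k * alpha - INR j) * sym_monomial k (S j) (s + / 2) theta x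
       + RtoC (- (s * alpha)) * sym_monomial (S k) (S j) (s + 1 + / 2) theta x)%C. split.
    + intros theta x [Ht _] Hx.
      assert (HP := pot_ge_1 alpha theta Ht x).
      unfold sym_monomial. rewrite <- !RtoC_mult, <- RtoC_plus, <- RtoC_mult.
      apply is_derive_RC_RtoC. eapply is_derive_eq.
      * apply Derive.is_derive_mult; [apply Derive.is_derive_mult|].
        -- apply (is_derive_pow (hpot theta) k). apply is_derive_hpot. lra.
        -- apply (is_derive_pow (fun x => / x) j). apply (is_derive_inv (fun x => x) x 1);
             [apply @is_derive_id|lra].
        -- apply is_derive_pot_power; [exact Ht|lra].
      * rewrite dpot_hpot, sqrt_pot by lra.
        assert (E1 : Rpower (pot alpha theta x) (- s)
           = Rpower (pot alpha theta x) (- (s + / 2)) * Rpower (pot alpha theta x) (/ 2))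
          by (rewrite <- Rpower_plus; f_equal; lra).
        assert (E2 : Rpower (pot alpha theta x) (- s - 1)
           = Rpower (pot alpha theta x) (- (s + 1 + / 2)) * Rpower (pot alpha theta x) (/ 2))
          by (rewrite <- Rpower_plus; f_equal; lra).
        rewrite E1, E2.
        destruct k as [|k]; [lia|]. destruct j as [|j]; simpl pow; simpl Init.Nat.pred;
          rewrite ?S_INR; simpl INR; field; lra.
    + apply symbol_plus; apply symbol_scal; apply IH; rewrite ?S_INR; try lia; lra.
Qed.

(** This is [M / phi'], the potential [m] of the equation in the variable [t]. *)
Definition m_symbol (theta x : R) : C :=
  (RtoC (5 / 16 * alpha ^ 2) * sym_monomial 2 2 3 theta x
   + RtoC (- (alpha * (alpha - 1) / 4)) * sym_monomial 1 2 2 theta x)%C.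

Lemma symbol_m (N : nat) : symbol N 2 m_symbol.
Proof. apply symbol_plus; apply symbol_scal; apply symbol_monomial; simpl; try lia; lra. Qed.

Lemma M_m_symbol (theta x : R) : 0 < theta -> 0 < x ->
  RtoC (M alpha theta x) = (RtoC (sqrt (pot alpha theta x)) * m_symbol theta x)%C.
Proof.
  intros Ht Hx. unfold m_symbol, sym_monomial.
  rewrite <- !RtoC_mult, <- RtoC_plus, <- RtoC_mult. f_equal.
  rewrite M_eq, b_eq by assumption. unfold ddb.
  rewrite dpot_hpot, ddpot_hpot, sqrt_pot by assumption.
  replace (- (9 / 4)) with (/ 2 + / 4 + - (3)) by lra.
  replace (- (5 / 4)) with (/ 2 + / 4 + - (2)) by lra.
  rewrite !Rpower_plus.
  assert (Hq : Rpower (pot alpha theta x) (- / 4) * Rpower (pot alpha theta x) (/ 4) = 1).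
  { rewrite <- Rpower_plus. replace (- / 4 + / 4) with 0 by ring. apply Rpower_O.
    generalize (pot_ge_1 alpha theta Ht x); lra. }
  set (p1 := Rpower _ (- / 4)) in *. set (p2 := Rpower _ (/ 4)) in *.
  transitivity (p1 * p2 * (5 / 16 * (alpha * hpot theta x * / x) ^ 2 *
     (Rpower (pot alpha theta x) (/ 2) * Rpower (pot alpha theta x) (- (3)))
    - / 4 * (alpha * (alpha - 1) * hpot theta x * (/ x) ^ 2) *
     (Rpower (pot alpha theta x) (/ 2) * Rpower (pot alpha theta x) (- (2))))).
  - ring.
  - rewrite Hq. field. lra.
Qed.

(* The approximate solutions of the Riccati equation
   [eta' + eta^2 - 2 i eta + m = 0] (derivative in [t = phi x]) given by
   [eta := eta + e / (2 i)], where [e] is the current residual. *)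
Lemma riccati_approximation (n N : nat) :
  exists eta eta_t e : R -> R -> C,
    symbol N 2 eta /\ symbol N (n + 2) e /\
    (forall theta x, 0 < theta <= 1 -> a <= x ->
       is_derive_RC (eta theta) x (RtoC (sqrt (pot alpha theta x)) * eta_t theta x)%C) /\
    (forall theta x, 0 < theta <= 1 -> a <= x ->
       e theta x = m_symbol theta x + eta_t theta x + eta theta x * eta theta x
                   - 2 * Ci * eta theta x)%C.
Proof.
  revert N; induction n as [|n IH]; intros N.
  - exists (fun theta x => RtoC 0 * m_symbol theta x)%C, (fun _ _ => RtoC 0), m_symbol.
    split; [apply symbol_scal, symbol_m|]. split; [apply symbol_m|]. split.
    + intros theta x _ _. apply (is_derive_RC_ext (fun _ => RtoC 0)); [intros; ring|].
      eapply is_derive_RC_eq; [apply is_derive_RC_const|ring].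
    + intros theta x _ _. ring.
  - destruct (IH (S N)) as [eta [eta_t [e [H1 [H2 [H3 H4]]]]]].
    assert (H1' := symbol_pred _ _ _ H1). assert (H2' := symbol_pred _ _ _ H2).
    destruct H2 as [_ [e_t [H5 H6]]].
    set (h := (/ (2 * Ci))%C).
    assert (Hh : (2 * Ci * h = 1)%C).
    { unfold h. field. apply Ci_neq_0. }
    (* As [2 i h = 1], the linear term of the equation cancels the old residual [e]. What remains is
       [h e_t] and products with [e], all of order at least one higher. *)
    exists (fun theta x => eta theta x + h * e theta x)%C,
      (fun theta x => eta_t theta x + h * e_t theta x)%C,
      (fun theta x => h * e_t theta x + 2 * h * (eta theta x * e theta x)
         + h * h * (e theta x * e theta x))%C.
    split; [|split; [|split]].
    + apply symbol_plus; [exact H1'|]. apply symbol_scal.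
      apply (symbol_order_le N 2 (n + 2)); [lia|exact H2'].
    + apply symbol_plus; [apply symbol_plus|]; apply symbol_scal.
      * exact H6.
      * apply (symbol_order_le N (S n + 2) (2 + (n + 2))); [lia|]. now apply symbol_mult.
      * apply (symbol_order_le N (S n + 2) (n + 2 + (n + 2))); [lia|]. now apply symbol_mult.
    + intros theta x Ht Hx. eapply is_derive_RC_eq.
      * apply is_derive_RC_plus; [now apply H3|].
        apply is_derive_RC_mult; [apply is_derive_RC_const|now apply H5].
      * cbv beta. ring.
    + intros theta x Ht Hx.
      assert (E := H4 theta x Ht Hx).
      match goal with |- _ = ?R0 => transitivity
        (m_symbol theta x + eta_t theta x + eta theta x * eta theta x - 2 * Ci * eta theta x
         - 2 * Ci * h * e theta x + h * e_t theta x + 2 * h * (eta theta x * e theta x)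
         + h * h * (e theta x * e theta x))%C end.
      * rewrite Hh, <- E. ring.
      * ring.
Qed.

End WKB.

Lemma Rpower_small (K delta eps : R) : 0 <= K -> 0 < delta -> 0 < eps ->
  exists theta1, 0 < theta1 <= 1 /\
    forall theta, 0 < theta < theta1 -> K * Rpower theta delta <= eps.
Proof.
  intros HK Hd He.
  assert (Hq : 0 < eps / (K + 1)) by (apply Rdiv_lt_0_compat; lra).
  exists (Rmin 1 (Rpower (eps / (K + 1)) (/ delta))). split.
  - split; [|apply Rmin_l]. apply Rmin_glb_lt; [lra|apply exp_pos].
  - intros theta [H1 H2].
    assert (H3 : Rpower theta delta <= eps / (K + 1)).
    { apply Rle_trans with (Rpower (Rpower (eps / (K + 1)) (/ delta)) delta).
      - apply Rle_Rpower_l; [lra|]. split; [exact H1|].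
        apply Rlt_le, (Rlt_le_trans _ _ _ H2), Rmin_r.
      - rewrite Rpower_mult, Rinv_l, Rpower_1 by lra. apply Rle_refl. }
    apply Rle_div_r in H3; [|lra].
    generalize (exp_pos (delta * ln theta)). unfold Rpower in *. nra.
Qed.

(** * Estimates uniform in theta *)

Section SmallTheta.

Variables (alpha x0 : R).
Hypothesis (alpha_pos : 0 < alpha) (x0_pos : 0 < x0).

Let a := x0 / 2.
(** Any gain [theta^delta] costs a growth [x^(alpha delta)]. Here [alpha delta <= 1/2], so that
    [x^(-2)] still leaves the decay [x^(-3/2)]. *)
Let delta := / (2 * alpha + 1).

Lemma half_x0_gt_0 : 0 < a. Proof. unfold a; lra. Qed.

Lemma delta_pos : 0 < delta. Proof. apply Rinv_0_lt_compat; lra. Qed.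

Lemma delta_le_1 : delta <= 1.
Proof.
  unfold delta. apply Rmult_le_reg_r with (2 * alpha + 1); [lra|]. rewrite Rinv_l; lra.
Qed.

Lemma alpha_delta : alpha * delta <= / 2.
Proof.
  unfold delta. apply Rmult_le_reg_r with (2 * alpha + 1); [lra|].
  rewrite Rmult_assoc, Rinv_l by lra. lra.
Qed.

(** With [h = theta x^alpha], the ratio [h / (1 + h)] is at most [min(1, h)], hence at most
    [h^delta] for [0 < delta <= 1]. *)
Lemma hpot_ratio_le (theta x : R) : 0 < theta -> 0 < x ->
  hpot alpha theta x / pot alpha theta x <= Rpower theta delta * Rpower x (alpha * delta).
Proof.
  intros Ht Hx. rewrite (pot_hpot alpha theta x Hx).
  assert (Hh := hpot_pos alpha theta x Ht).
  assert (E : Rpower theta delta * Rpower x (alpha * delta) = Rpower (hpot alpha theta x) delta).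
  { unfold hpot. rewrite <- Rpower_mult_distr by (try apply exp_pos; exact Ht).
    now rewrite Rpower_mult. }
  rewrite E. set (h := hpot alpha theta x) in *.
  destruct (Rle_dec h 1) as [H1|H1].
  - apply Rle_trans with h.
    + apply Rle_div_l; nra.
    + destruct (Rle_lt_or_eq_dec _ _ H1) as [H|H].
      * rewrite <- (Rpower_1 h) at 1 by exact Hh. unfold Rpower.
        assert (Hln : ln h < 0) by (rewrite <- ln_1; now apply ln_increasing).
        assert (1 * ln h <= delta * ln h) by (generalize delta_le_1; nra).
        now apply exp_le_compat.
      * rewrite H. unfold Rpower. rewrite ln_1, Rmult_0_r, exp_0. lra.
  - apply Rle_trans with 1; [apply Rle_div_l; lra|].
    rewrite <- (Rpower_O h) by lra. apply Rle_Rpower; [lra|]. generalize delta_pos; lra.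
Qed.

Lemma hpot_ratio_le_theta (theta x : R) : 0 < theta ->  0 < x ->
  hpot alpha theta x / pot alpha theta x <= theta * Rpower x alpha.
Proof.
  intros Ht Hx. rewrite (pot_hpot alpha theta x Hx).
  assert (Hh := hpot_pos alpha theta x Ht).
  apply Rle_div_l; [lra|]. fold (hpot alpha theta x). nra.
Qed.

Lemma inv_pow_Rpower (x : R) (j : nat) : 0 < x -> (/ x) ^ j = Rpower x (- INR j).
Proof.
  intros Hx. rewrite Rpower_Ropp, Rpower_pow, pow_inv by exact Hx. reflexivity.
Qed.

Lemma sqrt_pot_sym_weight (j : nat) (theta x : R) : 0 < theta -> 0 < x ->
  sqrt (pot alpha theta x) * sym_weight alpha j theta x
  = hpot alpha theta x / pot alpha theta x * Rpower x (- INR j).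
Proof.
  intros Ht Hx. unfold sym_weight. rewrite sqrt_pot, inv_pow_Rpower by assumption.
  assert (E : Rpower (pot alpha theta x) (/ 2) * Rpower (pot alpha theta x) (- / 2) = 1).
  { rewrite <- Rpower_plus, Rplus_opp_r. apply Rpower_O. generalize (pot_ge_1 alpha theta Ht x); lra. }
  transitivity (Rpower (pot alpha theta x) (/ 2) * Rpower (pot alpha theta x) (- / 2) *
    (hpot alpha theta x / pot alpha theta x * Rpower x (- INR j))); [ring|].
  rewrite E. ring.
Qed.

Lemma Rpower_decay (e x : R) : e <= - (1 + / 2) -> a <= x ->
  Rpower x e <= Rpower a (e + (1 + / 2)) * Rpower x (- (1 + / 2)).
Proof.
  intros He Hx. replace e with ((e + (1 + / 2)) + - (1 + / 2)) at 1 by ring.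
  rewrite Rpower_plus. apply Rmult_le_compat_r; [apply Rlt_le, exp_pos|].
  replace (e + (1 + / 2)) with (- (- (e + (1 + / 2)))) by ring.
  rewrite !(Rpower_Ropp _ (- (e + (1 + / 2)))). apply Rinv_le_contravar; [apply exp_pos|].
  apply Rle_Rpower_l; [lra|]. generalize half_x0_gt_0; lra.
Qed.

(** Order [2] leaves room only for the growth [x^(alpha delta)], so the uniform gain is
    [theta^delta] and not [theta]. *)
Lemma sym_bound_order_2 (f : R -> R -> C) : sym_bound alpha a 2 f ->
  exists K, 0 <= K /\ forall theta x, 0 < theta <= 1 -> a <= x ->
    sqrt (pot alpha theta x) * Cmod (f theta x)
    <= K * Rpower theta delta * Rpower x (- (1 + / 2)).
Proof.
  intros [K [HK H]]. exists (K * Rpower a (alpha * delta - 2 + (1 + / 2))). split.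
  { apply Rmult_le_pos; [exact HK|apply Rlt_le, exp_pos]. }
  intros theta x Ht Hx.
  assert (Hx0 : 0 < x) by (generalize half_x0_gt_0; lra).
  apply Rle_trans with (K * (sqrt (pot alpha theta x) * sym_weight alpha 2 theta x)).
  - generalize (H theta x Ht Hx) (sqrt_pos (pot alpha theta x)); intros. nra.
  - rewrite sqrt_pot_sym_weight by (exact Hx0 || apply Ht). rewrite !Rmult_assoc.
    apply Rmult_le_compat_l; [exact HK|].
    apply Rle_trans with (Rpower theta delta * Rpower x (alpha * delta) * Rpower x (- INR 2)).
    + apply Rmult_le_compat_r; [apply Rlt_le, exp_pos|]. now apply hpot_ratio_le.
    + rewrite Rmult_assoc, <- Rpower_plus.
      rewrite (Rmult_comm (Rpower a _)), !Rmult_assoc, (Rmult_comm _ (Rpower a _)).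
      apply Rmult_le_compat_l; [apply Rlt_le, exp_pos|].
      replace (alpha * delta + - INR 2) with (alpha * delta - 2) by (simpl; ring).
      apply Rpower_decay; [|exact Hx]. generalize alpha_delta; lra.
Qed.

(** The full factor [theta] costs the growth [x^alpha], which [x^(-j)] compensates as soon as
    [j >= alpha + 2]. This is the reason for lowering the Riccati residual several times. *)
Lemma sym_bound_high_order (j : nat) (f : R -> R -> C) :
  alpha + 2 <= INR j -> sym_bound alpha a j f ->
  exists K, 0 <= K /\ forall theta x, 0 < theta <= 1 -> a <= x ->
    sqrt (pot alpha theta x) * Cmod (f theta x) <= K * theta * Rpower x (- (1 + / 2)).
Proof.
  intros Hj [K [HK H]]. exists (K * Rpower a (alpha - INR j + (1 + / 2))). split.
  { apply Rmult_le_pos; [exact HK|apply Rlt_le, exp_pos]. }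
  intros theta x Ht Hx.
  assert (Hx0 : 0 < x) by (generalize half_x0_gt_0; lra).
  apply Rle_trans with (K * (sqrt (pot alpha theta x) * sym_weight alpha j theta x)).
  - generalize (H theta x Ht Hx) (sqrt_pos (pot alpha theta x)); intros. nra.
  - rewrite sqrt_pot_sym_weight by (exact Hx0 || apply Ht). rewrite !Rmult_assoc.
    apply Rmult_le_compat_l; [exact HK|].
    apply Rle_trans with (theta * Rpower x alpha * Rpower x (- INR j)).
    + apply Rmult_le_compat_r; [apply Rlt_le, exp_pos|]. now apply hpot_ratio_le_theta.
    + rewrite Rmult_assoc, <- Rpower_plus.
      rewrite (Rmult_comm (Rpower a _)), !Rmult_assoc, (Rmult_comm _ (Rpower a _)).
      apply Rmult_le_compat_l; [lra|]. apply Rpower_decay; [lra|exact Hx].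
Qed.

Lemma sym_bound_at (j : nat) (f : R -> R -> C) (x : R) : a <= x -> sym_bound alpha a j f ->
  exists K, 0 <= K /\ forall theta, 0 < theta <= 1 -> Cmod (f theta x) <= K * theta.
Proof.
  intros Hx [K [HK H]]. assert (Hx0 : 0 < x) by (generalize half_x0_gt_0; lra).
  exists (K * (Rpower x alpha * Rpower x (- INR j))). split.
  { apply Rmult_le_pos; [exact HK|]. apply Rlt_le, Rmult_lt_0_compat; apply exp_pos. }
  intros theta Ht. eapply Rle_trans; [now apply H|]. rewrite !Rmult_assoc.
  apply Rmult_le_compat_l; [exact HK|].
  assert (Hs := sqrt_pot_ge_1 alpha theta (proj1 Ht) x).
  apply Rle_trans with (sqrt (pot alpha theta x) * sym_weight alpha j theta x).
  - generalize (sym_weight_pos alpha a half_x0_gt_0 j theta x (proj1 Ht) Hx). nra.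
  - rewrite sqrt_pot_sym_weight by (exact Hx0 || apply Ht).
    apply Rle_trans with (theta * Rpower x alpha * Rpower x (- INR j)); [|lra].
    apply Rmult_le_compat_r; [apply Rlt_le, exp_pos|]. now apply hpot_ratio_le_theta.
Qed.

Lemma M_bound : exists K, 0 <= K /\ forall theta x, 0 < theta <= 1 -> a <= x ->
  Rabs (M alpha theta x) <= K * Rpower theta delta * Rpower x (- (1 + / 2)).
Proof.
  destruct (sym_bound_order_2 (m_symbol alpha)) as [K [HK H]].
  { apply (symbol_sym_bound alpha a 0), symbol_m, half_x0_gt_0. }
  exists K. split; [exact HK|]. intros theta x Ht Hx.
  rewrite <- Cmod_R, M_m_symbol, Cmod_mult, Cmod_R by (generalize half_x0_gt_0; lra).
  rewrite Rabs_right by (apply Rle_ge, sqrt_pos). now apply H.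
Qed.

(** Freezing [M] to the left of [a] gives a coefficient continuous on the whole line; [M] itself is
    meaningful for positive arguments and may be singular at [0]. *)
Definition M_ext (theta x : R) : R := M alpha theta (Rmax x a).

Lemma M_ext_eq (theta x : R) : a <= x -> M_ext theta x = M alpha theta x.
Proof. intros H. unfold M_ext. now rewrite Rmax_left. Qed.

Lemma M_ext_continuous (theta x : R) : 0 < theta -> continuous (M_ext theta) x.
Proof.
  intros Ht. apply (continuous_comp (fun x => Rmax x a) (M alpha theta)); [apply continuous_Rmax|].
  apply M_continuous; [exact Ht|]. generalize (Rmax_r x a) half_x0_gt_0; lra.
Qed.

(** The estimate [jost_r_bound] alone gives only [O(theta^delta)]. The difference [r - eta s] is
    driven by [e s], whose integral is [O(theta)], and at the single point [x0] no uniformity in [x]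
    is asked, so [eta] keeps the full power of [theta] there. *)
Lemma jost_r_small : exists C theta1, 0 <= C /\ 0 < theta1 <= 1 /\
  forall theta, 0 < theta < theta1 -> forall s r A B,
  jost (phi alpha theta) (M_ext theta) a 0 s r A B -> Cmod (r x0) <= C * theta.
Proof.
  destruct (nfloor_ex alpha) as [n0 [_ Hn0]]; [lra|].
  (* More than [alpha] correction steps bring the residual to order [n + 2 >= alpha + 2], the order
     required by [sym_bound_high_order]. *)
  set (n := S n0).
  assert (Hn : alpha + 2 <= INR (n + 2)).
  { unfold n. rewrite plus_INR, S_INR. simpl INR. lra. }
  destruct (riccati_approximation alpha a half_x0_gt_0 n 0) as [eta [eta_t [e [H1 [H2 [H3 H4]]]]]].
  apply symbol_sym_bound in H1. apply symbol_sym_bound in H2.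
  destruct (sym_bound_order_2 _ H1) as [Ke [HKe He]].
  destruct (sym_bound_high_order _ _ Hn H2) as [Kr [HKr Hr]].
  destruct (sym_bound_at _ _ x0 ltac:(unfold a; lra) H1) as [K0 [HK0 H0]].
  destruct M_bound as [KM [HKM HM]].
  set (p := Rpower x0 (- / 2)). assert (Hp : 0 < p) by apply exp_pos.
  (* Below [t1] the term with [eta] contributes at most [L / 2] to the halving step. *)
  destruct (Rpower_small (4 * Ke * p) delta 1) as [t1 [Ht1 Hs1]];
    [repeat apply Rmult_le_pos; lra|apply delta_pos|lra|].
  destruct (Rpower_small (8 * KM * Rpower a (- / 2)) delta 1) as [t2 [Ht2 Hs2]];
    [repeat apply Rmult_le_pos; try lra; apply Rlt_le, exp_pos|apply delta_pos|lra|].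
  exists (2 * (4 * Kr * p) + 2 * K0), (Rmin t1 t2).
  split; [repeat apply Rplus_le_le_0_compat; repeat apply Rmult_le_pos; lra|].
  split; [split; [apply Rmin_glb_lt; lra|generalize (Rmin_l t1 t2); lra]|].
  intros theta Ht s r A B HJ.
  assert (Hta : 0 < theta < t1) by (generalize (Rmin_l t1 t2); lra).
  assert (Htb : 0 < theta < t2) by (generalize (Rmin_r t1 t2); lra).
  assert (Htc : 0 < theta <= 1) by lra.
  specialize (Hs1 theta Hta). specialize (Hs2 theta Htb).
  set (mu := KM * Rpower theta delta).
  assert (Hphi := is_derive_phi alpha theta alpha_pos (proj1 Htc)).
  assert (Hmono : forall x y, x <= y -> phi alpha theta x <= phi alpha theta y).
  { intros x y Hxy. generalize (phi_increment alpha theta alpha_pos (proj1 Htc) x y Hxy); lra. }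
  assert (Hphia : 0 <= phi alpha theta a).
  { rewrite <- (phi_0 alpha theta). apply Hmono. generalize half_x0_gt_0; lra. }
  assert (HN : forall x, a <= x -> Rabs (M_ext theta x) <= mu * Rpower x (- (1 + / 2))).
  { intros x Hx. rewrite M_ext_eq by exact Hx. now apply HM. }
  assert (Hrb := jost_r_bound (phi alpha theta) (M_ext theta) a mu half_x0_gt_0 Hmono HN
    0 s r A B (Rle_refl 0) HJ).
  assert (Hsys := jost_system (phi alpha theta) (fun x => sqrt (pot alpha theta x)) (M_ext theta) a
    Hphi 0 s r A B HJ).
  assert (Hs : forall x, Cmod (s x) <= 2) by apply HJ.
  set (om := fun x => sqrt (pot alpha theta x)).
  assert (Hom : forall x, 1 <= om x) by (intros; apply sqrt_pot_ge_1; lra).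
  assert (Heta : forall x, a <= x -> Cmod (eta theta x) <= Ke * Rpower theta delta * Rpower x (- (1 + / 2))).
  { intros x Hx. eapply Rle_trans; [|apply He; assumption]. fold (om x). specialize (Hom x).
    generalize (Cmod_ge_0 (eta theta x)). nra. }
  (* [exp (- 2 i phi) tau] has derivative
     [exp (- 2 i phi) phi' (- eta tau - e s)], where [eta] is small in L^1
     and [e] is [O(theta)] in L^1. *)
  set (tau := fun x => (r x - eta theta x * s x)%C).
  set (D := fun x => (wave 0 (-2) (phi alpha theta x) * tau x)%C).
  assert (Hx0a : a < x0) by (unfold a; lra).
  assert (HDd : forall x, x0 <= x -> is_derive_RC D x
     (wave 0 (-2) (phi alpha theta x) * RtoC (om x) * (- (eta theta x * tau x) - e theta x * s x))%C).
  { intros x Hx. destruct (Hsys x ltac:(lra)) as [S1 S2]. unfold D, tau.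
    eapply is_derive_RC_eq.
    - apply is_derive_RC_mult; [apply is_derive_RC_wave, Hphi|].
      apply is_derive_RC_minus; [exact S2|].
      apply is_derive_RC_mult; [apply H3; [exact Htc|lra]|exact S1].
    - cbv beta. rewrite H4 by (assumption || lra).
      rewrite M_ext_eq, M_m_symbol, zeta_0 by lra. fold (om x).
      replace (RtoC (-2)) with (- RtoC 2)%C by (apply C_eta; simpl; ring). ring. }
  assert (HDn : forall x, Cmod (D x) = Cmod (tau x)).
  { intros x. unfold D. rewrite Cmod_mult, Cmod_wave, Rmult_0_l, exp_0. ring. }
  assert (Hdec : forall x, a <= x -> 0 <= Rpower x (- (1 + / 2)) <= Rpower a (- (1 + / 2))).
  { intros x Hx. split; [apply Rlt_le, exp_pos|]. apply Rpower_opp_le; generalize half_x0_gt_0; lra. }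
  assert (Hdec2 : forall x, x0 <= x -> Rpower x (- / 2) <= p).
  { intros x Hx. apply Rpower_opp_le; lra. }
  assert (Hkd : 0 <= Ke * Rpower theta delta) by (apply Rmult_le_pos; [lra|apply Rlt_le, exp_pos]).
  assert (Hmu : 0 <= mu) by (apply Rmult_le_pos; [lra|apply Rlt_le, exp_pos]).
  assert (HDb : forall x, x0 <= x ->
    Cmod (D x) <= 4 * mu * Rpower x (- / 2) + 2 * (Ke * Rpower theta delta) * Rpower x (- (1 + / 2))).
  { intros x Hx. rewrite HDn. unfold tau. apply Cmod_triangle_le.
    rewrite Cmod_opp, Cmod_mult. specialize (Hrb x ltac:(lra)). specialize (Heta x ltac:(lra)).
    generalize (Hs x) (Cmod_ge_0 (s x)) (Cmod_ge_0 (eta theta x)); intros. nra. }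
  assert (HDv : vanishes_at_infinity D).
  { intros eps Heps.
    destruct (Rpower_opp_vanishes (/ 2) (eps / (8 * (mu + 1)))) as [X1 [_ HX1]];
      [lra|apply Rdiv_lt_0_compat; lra|].
    destruct (Rpower_opp_vanishes (1 + / 2) (eps / (4 * (Ke * Rpower theta delta + 1)))) as [X2 [_ HX2]];
      [lra|apply Rdiv_lt_0_compat; lra|].
    exists (Rmax x0 (Rmax X1 X2)). intros x Hx.
    assert (G0 := Rle_trans _ _ _ (Rmax_l _ _) Hx).
    assert (G := Rle_trans _ _ _ (Rmax_r _ _) Hx).
    specialize (HX1 x (Rle_trans _ _ _ (Rmax_l _ _) G)).
    specialize (HX2 x (Rle_trans _ _ _ (Rmax_r _ _) G)).
    apply Rle_div_r in HX1; [|lra]. apply Rle_div_r in HX2; [|lra].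
    assert (0 < Rpower x (- / 2)) by apply exp_pos.
    assert (0 < Rpower x (- (1 + / 2))) by apply exp_pos.
    eapply Rle_trans; [now apply HDb|]. lra. }
  assert (Htau : forall x, x0 <= x -> Cmod (tau x) <= 2 * (4 * Kr * theta * p)).
  { set (K1 := 4 * mu * p + 2 * (Ke * Rpower theta delta) * Rpower a (- (1 + / 2))).
    apply (halving_bound (fun x => Cmod (tau x)) x0 K1).
    - assert (0 < Rpower a (- (1 + / 2))) by apply exp_pos.
      unfold K1. apply Rplus_le_le_0_compat; apply Rmult_le_pos; lra.
    - repeat apply Rmult_le_pos; lra.
    - intros x Hx. rewrite <- HDn. eapply Rle_trans; [now apply HDb|].
      unfold K1. apply Rplus_le_compat; apply Rmult_le_compat_l; try lra.
      + now apply Hdec2.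
      + apply Hdec; lra.
    - intros L HL Hb x Hx. rewrite <- HDn.
      apply Rle_trans with ((L * (Ke * Rpower theta delta) + 2 * (Kr * theta)) / / 2 * Rpower x (- / 2)).
      + apply (tail_bound D (fun x => wave 0 (-2) (phi alpha theta x) * RtoC (om x) *
          (- (eta theta x * tau x) - e theta x * s x))%C x0 (/ 2)); try lra; try assumption.
        intros y Hy. rewrite !Cmod_mult, Cmod_wave, Rmult_0_l, exp_0, Cmod_R, Rmult_1_l.
        rewrite (Rabs_right (om y)) by (specialize (Hom y); lra).
        assert (I1 := He theta y Htc ltac:(lra)). assert (I2 := Hr theta y Htc ltac:(lra)).
        fold (om y) in I1, I2. specialize (Hb y Hy). specialize (Hom y).
        apply Rle_trans with (om y * Cmod (eta theta y) * L + om y * Cmod (e theta y) * 2).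
        * rewrite !Rmult_assoc, <- Rmult_plus_distr_l. apply Rmult_le_compat_l; [lra|].
          apply Cmod_triangle_le. rewrite !Cmod_opp, !Cmod_mult.
          apply Rplus_le_compat; apply Rmult_le_compat_l; try apply Cmod_ge_0; [exact Hb|apply Hs].
        * apply Rle_trans with (Ke * Rpower theta delta * Rpower y (- (1 + / 2)) * L
            + Kr * theta * Rpower y (- (1 + / 2)) * 2); [|lra].
          apply Rplus_le_compat; apply Rmult_le_compat_r; lra.
      + replace ((L * (Ke * Rpower theta delta) + 2 * (Kr * theta)) / / 2)
          with (2 * (L * (Ke * Rpower theta delta) + 2 * (Kr * theta))) by field.
        assert (0 <= Kr * theta) by (apply Rmult_le_pos; lra).
        assert (0 <= L * (Ke * Rpower theta delta)) by (apply Rmult_le_pos; lra).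
        apply Rle_trans with (2 * (L * (Ke * Rpower theta delta) + 2 * (Kr * theta)) * p).
        * apply Rmult_le_compat_l; [lra|]. now apply Hdec2.
        * replace (2 * (L * (Ke * Rpower theta delta) + 2 * (Kr * theta)) * p)
            with (L / 2 * (4 * Ke * p * Rpower theta delta) + 4 * Kr * theta * p) by field.
          apply Rplus_le_compat_r. nra. }
  specialize (Htau x0 (Rle_refl x0)). specialize (H0 theta Htc).
  replace (r x0) with (tau x0 + eta theta x0 * s x0)%C by (unfold tau; ring).
  apply Cmod_triangle_le. rewrite Cmod_mult.
  generalize (Hs x0) (Cmod_ge_0 (s x0)) (Cmod_ge_0 (eta theta x0)); intros.
  assert (Cmod (eta theta x0) * Cmod (s x0) <= K0 * theta * 2) by (apply Rmult_le_compat; assumption).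
  lra.
Qed.

End SmallTheta.

Lemma is_derive_RC_comp (f : R -> C) (g : R -> R) (x dg : R) (df : C) :
  is_derive_RC f (g x) df -> is_derive g x dg ->
  is_derive_RC (fun y => f (g y)) x (RtoC dg * df)%C.
Proof.
  rewrite !is_derive_RC_iff. intros [H1 H2] Hg. split; simpl.
  - eapply is_derive_eq; [apply (is_derive_comp (fun z => Re (f z)) g); eassumption|].
    unfold scal; simpl; unfold mult; simpl. unfold Re, Im. ring.
  - eapply is_derive_eq; [apply (is_derive_comp (fun z => Im (f z)) g); eassumption|].
    unfold scal; simpl; unfold mult; simpl. unfold Re, Im. ring.
Qed.

Lemma Derive_RC_unique (f : R -> C) (x : R) (l : C) : is_derive_RC f x l -> Derive_RC f x = l.
Proof.
  intros H. apply is_derive_RC_iff in H. destruct H as [H1 H2].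
  apply C_eta; apply is_derive_unique; assumption.
Qed.

(** * Amplitudes of the two waves *)

Section Amplitudes.

Variables (alpha theta : R).
Hypothesis (alpha_pos : 0 < alpha) (theta_pos : 0 < theta).

Let P := pot alpha theta.
Let om (x : R) := sqrt (P x).
Let ph := phi alpha theta.

(** The pair [amp_gt], [amp_lt] inverts the relations [u = a^> w^> + a^< w^<] and
    [u' = -i phi' (a^> w^> - a^< w^<)]. Being explicit in [u] and [u'], the amplitudes exist on the
    whole line and are continuous at [0]. *)
Definition amp_gt (u u' : R -> C) (x : R) : C :=
  (/ 2 * (u x + Ci * u' x * RtoC (/ om x)) * cis (ph x))%C.
Definition amp_lt (u u' : R -> C) (x : R) : C :=
  (/ 2 * (u x - Ci * u' x * RtoC (/ om x)) * cis (- ph x))%C.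

(** Closed form of [phi'' / (2 phi')] for positive [x], by [V_coefficient]. *)
Definition V_weight (x : R) : R := dpot alpha theta x / (4 * P x).

Lemma om_ge_1 (x : R) : 1 <= om x.
Proof. now apply sqrt_pot_ge_1. Qed.

Lemma RtoC_om_neq_0 (x : R) : RtoC (om x) <> RtoC 0.
Proof. intros H. apply RtoC_inj in H. generalize (om_ge_1 x); lra. Qed.

Lemma cis_mult_opp (t : R) : (cis t * cis (- t) = 1)%C.
Proof. rewrite <- cis_plus, Rplus_opp_r. apply cis_0. Qed.

Lemma is_derive_RC_w_gt (x : R) :
  is_derive_RC (w_gt alpha theta) x (- (Ci * RtoC (om x) * cis (- ph x)))%C.
Proof.
  unfold w_gt. eapply is_derive_RC_eq.
  - apply (is_derive_RC_cis (fun x => - phi alpha theta x)).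
    apply (is_derive_opp (V := R_NormedModule)). now apply is_derive_phi.
  - fold ph P. fold (om x). change (opp (om x)) with (- om x). rewrite RtoC_opp. ring.
Qed.

Lemma is_derive_RC_w_lt (x : R) :
  is_derive_RC (w_lt alpha theta) x (Ci * RtoC (om x) * cis (ph x))%C.
Proof. unfold w_lt. apply is_derive_RC_cis. now apply is_derive_phi. Qed.

Lemma wave_pair_amplitudes (x0 : R) (u u' a_gt a_lt : R -> C) :
  (forall x, is_derive_RC u x (u' x)) ->
  is_wave_pair alpha theta x0 u a_gt a_lt ->
  forall x, 0 <= x <= x0 -> a_gt x = amp_gt u u' x /\ a_lt x = amp_lt u u' x.
Proof.
  intros Hu Hw x Hx. destruct (Hw x Hx) as [H1 H2].
  assert (H3 := is_derive_RC_unique _ _ _ _ (Hu x) H2).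
  rewrite (Derive_RC_unique _ _ _ (is_derive_RC_w_gt x)),
    (Derive_RC_unique _ _ _ (is_derive_RC_w_lt x)) in H3.
  unfold amp_gt, amp_lt. rewrite H1, H3. unfold w_gt, w_lt. fold ph.
  rewrite RtoC_inv by (generalize (om_ge_1 x); lra).
  assert (Hc := cis_mult_opp (ph x)). assert (Ho := RtoC_om_neq_0 x).
  assert (Hi := Ci_sqr).
  set (e := cis (ph x)) in *. set (f := cis (- ph x)) in *. set (o := RtoC (om x)) in *.
  split.
  (* For [field] the phases and [Ci] are atoms; the intermediate form isolates [e * f] and
     [Ci * Ci], which are then rewritten to [1] and [-1]. *)
  - transitivity (a_gt x * (/ 2 * (1 - Ci * Ci)) * (e * f) + a_lt x * e * e * / 2 * (1 + Ci * Ci))%C.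
    + rewrite Hc, Hi. field.
    + field. exact Ho.
  - transitivity (a_lt x * (/ 2 * (1 - Ci * Ci)) * (e * f) + a_gt x * f * f * / 2 * (1 + Ci * Ci))%C.
    + rewrite Hc, Hi. field.
    + field. exact Ho.
Qed.

Lemma amplitudes_wave_pair (u u' : R -> C) (x : R) :
  u x = (amp_gt u u' x * cis (- ph x) + amp_lt u u' x * cis (ph x))%C /\
  u' x = (- Ci * RtoC (om x) * (amp_gt u u' x * cis (- ph x) - amp_lt u u' x * cis (ph x)))%C.
Proof.
  unfold amp_gt, amp_lt. rewrite RtoC_inv by (generalize (om_ge_1 x); lra).
  assert (Hc := cis_mult_opp (ph x)). assert (Ho := RtoC_om_neq_0 x).
  assert (Hi := Ci_sqr).
  set (e := cis (ph x)) in *. set (f := cis (- ph x)) in *. set (o := RtoC (om x)) in *.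
  split.
  - transitivity (u x * (e * f))%C; [rewrite Hc; ring|]. field. exact Ho.
  - transitivity (- (Ci * Ci) * u' x * (e * f))%C; [rewrite Hc, Hi; ring|]. field. exact Ho.
Qed.

Lemma is_derive_RC_inv_om (x : R) : 0 < x ->
  is_derive_RC (fun x => RtoC (/ om x)) x (- (2 * RtoC (V_weight x)) * RtoC (/ om x))%C.
Proof.
  intros Hx. eapply is_derive_RC_eq.
  - apply is_derive_RC_RtoC. apply is_derive_inv; [now apply is_derive_sqrt_pot|].
    fold P. fold (om x). generalize (om_ge_1 x); lra.
  - rewrite <- RtoC_mult, <- RtoC_opp, <- RtoC_mult. f_equal. fold P. fold (om x). unfold V_weight.
    generalize (om_ge_1 x); intros. 
    assert (E : P x = om x * om x).
    { unfold om. rewrite sqrt_sqrt; [reflexivity|]. generalize (pot_ge_1 alpha theta theta_pos x). fold P. lra. }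
    rewrite E. field. lra.
Qed.

(** Since [phi'^2 = P] and [i^2 = -1], the contributions of the derivatives of [u], [u'] and of the
    phase cancel, except for the derivative of [1 / phi'], which is [-2 V_weight / phi']. *)
Lemma is_derive_amplitudes (u u' : R -> C) (x : R) :
  0 < x -> is_derive_RC u x (u' x) -> is_derive_RC u' x (- (RtoC (P x) * u x))%C ->
  is_derive_RC (amp_gt u u') x
    (RtoC (V_weight x) * (- amp_gt u u' x + cis (2 * ph x) * amp_lt u u' x))%C /\
  is_derive_RC (amp_lt u u') x
    (RtoC (V_weight x) * (cis (- 2 * ph x) * amp_gt u u' x - amp_lt u u' x))%C.
Proof.
  intros Hx H1 H2.
  assert (E : P x = om x * om x).
  { unfold om. rewrite sqrt_sqrt; [reflexivity|].
    generalize (pot_ge_1 alpha theta theta_pos x). fold P. lra. }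
  rewrite E in H2.
  assert (H3 := is_derive_RC_inv_om x Hx).
  assert (Hp := is_derive_phi alpha theta alpha_pos theta_pos x). fold P in Hp. fold (om x) in Hp.
  assert (Hc := cis_mult_opp (ph x)). assert (Ho := RtoC_om_neq_0 x).
  assert (Hi := Ci_sqr).
  replace (2 * ph x) with (ph x + ph x) by ring.
  replace (- 2 * ph x) with (- ph x + - ph x) by ring. rewrite !cis_plus.
  assert (Hio : (RtoC (om x) * RtoC (/ om x) = 1)%C).
  { rewrite <- RtoC_mult. f_equal. apply Rinv_r. generalize (om_ge_1 x); lra. }
  split.
  - eapply is_derive_RC_eq.
    + apply is_derive_RC_mult.
      * apply is_derive_RC_mult; [apply is_derive_RC_const|].
        apply is_derive_RC_plus; [exact H1|].
        apply is_derive_RC_mult; [|exact H3].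
        apply is_derive_RC_mult; [apply is_derive_RC_const|exact H2].
      * apply (is_derive_RC_cis ph). exact Hp.
    + cbv beta. unfold amp_gt, amp_lt. fold (om x). rewrite RtoC_mult.
      set (e := cis (ph x)) in *. set (f := cis (- ph x)) in *. set (o := RtoC (om x)) in *.
      set (oi := RtoC (/ om x)) in *. set (g := RtoC (V_weight x)).
      transitivity (/ 2 * e * (u' x * (1 + (Ci * Ci) * (o * oi)) + Ci * u x * o * (1 - o * oi)
         - 2 * g * Ci * oi * u' x))%C; [ring|].
      rewrite Hio, Hi.
      transitivity (g * (- (/ 2 * (u x + Ci * u' x * oi) * e) + (e * f) * e * (/ 2 * (u x - Ci * u' x * oi))))%C;
        [rewrite Hc|]; field.
  - eapply is_derive_RC_eq.
    + apply is_derive_RC_mult.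
      * apply is_derive_RC_mult; [apply is_derive_RC_const|].
        apply is_derive_RC_minus; [exact H1|].
        apply is_derive_RC_mult; [|exact H3].
        apply is_derive_RC_mult; [apply is_derive_RC_const|exact H2].
      * apply (is_derive_RC_cis (fun x => - ph x) x (- om x)).
        apply (is_derive_opp (V := R_NormedModule)). exact Hp.
    + cbv beta. unfold amp_gt, amp_lt. fold (om x). rewrite RtoC_mult, RtoC_opp.
      set (e := cis (ph x)) in *. set (f := cis (- ph x)) in *. set (o := RtoC (om x)) in *.
      set (oi := RtoC (/ om x)) in *. set (g := RtoC (V_weight x)).
      transitivity (/ 2 * f * (u' x * (1 + (Ci * Ci) * (o * oi)) - Ci * u x * o * (1 - o * oi)
         + 2 * g * Ci * oi * u' x))%C; [ring|].
      rewrite Hio, Hi.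
      transitivity (g * ((e * f) * f * (/ 2 * (u x + Ci * u' x * oi)) - (/ 2 * (u x - Ci * u' x * oi) * f)))%C;
        [rewrite Hc|]; field.
Qed.

Lemma V_weight_continuous (x : R) : 0 < x -> continuous V_weight x.
Proof.
  intros Hx. unfold V_weight. eapply continuous_of_derive.
  apply is_derive_div; [now apply is_derive_dpot| |].
  - apply is_derive_scal. now apply is_derive_pot.
  - generalize (pot_ge_1 alpha theta theta_pos x). fold P. lra.
Qed.

Lemma om_continuous (x : R) : continuous om x.
Proof. now apply sqrt_pot_continuous. Qed.

Lemma amplitudes_continuous (u u' : R -> C) (x : R) :
  cont_RC u x -> cont_RC u' x -> cont_RC (amp_gt u u') x /\ cont_RC (amp_lt u u') x.
Proof.
  intros H1 H2.
  assert (Ho : cont_RC (fun x => RtoC (/ om x)) x).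
  { apply cont_RC_RtoC. apply (continuous_comp om Rinv); [apply om_continuous|].
    apply continuous_Rinv. generalize (om_ge_1 x); lra. }
  assert (H3 : cont_RC (fun x => Ci * u' x * RtoC (/ om x))%C x).
  { apply cont_RC_mult; [|exact Ho]. apply cont_RC_mult; [apply cont_RC_const|exact H2]. }
  assert (Hp : continuous ph x) by now apply phi_continuous.
  split; (apply cont_RC_mult; [apply cont_RC_mult; [apply cont_RC_const|]|]).
  - now apply cont_RC_plus.
  - now apply cont_RC_cis.
  - now apply cont_RC_minus.
  - apply (cont_RC_cis (fun x => - ph x)).
    now apply continuous_opp_R.
Qed.

(* Components of the integrand of [V]; [f] is a function of [(j, y)], with
   [true] the index of the component along [w_gt]. *)
Definition V_gt_row (f : bool * R -> C) (y : R) : C :=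
  (- f (true, y) + cis (2 * ph y) * f (false, y))%C.
Definition V_lt_row (f : bool * R -> C) (y : R) : C :=
  (cis (- 2 * ph y) * f (true, y) - f (false, y))%C.

Lemma V_rows_continuous (f : bool * R -> C) (x : R) :
  (forall j, cont_RC (fun y => f (j, y)) x) ->
  cont_RC (V_gt_row f) x /\ cont_RC (V_lt_row f) x.
Proof.
  intros Hf. assert (Hp : continuous ph x) by now apply phi_continuous.
  assert (Hs : forall s, continuous (fun y => s * ph y) x).
  { intros s. now apply continuous_scal_R. }
  split; unfold V_gt_row, V_lt_row.
  - apply cont_RC_plus; [apply cont_RC_opp, Hf|].
    apply cont_RC_mult; [apply (cont_RC_cis (fun y => 2 * ph y)), Hs|apply Hf].
  - apply cont_RC_minus; [|apply Hf].
    apply cont_RC_mult; [apply (cont_RC_cis (fun y => - 2 * ph y)), Hs|apply Hf].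
Qed.

Lemma V_primitive (x0 : R) (F : R -> C * C) (f : bool * R -> C) (H1 H2 : R -> C) (x : R) :
  0 < x0 -> 0 <= x <= x0 ->
  (forall y, 0 < y <= x0 -> F y = (f (true, y), f (false, y))) ->
  (forall j y, 0 < y -> cont_RC (fun y => f (j, y)) y) ->
  (forall y, 0 < y -> is_derive_RC H1 y (RtoC (V_weight y) * V_gt_row f y)%C) ->
  (forall y, 0 < y -> is_derive_RC H2 y (RtoC (V_weight y) * V_lt_row f y)%C) ->
  cont_RC H1 x -> cont_RC H2 x ->
  V alpha theta x0 F x = ((H1 x - H1 x0)%C, (H2 x - H2 x0)%C).
Proof.
  intros Hx0 Hx HF Hf HD1 HD2 C1 C2. unfold V.
  assert (Hw : forall y, 0 < y -> cont_RC (fun y => RtoC (V_weight y)) y).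
  { intros y Hy. apply cont_RC_RtoC. now apply V_weight_continuous. }
  f_equal.
  - apply (V_int_primitive x0 _ (fun y => RtoC (V_weight y) * V_gt_row f y)%C H1); try assumption.
    + intros y Hy. rewrite (HF y Hy). unfold V_weight, V_gt_row. simpl fst. simpl snd.
      now rewrite V_coefficient by (assumption || lra).
    + intros y Hy. split; [now apply HD1|]. apply cont_RC_mult; [now apply Hw|].
      apply (proj1 (V_rows_continuous f y (fun j => Hf j y Hy))).
  - apply (V_int_primitive x0 _ (fun y => RtoC (V_weight y) * V_lt_row f y)%C H2); try assumption.
    + intros y Hy. rewrite (HF y Hy). unfold V_weight, V_lt_row. simpl fst. simpl snd.
      now rewrite V_coefficient by (assumption || lra).
    + intros y Hy. split; [now apply HD2|]. apply cont_RC_mult; [now apply Hw|].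
      apply (proj2 (V_rows_continuous f y (fun j => Hf j y Hy))).
Qed.

(** The differential system holds for positive [x] only; the value at [0] is reached through the
    continuity of the amplitudes there. *)
Lemma solution_amplitudes (x0 : R) (u u' : R -> C) (F : R -> C * C) :
  0 < x0 ->
  (forall x, is_derive_RC u x (u' x) /\ is_derive_RC u' x (- (RtoC (P x) * u x))%C) ->
  (forall x, 0 <= x <= x0 -> F x = (amp_gt u u' x, amp_lt u u' x)) ->
  forall x, 0 <= x <= x0 -> F x = add2 (F x0) (V alpha theta x0 F x).
Proof.
  intros Hx0 Hu HF x Hx.
  assert (Hc : forall y, cont_RC (amp_gt u u') y /\ cont_RC (amp_lt u u') y).
  { intros y. apply amplitudes_continuous; eapply is_derive_RC_continuous;
      [exact (proj1 (Hu y))|exact (proj2 (Hu y))]. }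
  set (f := fun jy : bool * R => if fst jy then amp_gt u u' (snd jy) else amp_lt u u' (snd jy)).
  rewrite (V_primitive x0 F f (amp_gt u u') (amp_lt u u') x); try assumption.
  - rewrite (HF x Hx), (HF x0) by lra. unfold add2; simpl. f_equal; ring.
  - intros y Hy. apply HF. lra.
  - intros [|] y Hy; [exact (proj1 (Hc y))|exact (proj2 (Hc y))].
  - intros y Hy. exact (proj1 (is_derive_amplitudes u u' y Hy (proj1 (Hu y)) (proj2 (Hu y)))).
  - intros y Hy. exact (proj2 (is_derive_amplitudes u u' y Hy (proj1 (Hu y)) (proj2 (Hu y)))).
  - exact (proj1 (Hc x)).
  - exact (proj2 (Hc x)).
Qed.

Lemma is_solution_one (u : R -> C) : is_solution alpha theta 1%C u ->
  exists u', forall x, is_derive_RC u x (u' x) /\ is_derive_RC u' x (- (RtoC (P x) * u x))%C.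
Proof.
  intros [u' Hu]. exists u'. intros x. destruct (Hu x) as [H1 H2]. split; [exact H1|].
  eapply is_derive_RC_eq; [exact H2|]. rewrite inv_c_sqr by assumption. fold P. ring.
Qed.

Lemma wave_pair_equation (x0 : R) (u a_gt a_lt : R -> C) :
  0 < x0 ->
  is_solution alpha theta 1%C u -> is_wave_pair alpha theta x0 u a_gt a_lt ->
  forall y : R, 0 <= y <= x0 ->
    (a_gt y, a_lt y)
    = add2 (a_gt x0, a_lt x0) (V alpha theta x0 (fun t => (a_gt t, a_lt t)) y).
Proof.
  intros Hx0 Hu Hw y Hy. destruct (is_solution_one u Hu) as [u' Hu'].
  apply (solution_amplitudes x0 u u' (fun t => (a_gt t, a_lt t))); try assumption.
  intros x Hx. destruct (wave_pair_amplitudes x0 u u' a_gt a_lt (fun x => proj1 (Hu' x)) Hw x Hx)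
    as [-> ->]. reflexivity.
Qed.

End Amplitudes.

(** * Functions on a segment continued to the line *)

Lemma continuous_Rmin (a x : R) : continuous (fun x => Rmin x a) x.
Proof.
  apply (continuous_ext (fun x => - Rmax (- x) (- a))).
  - intros t. unfold Rmin, Rmax. destruct (Rle_dec (- t) (- a)), (Rle_dec t a); lra.
  - apply continuous_opp_R.
    apply (continuous_comp Ropp (fun x => Rmax x (- a))); [|apply continuous_Rmax].
    apply continuous_opp_R, continuous_id.
Qed.

(** Projection onto [[0, x0]]. Composition with it turns continuity on the segment into continuity
    on the line, so primitives and fixed points need no one-sided versions. *)
Definition clamp (x0 x : R) : R := Rmax (Rmin x x0) 0.

Lemma clamp_range (x0 x : R) : 0 <= x0 -> 0 <= clamp x0 x <= x0.
Proof.
  intros H. unfold clamp. split; [apply Rmax_r|]. apply Rmax_lub; [apply Rmin_r|exact H].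
Qed.

Lemma clamp_id (x0 x : R) : 0 <= x <= x0 -> clamp x0 x = x.
Proof. intros H. unfold clamp. rewrite Rmin_left, Rmax_left; lra. Qed.

Lemma clamp_continuous (x0 x : R) : continuous (clamp x0) x.
Proof.
  apply (continuous_comp (fun x => Rmin x x0) (fun x => Rmax x 0));
    [apply continuous_Rmin|apply continuous_Rmax].
Qed.

Lemma continuous_seg_clamp (x0 : R) (g : R -> C * C) : 0 <= x0 -> continuous_seg x0 g ->
  forall x, cont_RC (fun y => fst (g (clamp x0 y))) x /\ cont_RC (fun y => snd (g (clamp x0 y))) x.
Proof.
  intros H0 Hg x.
  assert (H : filterlim (fun y => g (clamp x0 y)) (locally x)
     (@locally (prod_UniformSpace C_UniformSpace C_UniformSpace) (g (clamp x0 x)))).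
  { apply (filterlim_comp _ _ _ (clamp x0) g _ (within (fun y => 0 <= y <= x0) (locally (clamp x0 x)))).
    - intros Q HQ. unfold filtermap. unfold within in HQ.
      generalize (clamp_continuous x0 x _ HQ). unfold filtermap. apply filter_imp.
      intros y Hy. apply Hy. now apply clamp_range.
    - apply (Hg (clamp x0 x)). now apply clamp_range. }
  split.
  - apply (filterlim_comp _ _ _ (fun y => g (clamp x0 y)) fst _ _ _ H).
    destruct (g (clamp x0 x)) as [p r]. exact (@continuous_fst C_UniformSpace C_UniformSpace p r).
  - apply (filterlim_comp _ _ _ (fun y => g (clamp x0 y)) snd _ _ _ H).
    destruct (g (clamp x0 x)) as [p r]. exact (@continuous_snd C_UniformSpace C_UniformSpace p r).
Qed.

Lemma continuous_seg_of_components (x0 : R) (f : bool * R -> C) :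
  (forall j x, cont_RC (fun y => f (j, y)) x) ->
  continuous_seg x0 (fun x => (f (true, x), f (false, x))).
Proof.
  intros Hf x _. apply (filterlim_filter_le_1 (F := locally x)).
  - intros Q HQ. unfold within. revert HQ. apply filter_imp. auto.
  - intros Q [eps HQ].
    assert (H1 := proj1 (filterlim_locally _ _) (Hf true x) eps).
    assert (H2 := proj1 (filterlim_locally _ _) (Hf false x) eps).
    unfold filtermap. generalize (filter_and _ _ H1 H2). apply filter_imp.
    intros y [Hy1 Hy2]. apply HQ. exact (conj Hy1 Hy2).
Qed.

Lemma bounded_on_segment (x0 : R) (f : R -> C) : 0 <= x0 ->
  (forall x, cont_RC f x) -> exists B, forall x, 0 <= x <= x0 -> Cmod (f x) <= B.
Proof.
  intros H0 Hf.
  destruct (continuity_ab_maj (fun x => Rabs (Re (f x)) + Rabs (Im (f x))) 0 x0 H0) as [m [Hm _]].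
  - intros x _. apply continuity_pt_filterlim.
    destruct (proj1 (continuous_C_iff f x) (Hf x)) as [A B].
    apply (continuous_plus_R
      (fun x => Rabs (Re (f x))) (fun x => Rabs (Im (f x)))).
    + apply (continuous_comp (fun x => Re (f x)) Rabs); [exact A|apply continuous_Rabs].
    + apply (continuous_comp (fun x => Im (f x)) Rabs); [exact B|apply continuous_Rabs].
  - exists (Rabs (Re (f m)) + Rabs (Im (f m))). intros x Hx.
    eapply Rle_trans; [apply Cmod_le_abs|]. now apply Hm.
Qed.

(** * Inversion of Id - V *)

Section VolterraOperator.

Variables (alpha theta x0 : R).
Hypothesis (alpha_pos : 0 < alpha) (theta_pos : 0 < theta) (x0_pos : 0 < x0).

Let wgt := V_weight alpha theta.

(* The substitution [z = y ^ alpha] turns [V_weight y dy] into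
   [theta / (4 (1 + theta z)) dz], which has no singularity at [0]. *)
Definition V_density (z : R) : R := theta / (4 * (1 + theta * Rmax z 0)).

Definition V_prim (f : R -> C) (x : R) : C :=
  primitive_RC (fun z => RtoC (V_density z) * f (pos_pow (/ alpha) z))%C (pos_pow alpha x).

Lemma V_density_continuous (z : R) : continuous V_density z.
Proof.
  unfold V_density.
  apply (continuous_ext (fun z => theta * / (4 * (1 + theta * Rmax z 0)))); [reflexivity|].
  apply continuous_scal_R.
  apply (continuous_comp (fun z => 4 * (1 + theta * Rmax z 0)) Rinv).
  - apply continuous_scal_R.
    apply continuous_plus_R; [apply continuous_const|].
    apply continuous_scal_R, continuous_Rmax.
  - apply continuous_Rinv. generalize (Rmax_r z 0). nra.
Qed.

Lemma V_density_bound (z : R) : 0 < V_density z <= theta / 4.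
Proof.
  assert (Hm := Rmax_r z 0). unfold V_density. split.
  - apply Rdiv_lt_0_compat; [exact theta_pos|]. nra.
  - unfold Rdiv. apply Rmult_le_compat_l; [lra|]. apply Rinv_le_contravar; [lra|]. nra.
Qed.

Lemma V_integrand_continuous (f : R -> C) (z : R) : (forall x, cont_RC f x) ->
  cont_RC (fun z => RtoC (V_density z) * f (pos_pow (/ alpha) z))%C z.
Proof.
  intros Hf. apply cont_RC_mult; [apply cont_RC_RtoC, V_density_continuous|].
  apply (cont_RC_comp (pos_pow (/ alpha)) f); [|apply Hf].
  apply pos_pow_continuous, Rinv_0_lt_compat, alpha_pos.
Qed.

Lemma V_prim_continuous (f : R -> C) (x : R) : (forall x, cont_RC f x) -> cont_RC (V_prim f) x.
Proof.
  intros Hf. apply (cont_RC_comp (pos_pow alpha)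
    (primitive_RC (fun z => RtoC (V_density z) * f (pos_pow (/ alpha) z))%C)).
  - now apply pos_pow_continuous.
  - eapply is_derive_RC_continuous. apply is_derive_primitive_RC.
    intros y. now apply V_integrand_continuous.
Qed.

Lemma is_derive_V_prim (f : R -> C) (x : R) : (forall x, cont_RC f x) -> 0 < x ->
  is_derive_RC (V_prim f) x (RtoC (wgt x) * f x)%C.
Proof.
  intros Hf Hx. eapply is_derive_RC_eq.
  - apply (is_derive_RC_comp
      (primitive_RC (fun z => RtoC (V_density z) * f (pos_pow (/ alpha) z))%C) (pos_pow alpha) x
      (alpha * Rpower x (alpha - 1))).
    + apply is_derive_primitive_RC. intros y. now apply V_integrand_continuous.
    + apply (is_derive_ext_loc (fun y => Rpower y alpha)); [|now apply is_derive_Rpower].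
      generalize (locally_gt 0 x Hx). apply filter_imp. intros y Hy. symmetry; now apply pos_pow_pos.
  - cbv beta. rewrite pos_pow_inverse by lra. rewrite Cmult_assoc, <- RtoC_mult. f_equal. f_equal.
    unfold V_density, wgt, V_weight, dpot, pot.
    rewrite Rmax_left by apply pos_pow_ge_0. field.
    generalize (pos_pow_ge_0 alpha x). nra.
Qed.

(** Bound on the integral of [V_weight] over [(0, x0]]: in the variable [z] the density is at most
    [theta / 4] on an interval of length [x0^alpha]. *)
Definition V_size : R := theta * Rpower x0 alpha / 4.

Lemma V_size_pos : 0 < V_size.
Proof. unfold V_size. assert (0 < Rpower x0 alpha) by apply exp_pos. nra. Qed.

(** Stated for a difference of two functions, the form used by contractions; the choice [f2 = 0]
    gives a bound on a single function. *)
Lemma V_prim_diff_bound (f1 f2 : R -> C) (K : R) :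
  (forall x, cont_RC f1 x) -> (forall x, cont_RC f2 x) ->
  (forall x, 0 <= x <= x0 -> Cmod (f1 x - f2 x)%C <= K) ->
  forall x, 0 <= x <= x0 ->
  Cmod ((V_prim f1 x - V_prim f1 x0) - (V_prim f2 x - V_prim f2 x0))%C <= K * V_size.
Proof.
  intros H1 H2 HK x Hx.
  assert (HK0 : 0 <= K).
  { generalize (HK 0 ltac:(lra)) (Cmod_ge_0 (f1 0 - f2 0)%C); lra. }
  set (i1 := fun z => (RtoC (V_density z) * f1 (pos_pow (/ alpha) z))%C).
  set (i2 := fun z => (RtoC (V_density z) * f2 (pos_pow (/ alpha) z))%C).
  set (D := fun z => (primitive_RC i1 z - primitive_RC i2 z)%C).
  set (z0 := pos_pow alpha x0). set (z := pos_pow alpha x).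
  replace ((V_prim f1 x - V_prim f1 x0) - (V_prim f2 x - V_prim f2 x0))%C
    with (- (D z0 - D z))%C by (unfold D, z0, z, V_prim, i1, i2; ring).
  rewrite Cmod_opp.
  assert (Hz0 : z0 = Rpower x0 alpha) by (now apply pos_pow_pos).
  assert (Hz : 0 <= z) by apply pos_pow_ge_0.
  assert (Hzz : z <= z0) by (apply pos_pow_le; lra).
  apply Rle_trans with (K * (theta / 4) * (z0 - z)).
  - apply (lipschitz_bound D (fun t => i1 t - i2 t)%C); [exact Hzz|].
    intros t Ht. split.
    { apply is_derive_RC_minus; apply is_derive_primitive_RC; intros y;
        now apply V_integrand_continuous. }
    unfold i1, i2.
    replace (RtoC (V_density t) * f1 (pos_pow (/ alpha) t) - RtoC (V_density t) * f2 (pos_pow (/ alpha) t))%C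
      with (RtoC (V_density t) * (f1 (pos_pow (/ alpha) t) - f2 (pos_pow (/ alpha) t)))%C by ring.
    rewrite Cmod_mult, Cmod_R. rewrite Rabs_right by (generalize (V_density_bound t); lra).
    rewrite (Rmult_comm K). apply Rmult_le_compat.
    + generalize (V_density_bound t); lra.
    + apply Cmod_ge_0.
    + apply V_density_bound.
    + apply HK. split; [apply pos_pow_ge_0|].
      rewrite <- (pos_pow_inverse alpha x0) by lra.
      apply pos_pow_le; [now apply Rinv_0_lt_compat|]. fold z0. lra.
  - rewrite Hz0. unfold V_size.
    assert (0 <= K * (theta / 4)) by (apply Rmult_le_pos; lra). nra.
Qed.

Lemma V_prim_zero_diff (f : R -> C) (x : R) :
  (forall x, f x = RtoC 0) -> 0 <= x <= x0 -> (V_prim f x - V_prim f x0)%C = RtoC 0.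
Proof.
  intros Hf Hx. assert (Hc : forall x, cont_RC f x).
  { intros y. apply (cont_RC_ext (fun _ => RtoC 0)); [intros; now rewrite Hf|apply cont_RC_const]. }
  apply Cmod_le_0.
  assert (E : V_prim f = V_prim (fun _ => RtoC 0)).
  { f_equal. apply functional_extensionality. exact Hf. }
  rewrite E. unfold V_prim.
  set (D := primitive_RC (fun z => RtoC (V_density z) * 0)%C).
  assert (HD : forall t, is_derive_RC D t (RtoC 0)).
  { intros t. eapply is_derive_RC_eq; [apply is_derive_primitive_RC|ring].
    intros y. apply (V_integrand_continuous (fun _ => RtoC 0)). intros; apply cont_RC_const. }
  assert (Hm : forall s t, s <= t -> Cmod (D t - D s)%C <= 0).
  { intros s t Hst. rewrite <- (Rmult_0_l (t - s)).
    apply (lipschitz_bound D (fun _ => RtoC 0)); [exact Hst|].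
    intros y _. split; [apply HD|]. rewrite Cmod_0; lra. }
  destruct (Rle_dec (pos_pow alpha x0) (pos_pow alpha x)) as [Hs|Hs].
  - now apply Hm.
  - replace (D (pos_pow alpha x) - D (pos_pow alpha x0))%C with
      (- (D (pos_pow alpha x0) - D (pos_pow alpha x)))%C by ring.
    rewrite Cmod_opp. apply Hm. lra.
Qed.

(** The operator [V] on scalar functions of [bool * R] in place of pairs of functions, so that the
    scalar fixed point lemma applies; clamping makes the image continuous on the line. *)
Definition V_components (f : bool * R -> C) (jx : bool * R) : C :=
  let h := if fst jx then V_gt_row alpha theta f else V_lt_row alpha theta f in
  (V_prim h (clamp x0 (snd jx)) - V_prim h x0)%C.

Lemma V_components_continuous (f : bool * R -> C) :
  (forall j x, cont_RC (fun y => f (j, y)) x) ->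
  forall j x, cont_RC (fun y => V_components f (j, y)) x.
Proof.
  intros Hf j x. unfold V_components. simpl.
  apply cont_RC_minus; [|apply cont_RC_const].
  apply (cont_RC_comp (clamp x0) (V_prim (if j then V_gt_row alpha theta f else V_lt_row alpha theta f)));
    [apply clamp_continuous|].
  apply V_prim_continuous. intros y.
  destruct (V_rows_continuous alpha theta alpha_pos theta_pos f y (fun j => Hf j y)) as [A B].
  destruct j; [exact A|exact B].
Qed.

Lemma V_rows_diff (f1 f2 : bool * R -> C) (K : R) :
  (forall j x, 0 <= x <= x0 -> Cmod (f1 (j, x) - f2 (j, x))%C <= K) ->
  forall x, 0 <= x <= x0 ->
  Cmod (V_gt_row alpha theta f1 x - V_gt_row alpha theta f2 x)%C <= 2 * K /\
  Cmod (V_lt_row alpha theta f1 x - V_lt_row alpha theta f2 x)%C <= 2 * K.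
Proof.
  intros HK x Hx. assert (H1 := HK true x Hx). assert (H2 := HK false x Hx).
  unfold V_gt_row, V_lt_row. split.
  - match goal with |- Cmod (- ?a + ?e * ?b - (- ?a' + ?e * ?b'))%C <= _ =>
      replace (- a + e * b - (- a' + e * b'))%C with (- (a - a') + e * (b - b'))%C by ring end.
    apply Cmod_triangle_le. rewrite Cmod_opp, Cmod_mult, Cmod_cis. lra.
  - match goal with |- Cmod (?e * ?a - ?b - (?e * ?a' - ?b'))%C <= _ =>
      replace (e * a - b - (e * a' - b'))%C with (e * (a - a') + - (b - b'))%C by ring end.
    apply Cmod_triangle_le. rewrite Cmod_opp, Cmod_mult, Cmod_cis. lra.
Qed.

Lemma V_components_diff (f1 f2 : bool * R -> C) (K : R) :
  (forall j x, cont_RC (fun y => f1 (j, y)) x) -> (forall j x, cont_RC (fun y => f2 (j, y)) x) ->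
  (forall j x, 0 <= x <= x0 -> Cmod (f1 (j, x) - f2 (j, x))%C <= K) ->
  forall jx, Cmod (V_components f1 jx - V_components f2 jx)%C <= 2 * K * V_size.
Proof.
  intros H1 H2 HK [j x]. unfold V_components. simpl.
  assert (Hcl := clamp_range x0 x ltac:(lra)).
  assert (C1 := fun y => V_rows_continuous alpha theta alpha_pos theta_pos f1 y (fun j => H1 j y)).
  assert (C2 := fun y => V_rows_continuous alpha theta alpha_pos theta_pos f2 y (fun j => H2 j y)).
  assert (HR := V_rows_diff f1 f2 K HK).
  destruct j; apply V_prim_diff_bound; try exact Hcl; intros y; try (apply HR; assumption).
  - exact (proj1 (C1 y)).
  - exact (proj1 (C2 y)).
  - exact (proj2 (C1 y)).
  - exact (proj2 (C2 y)).
Qed.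

Lemma V_eq_components (F : R -> C * C) (f : bool * R -> C) (x : R) :
  0 <= x <= x0 ->
  (forall y, 0 < y <= x0 -> F y = (f (true, y), f (false, y))) ->
  (forall j x, cont_RC (fun y => f (j, y)) x) ->
  V alpha theta x0 F x = (V_components f (true, x), V_components f (false, x)).
Proof.
  intros Hx HF Hf. unfold V_components. simpl. rewrite !clamp_id by exact Hx.
  assert (Hr := fun y => V_rows_continuous alpha theta alpha_pos theta_pos f y (fun j => Hf j y)).
  apply (V_primitive alpha theta alpha_pos theta_pos x0 F f
    (V_prim (V_gt_row alpha theta f)) (V_prim (V_lt_row alpha theta f)) x); try assumption.
  - intros j y _. apply Hf.
  - intros y Hy. apply is_derive_V_prim; [|exact Hy]. intros z; exact (proj1 (Hr z)).
  - intros y Hy. apply is_derive_V_prim; [|exact Hy]. intros z; exact (proj2 (Hr z)).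
  - apply V_prim_continuous. intros z; exact (proj1 (Hr z)).
  - apply V_prim_continuous. intros z; exact (proj2 (Hr z)).
Qed.

(** Each row of the matrix has two entries of modulus [1], so the ratio of the contraction is at
    most [2 * V_size], hence at most [1/2]. *)
Hypothesis size_small : 4 * V_size <= 1.

Definition components (x1 : R) (F : R -> C * C) (jx : bool * R) : C :=
  let v := F (clamp x1 (snd jx)) in if fst jx then fst v else snd v.

Lemma components_continuous (F : R -> C * C) : continuous_seg x0 F ->
  forall j x, cont_RC (fun y => components x0 F (j, y)) x.
Proof.
  intros HF j x. destruct (continuous_seg_clamp x0 F ltac:(lra) HF x) as [A B].
  destruct j; [exact A|exact B].
Qed.

Lemma components_eq (F : R -> C * C) (x : R) : 0 <= x <= x0 ->
  F x = (components x0 F (true, x), components x0 F (false, x)).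
Proof. intros Hx. unfold components; simpl. rewrite clamp_id by exact Hx. now destruct (F x). Qed.

Lemma solves_components (g F : R -> C * C) : solves_Id_sub_V alpha theta x0 g F ->
  forall jx, components x0 F jx = (components x0 g jx + V_components (components x0 F) jx)%C.
Proof.
  intros [HF1 HF2] [j x].
  assert (Hc := components_continuous F HF1).
  assert (Hcl := clamp_range x0 x ltac:(lra)).
  specialize (HF2 (clamp x0 x) Hcl).
  rewrite (V_eq_components F (components x0 F)) in HF2; try assumption.
  2: { intros y Hy. apply components_eq. lra. }
  assert (Hcc : forall j, V_components (components x0 F) (j, clamp x0 x) = V_components (components x0 F) (j, x)).
  { intros j'. unfold V_components; simpl. now rewrite (clamp_id x0 (clamp x0 x)). }
  unfold components at 1 2. simpl. rewrite HF2.
  destruct j; simpl; now rewrite Hcc.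
Qed.

Lemma continuous_bounded (F : R -> C * C) :
  continuous_seg x0 F -> exists B, 0 <= B /\ bounded_by (fun _ => 1) B (components x0 F).
Proof.
  intros HF. assert (Hc := components_continuous F HF).
  destruct (bounded_on_segment x0 (fun y => components x0 F (true, y)) ltac:(lra) (Hc true)) as [B1 H1].
  destruct (bounded_on_segment x0 (fun y => components x0 F (false, y)) ltac:(lra) (Hc false)) as [B2 H2].
  exists (Rabs B1 + Rabs B2). split; [generalize (Rabs_pos B1) (Rabs_pos B2); lra|].
  intros [j x]. assert (Hcl := clamp_range x0 x ltac:(lra)).
  specialize (H1 (clamp x0 x) Hcl). specialize (H2 (clamp x0 x) Hcl).
  unfold components in *. simpl in *. rewrite (clamp_id x0 (clamp x0 x)) in * by exact Hcl.
  generalize (Rle_abs B1) (Rle_abs B2) (Rabs_pos B1) (Rabs_pos B2). intros.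
  destruct j; lra.
Qed.

Lemma V_components_half (f1 f2 : bool * R -> C) (K : R) :
  (forall j x, cont_RC (fun y => f1 (j, y)) x) -> (forall j x, cont_RC (fun y => f2 (j, y)) x) ->
  bounded_by (fun _ => 1) K (fun jx => f1 jx - f2 jx)%C ->
  bounded_by (fun _ => 1) (K / 2) (fun jx => V_components f1 jx - V_components f2 jx)%C.
Proof.
  intros H1 H2 HK jx.
  assert (HK' : forall j x, 0 <= x <= x0 -> Cmod (f1 (j, x) - f2 (j, x))%C <= K).
  { intros j x _. specialize (HK (j, x)). simpl in HK. lra. }
  eapply Rle_trans; [apply (V_components_diff f1 f2 K H1 H2 HK')|].
  generalize V_size_pos (HK' true 0 ltac:(lra)) (Cmod_ge_0 (f1 (true, 0) - f2 (true, 0))%C). intros.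
  nra.
Qed.

Lemma solves_Id_sub_V_unique (g F1 F2 : R -> C * C) :
  solves_Id_sub_V alpha theta x0 g F1 -> solves_Id_sub_V alpha theta x0 g F2 ->
  forall x, 0 <= x <= x0 -> F1 x = F2 x.
Proof.
  intros HF1 HF2 x Hx.
  destruct (continuous_bounded F1 (proj1 HF1)) as [B1 [_ HB1]].
  destruct (continuous_bounded F2 (proj1 HF2)) as [B2 [_ HB2]].
  assert (H : forall jx, components x0 F1 jx = components x0 F2 jx).
  { apply (contraction_unique (fun _ => 1) (components x0 g) (components x0 F1) (components x0 F2)
      (V_components (components x0 F1)) (V_components (components x0 F2)) (B1 + B2)).
    - intros; lra.
    - intros B HB. apply V_components_half; [| |exact HB]; apply components_continuous;
        [apply HF1|apply HF2].
    - now apply solves_components.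
    - now apply solves_components.
    - intros jx. apply Cmod_triangle_le. rewrite Cmod_opp.
      generalize (HB1 jx) (HB2 jx). lra. }
  rewrite (components_eq F1 x Hx), (components_eq F2 x Hx). now rewrite !H.
Qed.

(** The explicit bound [2 * B] is part of the conclusion because the expansion later bounds the
    solution for the data [(1, k)] with [B = 1]. *)
Lemma solves_Id_sub_V_exists (g : R -> C * C) (B : R) :
  continuous_seg x0 g -> 0 <= B -> bounded_by (fun _ => 1) B (components x0 g) ->
  exists F, solves_Id_sub_V alpha theta x0 g F /\
    forall x, 0 <= x <= x0 -> Cmod (fst (F x)) <= 2 * B /\ Cmod (snd (F x)) <= 2 * B.
Proof.
  intros Hg HB0 HB.
  destruct (contraction_fixpoint (fun _ : bool * R => 1)
    (fun f => forall j x, cont_RC (fun y => f (j, y)) x) V_components (components x0 g) B)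
    as [f [Hf [Hb Hfix]]].
  - intros; lra.
  - exact HB0.
  - intros; apply cont_RC_const.
  - intros fn f K Hfn Hlim j. apply (cont_RC_limit (fun _ => 1) (fun n x => fn n (j, x))
      (fun x => f (j, x)) K).
    + intros; apply continuous_const.
    + intros; lra.
    + intros n x. apply Hfn.
    + intros n x. apply (Hlim n (j, x)).
  - intros f K Hf _ j x. apply cont_RC_plus; [now apply components_continuous|].
    now apply V_components_continuous.
  - intros f1 f2 K1 K2 K H1 H2 _ _ HK. now apply V_components_half.
  - intros [j x]. unfold V_components. simpl. apply V_prim_zero_diff; [|apply clamp_range; lra].
    intros y. destruct j; unfold V_gt_row, V_lt_row; ring.
  - exact HB.
  - exists (fun x => (f (true, x), f (false, x))). split.
    + split; [now apply continuous_seg_of_components|].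
      intros x Hx. rewrite (V_eq_components _ f x Hx); [|intros; reflexivity|exact Hf].
      rewrite (Hfix (true, x)), (Hfix (false, x)). rewrite (components_eq g x Hx). reflexivity.
    + intros x _. simpl. split; [specialize (Hb (true, x))|specialize (Hb (false, x))]; simpl in Hb; lra.
Qed.

Lemma Id_sub_V_invertible_small : Id_sub_V_invertible alpha theta x0.
Proof.
  intros g Hg. split.
  - destruct (continuous_bounded g Hg) as [B [HB0 HB]].
    destruct (solves_Id_sub_V_exists g B Hg HB0 HB) as [F [HF _]]. now exists F.
  - intros F1 F2. apply solves_Id_sub_V_unique.
Qed.

End VolterraOperator.

(** * Limits as [sigma] increases to [0] *)

Definition left_limit_0 (f : R -> C) (l : C) : Prop :=
  forall eps, 0 < eps -> exists delta, 0 < delta /\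
    forall sigma, - delta < sigma -> sigma <= 0 -> Cmod (f sigma - l)%C <= eps.

Lemma left_limit_0_const (z : C) : left_limit_0 (fun _ => z) z.
Proof.
  intros eps He. exists 1. split; [lra|]. intros sigma _ _.
  replace (z - z)%C with (RtoC 0) by ring. rewrite Cmod_0. lra.
Qed.

Lemma left_limit_0_plus (f g : R -> C) (l m : C) :
  left_limit_0 f l -> left_limit_0 g m -> left_limit_0 (fun s => f s + g s)%C (l + m)%C.
Proof.
  intros Hf Hg eps He.
  destruct (Hf (eps / 2)) as [d1 [Hd1 H1]]; [lra|]. destruct (Hg (eps / 2)) as [d2 [Hd2 H2]]; [lra|].
  exists (Rmin d1 d2). split; [now apply Rmin_glb_lt|]. intros s Hs Hs0.
  generalize (Rmin_l d1 d2) (Rmin_r d1 d2); intros.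
  replace (f s + g s - (l + m))%C with ((f s - l) + (g s - m))%C by ring.
  apply Cmod_triangle_le.
  specialize (H1 s ltac:(lra) Hs0). specialize (H2 s ltac:(lra) Hs0). lra.
Qed.

Lemma left_limit_0_mult (f g : R -> C) (l m : C) :
  left_limit_0 f l -> left_limit_0 g m -> left_limit_0 (fun s => f s * g s)%C (l * m)%C.
Proof.
  intros Hf Hg eps He.
  assert (Hl := Cmod_ge_0 l). assert (Hm := Cmod_ge_0 m).
  set (e1 := eps / (2 * (Cmod m + 1))). set (e2 := Rmin 1 (eps / (2 * (Cmod l + 1)))).
  assert (He1 : 0 < e1) by (apply Rdiv_lt_0_compat; lra).
  assert (He2 : 0 < e2) by (apply Rmin_glb_lt; [lra|apply Rdiv_lt_0_compat; lra]).
  destruct (Hf e1 He1) as [d1 [Hd1 H1]]. destruct (Hg e2 He2) as [d2 [Hd2 H2]].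
  exists (Rmin d1 d2). split; [now apply Rmin_glb_lt|]. intros s Hs Hs0.
  generalize (Rmin_l d1 d2) (Rmin_r d1 d2); intros.
  specialize (H1 s ltac:(lra) Hs0). specialize (H2 s ltac:(lra) Hs0).
  replace (f s * g s - l * m)%C with ((f s - l) * ((g s - m) + m) + l * (g s - m))%C by ring.
  apply Cmod_triangle_le. rewrite !Cmod_mult.
  assert (Ha : Cmod (g s - m + m)%C <= Cmod m + 1).
  { apply Cmod_triangle_le. generalize (Rmin_l 1 (eps / (2 * (Cmod l + 1)))).
    fold e2. lra. }
  assert (Hb : Cmod l * Cmod (g s - m)%C <= eps / 2).
  { assert (H3 : Cmod (g s - m)%C <= eps / (2 * (Cmod l + 1))).
    { eapply Rle_trans; [exact H2|apply Rmin_r]. }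
    apply Rle_div_r in H3; [|lra]. generalize (Cmod_ge_0 (g s - m)%C). nra. }
  assert (Hc : Cmod (f s - l)%C * Cmod (g s - m + m)%C <= eps / 2).
  { apply Rle_div_r in H1; [|lra].
    generalize (Cmod_ge_0 (f s - l)%C) (Cmod_ge_0 (g s - m + m)%C). nra. }
  lra.
Qed.

Lemma left_limit_0_zeta : left_limit_0 zeta (zeta 0).
Proof.
  intros eps He. exists eps. split; [exact He|]. intros s Hs Hs0.
  replace (zeta s - zeta 0)%C with (Ci * RtoC s)%C by (unfold zeta; ring).
  rewrite Cmod_mult, Cmod_Ci, Cmod_R, Rabs_left1; lra.
Qed.

Lemma left_limit_0_wave (b t : R) : 0 <= t -> left_limit_0 (fun s => wave s b t) (wave 0 b t).
Proof.
  intros Ht eps He. exists (eps / (t + 1)). split; [apply Rdiv_lt_0_compat; lra|].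
  intros s Hs Hs0. eapply Rle_trans; [apply (wave_damping s b t Hs0 Ht)|].
  assert (H : - s < eps / (t + 1)) by lra. apply Rlt_div_r in H; [|lra]. nra.
Qed.

Lemma left_limit_0_seq (f : R -> C) (l : C) (sg : nat -> R) :
  left_limit_0 f l -> (forall n, sg n < 0) -> is_lim_seq sg 0 ->
  forall eps, 0 < eps -> exists N, forall n, (N <= n)%nat -> Cmod (f (sg n) - l)%C <= eps.
Proof.
  intros Hf Hn Hl eps He. destruct (Hf eps He) as [d [Hd H]].
  destruct (proj1 (filterlim_locally _ _) Hl (mkposreal d Hd)) as [N HN].
  exists N. intros n Hnn. specialize (HN n Hnn).
  change (Rabs (sg n - 0) < d) in HN. rewrite Rminus_0_r in HN.
  specialize (Hn n). rewrite Rabs_left in HN by exact Hn. apply H; lra.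
Qed.

(** * Wronskians and growth of solutions *)

Section Solutions.

Variables (alpha theta : R).
Hypothesis (alpha_pos : 0 < alpha) (theta_pos : 0 < theta).

Let P := pot alpha theta.

Definition potential_term (z : C) (x : R) : C := (- (z * z * RtoC (P x)))%C.

Definition ode (z : C) (u u' : R -> C) : Prop :=
  forall x, is_derive_RC u x (u' x) /\ is_derive_RC u' x (potential_term z x * u x)%C.

Lemma is_solution_ode (z : C) (u : R -> C) :
  is_solution alpha theta z u <-> exists u', ode z u u'.
Proof.
  assert (E : forall x, (potential_term z x * u x)%C
    = (- (z * z * RtoC (/ (c alpha theta x) ^ 2) * u x))%C).
  { intros x. unfold potential_term. rewrite inv_c_sqr by assumption. fold P. ring. }
  split; intros [u' H]; exists u'; intros x; destruct (H x) as [H1 H2]; split; try exact H1;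
    eapply is_derive_RC_eq; try exact H2; [symmetry|]; apply E.
Qed.

Lemma potential_term_cont (z : C) (x : R) : cont_RC (potential_term z) x.
Proof.
  unfold potential_term. apply cont_RC_opp, cont_RC_mult; [apply cont_RC_const|].
  apply cont_RC_RtoC, pot_continuous, alpha_pos.
Qed.

Lemma Cmod_potential_term (z : C) (x : R) : Cmod (potential_term z x) = Cmod z * Cmod z * P x.
Proof.
  unfold potential_term. rewrite Cmod_opp, !Cmod_mult, Cmod_R, Rabs_right; [reflexivity|].
  generalize (pot_ge_1 alpha theta theta_pos x). fold P. lra.
Qed.

Lemma ode_exists (z : C) (x0 : R) (u0 v0 : C) :
  exists u u', ode z u u' /\ u x0 = u0 /\ u' x0 = v0.
Proof.
  apply (linear_ode_exists (potential_term z) (fun x => Cmod z * Cmod z * P x)).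
  - intros x. apply potential_term_cont.
  - intros x. apply continuous_scal_R.
    now apply pot_continuous.
  - intros x. rewrite Cmod_potential_term. apply Rle_refl.
Qed.

(** The energy of the difference vanishes at [x0], hence everywhere. The local form matters because
    Jost waves solve the equation only beyond [a], and plane waves only on the negative axis. *)
Lemma ode_unique_on (z : C) (lo hi x0 : R) (u u' v v' : R -> C) :
  lo <= x0 <= hi ->
  (forall x, lo <= x <= hi -> is_derive_RC u x (u' x) /\ is_derive_RC u' x (potential_term z x * u x)%C) ->
  (forall x, lo <= x <= hi -> is_derive_RC v x (v' x) /\ is_derive_RC v' x (potential_term z x * v x)%C) ->
  u x0 = v x0 -> u' x0 = v' x0 ->
  forall x, lo <= x <= hi -> u x = v x /\ u' x = v' x.
Proof.
  intros Hx0 Hu Hv H0 H1 x Hx.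
  set (Q := Cmod z * Cmod z * P hi).
  assert (HQ : 0 <= Q).
  { unfold Q. generalize (Cmod_ge_0 z) (pot_ge_1 alpha theta theta_pos hi). fold P. intros.
    repeat apply Rmult_le_pos; lra. }
  assert (H := energy_estimate (fun x => u x - v x)%C (fun x => u' x - v' x)%C
    (fun x => potential_term z x * u x - potential_term z x * v x)%C Q 0 lo hi HQ).
  assert (E : energy (u x - v x)%C (u' x - v' x)%C <= 0).
  { assert (HH : energy (u x - v x)%C (u' x - v' x)%C + 0 ^ 2 <=
      (energy (u x0 - v x0)%C (u' x0 - v' x0)%C + 0 ^ 2) * exp ((2 + Q) * Rabs (x - x0))).
    { apply H; [|exact Hx|exact Hx0]. intros y Hy. destruct (Hu y Hy) as [A1 A2].
      destruct (Hv y Hy) as [B1 B2]. split; [now apply is_derive_RC_minus|].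
      split; [now apply is_derive_RC_minus|].
      replace (potential_term z y * u y - potential_term z y * v y)%C
        with (potential_term z y * (u y - v y))%C by ring.
      rewrite Cmod_mult, Cmod_potential_term, Rplus_0_r. apply Rmult_le_compat_r; [apply Cmod_ge_0|].
      unfold Q. apply Rmult_le_compat_l; [apply Rmult_le_pos; apply Cmod_ge_0|].
      now apply pot_nondecreasing. }
    rewrite H0, H1 in HH.
    replace (v x0 - v x0)%C with (RtoC 0) in HH by ring.
    replace (v' x0 - v' x0)%C with (RtoC 0) in HH by ring.
    unfold energy at 2 in HH. rewrite Cmod_0 in HH. lra. }
  apply energy_eq_0 in E. destruct E as [E1 E2]. split.
  - replace (u x) with (u x - v x + v x)%C by ring. rewrite E1. ring.
  - replace (u' x) with (u' x - v' x + v' x)%C by ring. rewrite E2. ring.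
Qed.

Lemma ode_unique (z : C) (x0 : R) (u u' v v' : R -> C) :
  ode z u u' -> ode z v v' -> u x0 = v x0 -> u' x0 = v' x0 ->
  forall x, u x = v x /\ u' x = v' x.
Proof.
  intros Hu Hv H0 H1 x.
  apply (ode_unique_on z (Rmin x x0) (Rmax x x0) x0 u u' v v'); try assumption.
  - split; [apply Rmin_r|apply Rmax_r].
  - intros y _; apply Hu.
  - intros y _; apply Hv.
  - split; [apply Rmin_l|apply Rmax_l].
Qed.

Definition wronskian (u u' v v' : R -> C) (x : R) : C := (u x * v' x - u' x * v x)%C.

Lemma wronskian_constant (z : C) (u u' v v' : R -> C) :
  ode z u u' -> ode z v v' -> forall x y, wronskian u u' v v' x = wronskian u u' v v' y.
Proof.
  intros Hu Hv.
  assert (Hd : forall x, is_derive_RC (wronskian u u' v v') x (RtoC 0)).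
  { intros x. destruct (Hu x) as [A1 A2], (Hv x) as [B1 B2]. eapply is_derive_RC_eq.
    - apply is_derive_RC_minus; apply is_derive_RC_mult; [exact A1|exact B2|exact A2|exact B1].
    - ring. }
  assert (Hm : forall x y, x <= y -> wronskian u u' v v' x = wronskian u u' v v' y).
  { intros x y Hxy.
    symmetry. apply Cmod_minus_le_0. rewrite <- (Rmult_0_l (y - x)).
    apply (lipschitz_bound _ (fun _ => RtoC 0)); [exact Hxy|].
    intros t _. split; [apply Hd|]. rewrite Cmod_0; lra. }
  intros x y. destruct (Rle_dec x y); [now apply Hm|symmetry; apply Hm; lra].
Qed.

(** Both sides are solutions with the same Cauchy data at [x0]. The relation is cross-multiplied so
    that neither value at [x0] has to be nonzero and limits can be taken in it. *)
Lemma proportional_of_wronskian_0 (z : C) (x0 : R) (u u' v v' : R -> C) :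
  ode z u u' -> ode z v v' -> wronskian u u' v v' x0 = RtoC 0 ->
  forall x, (v x0 * u x = u x0 * v x)%C.
Proof.
  intros Hu Hv HW x.
  assert (Hl : forall k f f', ode z f f' -> ode z (fun x => k * f x)%C (fun x => k * f' x)%C).
  { intros k f f' Hf y. destruct (Hf y) as [A B]. split.
    - eapply is_derive_RC_eq; [apply is_derive_RC_mult; [apply is_derive_RC_const|exact A]|cbv beta; ring].
    - eapply is_derive_RC_eq; [apply is_derive_RC_mult; [apply is_derive_RC_const|exact B]|cbv beta; ring]. }
  apply (ode_unique z x0 (fun x => v x0 * u x)%C (fun x => v x0 * u' x)%C
    (fun x => u x0 * v x)%C (fun x => u x0 * v' x)%C).
  - now apply Hl.
  - now apply Hl.
  - ring.
  - unfold wronskian in HW. replace (v x0 * u' x0)%C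
      with (u x0 * v' x0 - (u x0 * v' x0 - u' x0 * v x0))%C by ring.
    rewrite HW. ring.
Qed.

(** On [[x, x + 1]] the second derivative is at most [|z|^2 P(x + 1)], so [u' x] differs from the
    increment of [u] over the unit interval by at most that; the increment itself is at most [2]. *)
Lemma derivative_bound_of_bounded (z : C) (u u' : R -> C) (x : R) :
  ode z u u' -> (forall y, x <= y <= x + 1 -> Cmod (u y) <= 1) ->
  Cmod (u' x) <= 2 + Cmod z * Cmod z * P (x + 1).
Proof.
  intros Hu Hb. set (Q := Cmod z * Cmod z * P (x + 1)).
  assert (HQ : 0 <= Q).
  { unfold Q. generalize (Cmod_ge_0 z) (pot_ge_1 alpha theta theta_pos (x + 1)). fold P. intros.
    repeat apply Rmult_le_pos; lra. }
  assert (H1 : forall y, x <= y <= x + 1 -> Cmod (u' y - u' x)%C <= Q).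
  { intros y Hy. apply Rle_trans with (Q * (y - x)); [|nra].
    apply (lipschitz_bound u' (fun t => potential_term z t * u t)%C); [lra|].
    intros t Ht. split; [exact (proj2 (Hu t))|].
    rewrite Cmod_mult, Cmod_potential_term. specialize (Hb t ltac:(lra)).
    assert (HP : P t <= P (x + 1)) by (apply pot_nondecreasing; lra).
    assert (0 <= P t) by (generalize (pot_ge_1 alpha theta theta_pos t); fold P; lra).
    assert (Hz : 0 <= Cmod z * Cmod z) by (apply Rmult_le_pos; apply Cmod_ge_0).
    apply Rle_trans with (Cmod z * Cmod z * P t * 1).
    - apply Rmult_le_compat_l; [now apply Rmult_le_pos|exact Hb].
    - rewrite Rmult_1_r. now apply Rmult_le_compat_l. }
  set (G := fun t => (u t - RtoC t * u' x)%C).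
  assert (HG : forall t, is_derive_RC G t (u' t - u' x)%C).
  { intros t. unfold G. eapply is_derive_RC_eq.
    - apply is_derive_RC_minus; [exact (proj1 (Hu t))|].
      apply is_derive_RC_mult; [|apply is_derive_RC_const].
      apply is_derive_RC_RtoC. apply @is_derive_id.
    - cbv beta. change one with 1. ring. }
  assert (H2 : Cmod (G (x + 1)%R - G x)%C <= Q).
  { replace Q with (Q * (x + 1 - x)) by ring.
    apply (lipschitz_bound G (fun t => u' t - u' x)%C); [lra|].
    intros t Ht. split; [apply HG|]. apply H1. lra. }
  replace (u' x) with (u (x + 1)%R + - u x + - (G (x + 1)%R - G x))%C
    by (unfold G; rewrite RtoC_plus; ring).
  apply Cmod_triangle_le. rewrite Cmod_opp.
  assert (H3 : Cmod (u (x + 1)%R + - u x)%C <= 2).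
  { apply Cmod_triangle_le. rewrite Cmod_opp.
    generalize (Hb x ltac:(lra)) (Hb (x + 1) ltac:(lra)). lra. }
  lra.
Qed.

Lemma pot_exp_decay (sigma K eps X : R) : sigma < 0 -> 0 <= K -> 0 < eps ->
  exists X', X <= X' /\ forall x, X' <= x -> K * P (x + 1) * exp (sigma * x) <= eps.
Proof.
  intros Hs HK He.
  (* With this slope in [ln(c0 y) <= c0 y - 1], the term [alpha ln(x + 1)] uses up exactly half of
     the exponential rate, and [exp(sigma x / 2)] remains. *)
  set (c0 := - sigma / (2 * alpha)).
  assert (Hc0 : 0 < c0) by (apply Rdiv_lt_0_compat; lra).
  set (k := - sigma / 2 - alpha * (1 + ln c0)).
  set (C0 := K * (1 + theta) * (1 + exp k) + 1).
  assert (HC0 : 0 < C0).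
  { unfold C0. generalize (exp_pos k). intros.
    assert (0 <= K * (1 + theta) * (1 + exp k)) by (repeat apply Rmult_le_pos; lra). lra. }
  exists (Rmax (Rmax X 1) (2 / sigma * ln (eps / C0))).
  split; [eapply Rle_trans; [apply Rmax_l|apply Rmax_l]|].
  intros x Hx.
  assert (Hx1 : 1 <= x).
  { eapply Rle_trans; [apply Rmax_r|]. eapply Rle_trans; [apply Rmax_l|exact Hx]. }
  assert (Hx2 : 2 / sigma * ln (eps / C0) <= x) by (eapply Rle_trans; [apply Rmax_r|exact Hx]).
  assert (Hln : ln (x + 1) <= c0 * (x + 1) - 1 - ln c0).
  { assert (H : ln (c0 * (x + 1)) <= c0 * (x + 1) - 1).
    { assert (H1 := exp_ineq1_le (ln (c0 * (x + 1)))).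
      rewrite exp_ln in H1 by nra. lra. }
    rewrite ln_mult in H by lra. lra. }
  assert (E : Rpower (x + 1) alpha * exp (sigma * x) <= exp k * exp (sigma / 2 * x)).
  { unfold Rpower. rewrite <- !exp_plus.
    assert (alpha * ln (x + 1) + sigma * x <= k + sigma / 2 * x).
    { apply Rle_trans with (alpha * (c0 * (x + 1) - 1 - ln c0) + sigma * x).
      - apply Rplus_le_compat_r, Rmult_le_compat_l; lra.
      - unfold k. replace (alpha * (c0 * (x + 1) - 1 - ln c0))
          with (- sigma / 2 * (x + 1) - alpha * (1 + ln c0)) by (unfold c0; field; lra). lra. }
    now apply exp_le_compat. }
  assert (E2 : exp (sigma * x) <= exp (sigma / 2 * x)) by (apply Rlt_le, exp_increasing; nra).
  assert (E3 : exp (sigma / 2 * x) <= eps / C0).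
  { rewrite <- (exp_ln (eps / C0)) by (apply Rdiv_lt_0_compat; lra).
    assert (sigma / 2 * x <= ln (eps / C0)).
    { replace (ln (eps / C0)) with (sigma / 2 * (2 / sigma * ln (eps / C0))) by (field; lra).
      apply Rmult_le_compat_neg_l; lra. }
    now apply exp_le_compat. }
  assert (Hp0 := exp_pos (sigma / 2 * x)). assert (Hk := exp_pos k).
  unfold P. rewrite pot_pos by lra.
  apply Rle_trans with (C0 * exp (sigma / 2 * x)).
  - replace (K * (1 + theta * Rpower (x + 1) alpha) * exp (sigma * x))
      with (K * (exp (sigma * x) + theta * (Rpower (x + 1) alpha * exp (sigma * x)))) by ring.
    apply Rle_trans with (K * (exp (sigma / 2 * x) + theta * (exp k * exp (sigma / 2 * x)))).
    + apply Rmult_le_compat_l; [exact HK|]. apply Rplus_le_compat; [exact E2|].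
      apply Rmult_le_compat_l; lra.
    + unfold C0. assert (0 <= K * exp (sigma / 2 * x)) by (apply Rmult_le_pos; lra).
      assert (0 <= K * exp (sigma / 2 * x) * theta) by (apply Rmult_le_pos; lra).
      assert (0 <= K * exp (sigma / 2 * x) * exp k) by (apply Rmult_le_pos; lra).
      lra.
  - apply Rle_div_r in E3; [|lra]. lra.
Qed.

End Solutions.

Lemma two_Ci_neq_0 : (2 * Ci)%C <> RtoC 0.
Proof. apply Cmult_neq_0; [apply two_neq_0|apply Ci_neq_0]. Qed.

Lemma Cmod_inv_two_Ci : Cmod (/ (2 * Ci))%C = / 2.
Proof.
  rewrite Cmod_inv by apply two_Ci_neq_0. rewrite Cmod_mult, Cmod_Ci, Cmod_R, Rabs_right by lra.
  now rewrite Rmult_1_r.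
Qed.

Lemma RInt_RC_ext (f g : R -> C) (u v : R) :
  (forall x, Rmin u v < x < Rmax u v -> f x = g x) -> RInt_RC f u v = RInt_RC g u v.
Proof. apply (@RInt_ext C_R_CompleteNormedModule). Qed.

Lemma RInt_gen_tail_ext (f g H : R -> C) (x : R) :
  (forall y, x <= y -> f y = g y) ->
  (forall y, x <= y -> is_derive_RC H y (g y) /\ cont_RC g y) ->
  vanishes_at_infinity H ->
  RInt_gen_RC f (at_point x) (Rbar_locally p_infty) = (- H x)%C.
Proof.
  intros Hfg Hd Hv. apply (is_RInt_gen_unique (V := C_R_CompleteNormedModule)).
  apply (is_RInt_gen_ext g); [|now apply is_RInt_gen_tail].
  apply (Filter_prod _ _ _ (fun u => u = x) (fun v => x < v)).
  - reflexivity.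
  - exists x. intros; assumption.
  - intros u v -> Hv' y. simpl. rewrite Rmin_left by lra. intros Hy. symmetry. apply Hfg. lra.
Qed.


Lemma cis_minus_PI : cis (- PI) = (- RtoC 1)%C.
Proof. unfold cis. rewrite cos_neg, sin_neg, cos_PI, sin_PI. apply C_eta; simpl; ring. Qed.

Lemma plane_waves_independent (A B A' B' : C) :
  (forall x, x < 0 -> (A * cis x + B * cis (- x))%C = (A' * cis x + B' * cis (- x))%C) ->
  A = A' /\ B = B'.
Proof.
  intros H. assert (HP := PI_RGT_0).
  assert (H1 := H (- PI) ltac:(lra)). assert (H2 := H (- (PI / 2)) ltac:(lra)).
  rewrite Ropp_involutive in H1, H2.
  assert (E1 : cis PI = (- RtoC 1)%C).
  { unfold cis. rewrite cos_PI, sin_PI. apply C_eta; simpl; ring. }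
  assert (E2 : cis (PI / 2) = Ci).
  { unfold cis. now rewrite cos_PI2, sin_PI2. }
  assert (E3 : cis (- (PI / 2)) = (- Ci)%C).
  { unfold cis. rewrite cos_neg, sin_neg, cos_PI2, sin_PI2. apply C_eta; simpl; ring. }
  rewrite cis_minus_PI, E1 in H1. rewrite E2, E3 in H2.
  assert (Hi := Ci_neq_0).
  assert (S1 : (A - A' = - (B - B'))%C).
  { transitivity (- (A * - (1) + B * - (1)) + (A' * - (1) + B' * - (1)) - (B - B'))%C; [ring|].
    rewrite H1. ring. }
  assert (S2 : (A - A' = B - B')%C).
  { transitivity ((- (A * - Ci + B * Ci) + (A' * - Ci + B' * Ci)) / - - Ci * - RtoC 1 * - RtoC 1 + (B - B'))%C.
    - field. exact Hi.
    - rewrite H2. field. exact Hi. }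
  assert (S3 : (B - B' = 0)%C).
  { transitivity (/ 2 * ((B - B') + (B - B')))%C; [field|].
    rewrite <- S2 at 1. rewrite S1. ring. }
  split.
  - replace A with (A - A' + A')%C by ring. rewrite S2, S3. ring.
  - replace B with (B - B' + B')%C by ring. rewrite S3. ring.
Qed.

(** * Outgoing solutions and the reflection coefficient *)

Section Scattering.

Variables (alpha theta x0 mu : R).
Hypothesis (alpha_pos : 0 < alpha) (theta_pos : 0 < theta) (x0_pos : 0 < x0).

Let a := x0 / 2.
Let P := pot alpha theta.
Let om (x : R) := sqrt (P x).
Let ph := phi alpha theta.
Let N := M_ext alpha x0 theta.
Let bb := b alpha theta.

Hypothesis N_bound : forall x, a <= x -> Rabs (N x) <= mu * Rpower x (- (1 + / 2)).
Hypothesis mu_small : 8 * mu * Rpower a (- / 2) <= 1.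

Definition is_jost (sigma : R) (s r A B : R -> C) : Prop :=
  jost ph N a sigma s r A B.

Definition jost_wave (sigma : R) (s : R -> C) (x : R) : C :=
  (wave sigma (-1) (ph x) * (RtoC (bb x) * s x))%C.

(** Formal derivative of [jost_wave]: in [b' s + b phi' (r - i zeta s)] the factor [b phi'] has been
    written [1 / b]. *)
Definition jost_wave' (sigma : R) (s r : R -> C) (x : R) : C :=
  (wave sigma (-1) (ph x) * (RtoC (db alpha theta x) * s x
     + RtoC (/ bb x) * (r x - Ci * zeta sigma * s x)))%C.

Lemma half_x0_pos : 0 < a.
Proof. unfold a; lra. Qed.

Lemma phi_derive_om (x : R) : is_derive ph x (om x).
Proof. now apply is_derive_phi. Qed.

Lemma phi_nondecreasing (x y : R) : x <= y -> ph x <= ph y.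
Proof. intros H. generalize (phi_increment alpha theta alpha_pos theta_pos x y H). fold ph. lra. Qed.

Lemma phi_ge_id (x : R) : 0 <= x -> x <= ph x.
Proof.
  intros H. generalize (phi_increment alpha theta alpha_pos theta_pos 0 x H).
  rewrite phi_0. fold ph. lra.
Qed.

Lemma is_jost_exists (sigma : R) : sigma <= 0 -> exists s r A B, is_jost sigma s r A B.
Proof.
  intros Hs. apply (jost_exists ph om N a mu); try assumption.
  - apply half_x0_pos.
  - apply phi_derive_om.
  - apply phi_nondecreasing.
  - generalize (phi_ge_id a) half_x0_pos; lra.
  - intros x. now apply M_ext_continuous.
Qed.

Lemma bb_inv_om (x : R) : om x = / bb x * / bb x.
Proof.
  assert (Hb := b_pos alpha theta x).
  assert (H := b_sqr_phi' alpha theta theta_pos x). fold bb in Hb, H. fold P in H. fold (om x) in H.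
  replace (om x) with (bb x * bb x * om x * (/ bb x * / bb x)) by (field; lra).
  rewrite H. ring.
Qed.

(** With [phi' = b^(-2)] the terms in [b'] cancel and so do those in [r]; the term [b'' s] cancels
    against [N s / b] because [N = b b'']. The remaining [-zeta^2 b^(-3) s] is [-zeta^2 P b s], as
    [P = b^(-4)]. *)
Lemma is_derive_jost_wave (sigma : R) (s r A B : R -> C) (x : R) :
  is_jost sigma s r A B -> a < x ->
  is_derive_RC (jost_wave sigma s) x (jost_wave' sigma s r x) /\
  is_derive_RC (jost_wave' sigma s r) x
    (potential_term alpha theta (zeta sigma) x * jost_wave sigma s x)%C.
Proof.
  intros HJ Hx. assert (Hx0 : 0 < x) by (generalize half_x0_pos; lra).
  destruct (jost_system ph om N a phi_derive_om sigma s r A B HJ x Hx) as [S1 S2].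
  assert (Hb : 0 < bb x) by apply b_pos.
  assert (Hob := bb_inv_om x).
  assert (HM : N x = bb x * ddb alpha theta x).
  { unfold N. rewrite M_ext_eq by (fold a; lra). now rewrite M_eq. }
  assert (HP : P x = om x * om x).
  { unfold om. rewrite sqrt_sqrt; [reflexivity|]. generalize (pot_ge_1 alpha theta theta_pos x). fold P. lra. }
  assert (Hbi : (RtoC (bb x) * RtoC (/ bb x) = 1)%C).
  { rewrite <- RtoC_mult. f_equal. field. lra. }
  assert (Hii := Ci_sqr).
  assert (Hz : (RtoC sigma + Ci * RtoC (-1) = - (Ci * zeta sigma))%C).
  { unfold zeta. transitivity (- Ci - Ci * Ci * RtoC sigma)%C; [rewrite Hii|ring].
    apply C_eta; simpl; ring. }
  assert (D1 := is_derive_b alpha theta theta_pos x Hx0).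
  assert (D2 := is_derive_db alpha theta theta_pos x Hx0).
  assert (Dw := is_derive_RC_wave sigma (-1) ph x (om x) (phi_derive_om x)).
  rewrite Hz, Hob, RtoC_mult in Dw.
  assert (Di : is_derive (fun x => / bb x) x (- (db alpha theta x) * (/ bb x * / bb x))).
  { eapply is_derive_eq; [apply is_derive_inv; [exact D1|]|].
    - fold (bb x). lra.
    - fold (bb x). field. lra. }
  rewrite Hob, RtoC_mult in S1. rewrite Hob, HM, !RtoC_mult in S2.
  set (d := RtoC (db alpha theta x)). set (dd := RtoC (ddb alpha theta x)).
  fold dd in S2.
  split.
  - eapply is_derive_RC_eq.
    + apply is_derive_RC_mult; [exact Dw|].
      apply is_derive_RC_mult; [apply is_derive_RC_RtoC, D1|exact S1].
    + cbv beta. unfold jost_wave'. fold d. fold (bb x).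
      set (w := wave sigma (-1) (ph x)). set (be := RtoC (bb x)) in *. set (bi := RtoC (/ bb x)) in *.
      transitivity (w * (d * s x + (be * bi) * bi * (r x - Ci * zeta sigma * s x)))%C; [ring|].
      rewrite Hbi. ring.
  - eapply is_derive_RC_eq.
    + apply is_derive_RC_mult; [exact Dw|].
      apply is_derive_RC_plus.
      * apply is_derive_RC_mult; [apply is_derive_RC_RtoC, D2|exact S1].
      * apply is_derive_RC_mult; [apply is_derive_RC_RtoC, Di|].
        apply is_derive_RC_minus; [exact S2|].
        apply is_derive_RC_mult; [apply is_derive_RC_const|exact S1].
    + cbv beta. unfold potential_term, jost_wave. fold P. rewrite HP, Hob, !RtoC_mult, RtoC_opp.
      fold d dd.
      set (w := wave sigma (-1) (ph x)). set (be := RtoC (bb x)) in *. set (bi := RtoC (/ bb x)) in *.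
      transitivity (w * (dd * s x * (1 - be * bi) + (Ci * Ci) * zeta sigma * zeta sigma * (bi * bi * bi) * s x))%C;
        [ring|].
      transitivity (- (w * (zeta sigma * zeta sigma * (bi * bi * bi) * (be * bi) * s x)))%C; [|ring].
      rewrite Hbi, Hii. ring.
Qed.

(** The Jost wave is known to solve the equation only beyond [a]; [u], [u'] continue it to the whole
    line. *)
Definition jost_solution (sigma : R) (s r : R -> C) (u u' : R -> C) : Prop :=
  ode alpha theta (zeta sigma) u u' /\
  forall x, x0 <= x -> u x = jost_wave sigma s x /\ u' x = jost_wave' sigma s r x.

Lemma jost_solution_exists (sigma : R) (s r A B : R -> C) :
  is_jost sigma s r A B -> exists u u', jost_solution sigma s r u u'.
Proof.
  intros HJ.
  destruct (ode_exists alpha theta alpha_pos theta_pos (zeta sigma) x0 (jost_wave sigma s x0)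
    (jost_wave' sigma s r x0)) as [u [u' [Hu [H0 H1]]]].
  exists u, u'. split; [exact Hu|]. intros x Hx.
  apply (ode_unique_on alpha theta alpha_pos theta_pos (zeta sigma) x0 x x0); try assumption; try lra.
  - intros y _. apply Hu.
  - intros y Hy. apply (is_derive_jost_wave sigma s r A B); [exact HJ|]. unfold a; lra.
Qed.

(** Since [phi x >= x] and [sigma <= 0], the damping is at least [exp(sigma x)] strong. A crude
    power of [P] is enough for the derivative, because exponential decay will beat it. *)
Lemma jost_wave_decay (sigma : R) (s r A B : R -> C) :
  sigma <= 0 -> is_jost sigma s r A B -> exists K, 0 <= K /\ forall x, x0 <= x ->
    Cmod (jost_wave sigma s x) <= 2 * exp (sigma * x) /\
    Cmod (jost_wave' sigma s r x) <= K * P x * exp (sigma * x).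
Proof.
  intros Hs HJ.
  assert (Hmu : 0 <= mu).
  { apply (mu_ge_0 N a mu N_bound). }
  set (z := Cmod (zeta sigma)).
  set (rb := 4 * mu * Rpower x0 (- / 2)).
  assert (Hrb : 0 <= rb) by (unfold rb; repeat apply Rmult_le_pos; try lra; apply Rlt_le, exp_pos).
  assert (Hz : 0 <= z) by apply Cmod_ge_0.
  assert (Hi : 0 < / x0) by (now apply Rinv_0_lt_compat).
  exists (2 * (alpha * / x0) + (rb + 2 * z)). split.
  { assert (0 <= alpha * / x0) by (apply Rmult_le_pos; lra). lra. }
  intros x Hx. assert (Hx0 : 0 < x) by lra.
  assert (Hs2 : Cmod (s x) <= 2) by apply HJ.
  assert (Hw : Cmod (wave sigma (-1) (ph x)) <= exp (sigma * x)).
  { rewrite Cmod_wave. assert (sigma * ph x <= sigma * x) by (generalize (phi_ge_id x); nra).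
    now apply exp_le_compat. }
  assert (HP := pot_ge_1 alpha theta theta_pos x). fold P in HP.
  assert (Hb0 : 0 < bb x) by apply b_pos.
  assert (Hb1 : bb x <= 1) by (now apply b_le_1).
  assert (Hr : Cmod (r x) <= rb).
  { eapply Rle_trans.
    - apply (jost_r_bound ph N a mu half_x0_pos phi_nondecreasing N_bound sigma s r A B Hs HJ).
      unfold a; lra.
    - unfold rb. apply Rmult_le_compat_l; [lra|]. apply Rpower_opp_le; lra. }
  assert (Hib : / bb x <= P x).
  { unfold bb. rewrite b_eq, <- Rpower_Ropp, Ropp_involutive by assumption.
    fold P. rewrite <- (Rpower_1 (P x)) at 2 by lra. apply Rle_Rpower; lra. }
  assert (Hib0 : 0 < / bb x) by (now apply Rinv_0_lt_compat).
  assert (Hdb : Cmod (RtoC (db alpha theta x)) <= alpha * / x0 * P x).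
  { rewrite Cmod_R.
    assert (E : db alpha theta x = - (/ 4 * (alpha * (hpot alpha theta x * / x) * Rpower (P x) (- (5 / 4))))).
    { unfold db. rewrite dpot_hpot by exact Hx0. fold P. ring. }
    assert (Hh := hpot_pos alpha theta x theta_pos).
    assert (HPh : P x = 1 + hpot alpha theta x) by (now apply pot_hpot).
    assert (Hp54 : 0 < Rpower (P x) (- (5 / 4)) <= 1).
    { apply Rpower_opp_le_1; lra. }
    assert (Hx1 : 0 < / x) by (now apply Rinv_0_lt_compat).
    assert (Hx2 : / x <= / x0) by (apply Rinv_le_contravar; lra).
    assert (Hq : 0 <= alpha * (hpot alpha theta x * / x)).
    { apply Rmult_le_pos; [lra|]. apply Rmult_le_pos; lra. }
    rewrite E, Rabs_Ropp, Rabs_right by (apply Rle_ge, Rmult_le_pos; [lra|]; apply Rmult_le_pos; lra).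
    apply Rle_trans with (alpha * (hpot alpha theta x * / x)); [nra|].
    rewrite Rmult_assoc. apply Rmult_le_compat_l; [lra|]. rewrite (Rmult_comm (/ x0)).
    apply Rmult_le_compat; lra. }
  assert (Hex := exp_pos (sigma * x)).
  split.
  - unfold jost_wave. rewrite !Cmod_mult, Cmod_R, (Rabs_right (bb x)) by lra.
    rewrite (Rmult_comm 2). apply Rmult_le_compat; try apply Cmod_ge_0; [|exact Hw|].
    + apply Rmult_le_pos; [lra|apply Cmod_ge_0].
    + generalize (Cmod_ge_0 (s x)). nra.
  - unfold jost_wave'. rewrite Cmod_mult, Rmult_comm.
    apply Rmult_le_compat; try apply Cmod_ge_0; [|exact Hw].
    apply Cmod_triangle_le.
    rewrite !Rmult_plus_distr_r. rewrite <- Rmult_plus_distr_r. apply Rplus_le_compat.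
    + rewrite Cmod_mult. replace (2 * (alpha * / x0) * P x) with (alpha * / x0 * P x * 2) by ring.
      apply Rmult_le_compat; try apply Cmod_ge_0; assumption.
    + rewrite Cmod_mult, Rmult_comm, Cmod_R, Rabs_right by lra.
      apply Rmult_le_compat; [apply Cmod_ge_0|lra| |exact Hib].
      apply Cmod_triangle_le. rewrite Cmod_opp, !Cmod_mult, Cmod_Ci. fold z.
      rewrite Rmult_1_l. generalize (Cmod_ge_0 (s x)). nra.
Qed.

(* [v] is only known to tend to [0], but then [v'] grows at most polynomially,
   while the Jost wave decays exponentially: the Wronskian vanishes. *)
Lemma decaying_solution_unique (sigma : R) (s r A B u u' v v' : R -> C) :
  sigma < 0 -> is_jost sigma s r A B -> jost_solution sigma s r u u' ->
  ode alpha theta (zeta sigma) v v' -> is_lim (fun x => Cmod (v x)) p_infty 0 ->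
  forall x, (u x0 * v x = v x0 * u x)%C.
Proof.
  intros Hs HJ [Hu Huj] Hv Hlim.
  apply (proportional_of_wronskian_0 alpha theta alpha_pos theta_pos (zeta sigma) x0 v v' u u'); try assumption.
  destruct (jost_wave_decay sigma s r A B (Rlt_le _ _ Hs) HJ) as [K [HK Hdec]].
  apply is_lim_spec in Hlim. destruct (Hlim (mkposreal 1 Rlt_0_1)) as [X HX]. simpl in HX.
  apply Cmod_le_0.
  apply le_epsilon. intros eps He. rewrite Rplus_0_l.
  set (z := Cmod (zeta sigma) * Cmod (zeta sigma)).
  assert (Hz : 0 <= z) by (apply Rmult_le_pos; apply Cmod_ge_0).
  (* The two products in the Wronskian are at most [K] and [2 (2 + z)] times
     [P(x + 1) exp(sigma x)]. Beyond [Rmax x0 (X + 1)] both the Jost formula and [|v| <= 1] hold. *)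
  destruct (pot_exp_decay alpha theta alpha_pos theta_pos sigma (K + 2 * (2 + z)) eps
    (Rmax x0 (X + 1)) Hs ltac:(lra) He) as [x [Hx1 Hx2]].
  specialize (Hx2 x (Rle_refl x)). fold P in Hx2.
  assert (Hx3 : x0 <= x) by (eapply Rle_trans; [apply Rmax_l|exact Hx1]).
  assert (Hx4 : X < x) by (generalize (Rle_trans _ _ _ (Rmax_r x0 (X + 1)) Hx1); lra).
  rewrite (wronskian_constant alpha theta (zeta sigma) v v' u u' Hv Hu x0 x).
  assert (Hv1 : forall y, x <= y <= x + 1 -> Cmod (v y) <= 1).
  { intros y Hy. specialize (HX y ltac:(lra)). rewrite Rminus_0_r in HX.
    generalize (Rle_abs (Cmod (v y))); lra. }
  assert (Hv2 := derivative_bound_of_bounded alpha theta alpha_pos theta_pos (zeta sigma) v v' x Hv Hv1).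
  fold P in Hv2. fold z in Hv2.
  specialize (Hv1 x ltac:(lra)).
  destruct (Huj x Hx3) as [E1 E2]. destruct (Hdec x Hx3) as [D1 D2].
  unfold wronskian. rewrite E1, E2.
  apply Cmod_triangle_le. rewrite Cmod_opp, !Cmod_mult.
  assert (HP1 := pot_ge_1 alpha theta theta_pos (x + 1)). fold P in HP1.
  assert (HPm : P x <= P (x + 1)) by (apply pot_nondecreasing; lra).
  assert (Hex := exp_pos (sigma * x)).
  assert (B1 : Cmod (v x) * Cmod (jost_wave' sigma s r x) <= 1 * (K * P (x + 1) * exp (sigma * x))).
  { apply Rmult_le_compat; try apply Cmod_ge_0; [exact Hv1|]. eapply Rle_trans; [exact D2|].
    apply Rmult_le_compat_r; [lra|]. now apply Rmult_le_compat_l. }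
  assert (B2 : Cmod (v' x) * Cmod (jost_wave sigma s x) <= (2 + z) * P (x + 1) * (2 * exp (sigma * x))).
  { apply Rmult_le_compat; try apply Cmod_ge_0; [|exact D1]. nra. }
  lra.
Qed.

Lemma jost_wave_left_limit (s r : R -> R -> C) :
  left_limit_0 (fun sg => s sg x0) (s 0 x0) -> left_limit_0 (fun sg => r sg x0) (r 0 x0) ->
  left_limit_0 (fun sg => jost_wave sg (s sg) x0) (jost_wave 0 (s 0) x0) /\
  left_limit_0 (fun sg => jost_wave' sg (s sg) (r sg) x0) (jost_wave' 0 (s 0) (r 0) x0).
Proof.
  intros Hs Hr.
  assert (Hw : left_limit_0 (fun sg => wave sg (-1) (ph x0)) (wave 0 (-1) (ph x0))).
  { apply left_limit_0_wave. generalize (phi_ge_id x0); lra. }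
  unfold jost_wave, jost_wave', Cminus. split; apply left_limit_0_mult; try exact Hw.
  - apply left_limit_0_mult; [apply left_limit_0_const|exact Hs].
  - apply left_limit_0_plus; apply left_limit_0_mult; try apply left_limit_0_const; [exact Hs|].
    apply left_limit_0_plus; [exact Hr|].
    intros eps He.
    assert (H : left_limit_0 (fun sg => - RtoC 1 * (Ci * zeta sg * s sg x0))%C (- RtoC 1 * (Ci * zeta 0 * s 0 x0))%C).
    { apply left_limit_0_mult; [apply left_limit_0_const|].
      apply left_limit_0_mult; [|exact Hs].
      apply left_limit_0_mult; [apply left_limit_0_const|apply left_limit_0_zeta]. }
    destruct (H eps He) as [d [Hd H']]. exists d. split; [exact Hd|].
    intros sg H1 H2. specialize (H' sg H1 H2).
    replace (- (Ci * zeta sg * s sg x0) - - (Ci * zeta 0 * s 0 x0))%C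
      with (- RtoC 1 * (Ci * zeta sg * s sg x0) - - RtoC 1 * (Ci * zeta 0 * s 0 x0))%C by ring.
    exact H'.
Qed.

(** The difference of the solutions for [sg] and [0] solves the equation for [sg] with source
    [(1 - zeta^2) P u_0], of size [O(sg)] on a compact interval; the energy estimate carries this
    and the small data at [x0] across the interval. *)
Lemma solutions_converge (u u' : R -> R -> C) (lo hi : R) :
  (forall sg, sg <= 0 -> ode alpha theta (zeta sg) (u sg) (u' sg)) ->
  left_limit_0 (fun sg => u sg x0) (u 0 x0) -> left_limit_0 (fun sg => u' sg x0) (u' 0 x0) ->
  forall eps, 0 < eps -> exists delta, 0 < delta /\
    forall sg, - delta < sg -> sg <= 0 -> forall x, lo <= x <= hi -> Cmod (u sg x - u 0 x)%C <= eps.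
Proof.
  intros Hu H0 H1 eps He.
  set (l := Rmin lo x0). set (h := Rmax hi x0).
  destruct (Rle_dec lo hi) as [Hlh|Hlh].
  2: { exists 1. split; [lra|]. intros; lra. }
  assert (Hl1 : l <= lo) by apply Rmin_l. assert (Hl2 : l <= x0) by apply Rmin_r.
  assert (Hh1 : hi <= h) by apply Rmax_l. assert (Hh2 : x0 <= h) by apply Rmax_r.
  set (ush := fun x => u 0 (l + x)).
  destruct (bounded_on_segment (h - l) ush) as [Bd HBd].
  { lra. }
  { intros x. apply (cont_RC_comp (fun x => l + x) (u 0)).
    - eapply continuous_of_derive. auto_derive; [exact Logic.I|reflexivity].
    - eapply is_derive_RC_continuous. exact (proj1 (Hu 0 (Rle_refl 0) (l + x))). }
  assert (HB : forall x, l <= x <= h -> Cmod (u 0 x) <= Bd).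
  { intros x Hx. generalize (HBd (x - l) ltac:(lra)). unfold ush.
    replace (l + (x - l)) with x by ring. auto. }
  assert (HB0 : 0 <= Bd) by (generalize (HB x0 ltac:(lra)) (Cmod_ge_0 (u 0 x0)); lra).
  set (Ph := P h). assert (HPh : 1 <= Ph) by (now apply pot_ge_1).
  (* Here [|zeta| <= 2] once [|sg| < 1], and [P <= Ph] on the interval. *)
  set (Q := 4 * Ph).
  set (G := exp ((2 + Q) * (h - l))). assert (HG : 0 < G) by apply exp_pos.
  (* The energy at [x0] and the squared source add up to at most [3 * e], which the exponential
     multiplies by at most [G]; the result stays below [eps^2]. *)
  set (e := Rmin 1 (eps * eps / (4 * G))).
  assert (Hee : 0 < eps * eps / (4 * G)) by (apply Rdiv_lt_0_compat; nra).
  assert (Hepos : 0 < e) by (apply Rmin_glb_lt; lra).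
  (* From [|zeta^2 - 1| <= 3 |sg|] the source is at most [3 |sg| Ph Bd], hence at most [e] when
     [|sg| < e / kk]. *)
  set (kk := 3 * Ph * Bd + 1). assert (Hkk : 0 < kk) by (unfold kk; nra).
  destruct (H0 e Hepos) as [d0 [Hd0 D0]]. destruct (H1 e Hepos) as [d1 [Hd1 D1]].
  assert (Hek : 0 < e / kk) by (now apply Rdiv_lt_0_compat).
  exists (Rmin (Rmin d0 d1) (Rmin 1 (e / kk))). split.
  { repeat apply Rmin_glb_lt; lra. }
  intros sg Hsg Hsg0 x Hx.
  assert (Hs1 : - sg < d0 /\ - sg < d1 /\ - sg < 1 /\ - sg < e / kk).
  { generalize (Rmin_l (Rmin d0 d1) (Rmin 1 (e / kk))) (Rmin_r (Rmin d0 d1) (Rmin 1 (e / kk)))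
      (Rmin_l d0 d1) (Rmin_r d0 d1) (Rmin_l 1 (e / kk)) (Rmin_r 1 (e / kk)). lra. }
  destruct Hs1 as [Hs0 [Hs1 [Hs2 Hs3]]]. apply Rlt_div_r in Hs3; [|exact Hkk].
  specialize (D0 sg ltac:(lra) Hsg0). specialize (D1 sg ltac:(lra) Hsg0).
  assert (Hz2 : Cmod (zeta sg) <= 2).
  { unfold zeta. apply Cmod_triangle_le.
    rewrite Cmod_1, Cmod_mult, Cmod_Ci, Cmod_R, Rabs_left1; lra. }
  assert (Hz1 := Cmod_ge_0 (zeta sg)).
  assert (Hzz : Cmod (zeta sg * zeta sg - 1)%C <= 3 * - sg).
  { replace (zeta sg * zeta sg - 1)%C with (Ci * RtoC sg * (zeta sg + 1))%C by (unfold zeta; ring).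
    rewrite !Cmod_mult, Cmod_Ci, Cmod_R, Rabs_left1 by lra.
    assert (Cmod (zeta sg + 1)%C <= 3).
    { apply Cmod_triangle_le. rewrite Cmod_1. lra. }
    generalize (Cmod_ge_0 (zeta sg + 1)%C). nra. }
  set (dl := e).
  assert (HE : energy (u sg x - u 0 x)%C (u' sg x - u' 0 x)%C + dl ^ 2
    <= (energy (u sg x0 - u 0 x0)%C (u' sg x0 - u' 0 x0)%C + dl ^ 2) * exp ((2 + Q) * Rabs (x - x0))).
  { apply (energy_estimate (fun x => u sg x - u 0 x)%C (fun x => u' sg x - u' 0 x)%C
      (fun x => potential_term alpha theta (zeta sg) x * u sg x
        - potential_term alpha theta (zeta 0) x * u 0 x)%C Q dl l h); [unfold Q; lra| |lra|lra].
    intros y Hy. destruct (Hu sg Hsg0 y) as [A1 A2]. destruct (Hu 0 (Rle_refl 0) y) as [B1 B2].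
    split; [now apply is_derive_RC_minus|]. split; [now apply is_derive_RC_minus|].
    replace (potential_term alpha theta (zeta sg) y * u sg y - potential_term alpha theta (zeta 0) y * u 0 y)%C
      with (potential_term alpha theta (zeta sg) y * (u sg y - u 0 y)
        + - ((zeta sg * zeta sg - 1) * RtoC (P y) * u 0 y))%C.
    2: { unfold potential_term. rewrite zeta_0. fold P. ring. }
    assert (HPy : 0 <= P y <= Ph).
    { split; [generalize (pot_ge_1 alpha theta theta_pos y); fold P; lra|].
      apply pot_nondecreasing; lra. }
    apply Cmod_triangle_le.
    rewrite Cmod_opp, !Cmod_mult, Cmod_potential_term, Cmod_R, Rabs_right by (fold P; lra || assumption).
    fold P. apply Rplus_le_compat.
    - apply Rmult_le_compat_r; [apply Cmod_ge_0|]. unfold Q.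
      apply Rmult_le_compat; [nra|lra|nra|lra].
    - specialize (HB y Hy). apply Rle_trans with (3 * - sg * Ph * Bd).
      + apply Rmult_le_compat; try apply Cmod_ge_0; [|apply Rmult_le_compat; try apply Cmod_ge_0; lra|exact HB].
        apply Rmult_le_pos; [apply Cmod_ge_0|lra].
      + unfold dl. unfold kk in Hs3. nra. }
  assert (Hexp : exp ((2 + Q) * Rabs (x - x0)) <= G).
  { unfold G. assert (Rabs (x - x0) <= h - l) by (apply Rabs_le_between; lra).
    apply exp_le_compat, Rmult_le_compat_l; [unfold Q|]; lra. }
  assert (Hsq : forall t, 0 <= t <= e -> t ^ 2 <= e).
  { intros t Ht. assert (e <= 1) by apply Rmin_l. nra. }
  assert (HE0 : energy (u sg x0 - u 0 x0)%C (u' sg x0 - u' 0 x0)%C + dl ^ 2 <= 3 * e).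
  { unfold energy. assert (A1 := Hsq _ (conj (Cmod_ge_0 _) D0)).
    assert (A2 := Hsq _ (conj (Cmod_ge_0 _) D1)). assert (A3 := Hsq e ltac:(lra)). unfold dl. lra. }
  assert (HE1 : energy (u sg x - u 0 x)%C (u' sg x - u' 0 x)%C <= 3 * e * G).
  { apply Rle_trans with (energy (u sg x - u 0 x)%C (u' sg x - u' 0 x)%C + dl ^ 2);
      [generalize (pow2_ge_0 dl); lra|].
    eapply Rle_trans; [exact HE|]. apply Rmult_le_compat; try assumption; [|apply Rlt_le, exp_pos].
    unfold energy. generalize (pow2_ge_0 dl) (pow2_ge_0 (Cmod (u sg x0 - u 0 x0)%C))
      (pow2_ge_0 (Cmod (u' sg x0 - u' 0 x0)%C)). lra. }
  assert (He4 : e <= eps * eps / (4 * G)) by apply Rmin_r.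
  apply Rle_div_r in He4; [|lra].
  unfold energy in HE1. generalize (pow2_ge_0 (Cmod (u' sg x - u' 0 x)%C)); intros Hp.
  generalize (Cmod_ge_0 (u sg x - u 0 x)%C). intros Hc.
  apply Rsqr_incr_0_var; [|lra]. unfold Rsqr. nra.
Qed.

(** Existence: the Jost solutions for [sigma = -1 / (n + 1)] decay and converge to that for [0].
    Uniqueness: any decaying approximants are proportional to the Jost solutions for the same
    [sigma], and the cross-multiplied relation passes to the limit. The factor [u x0] is nonzero
    since [|s - 1| <= 1/2]. *)
Lemma outgoing_characterization (s r A B : R -> C) :
  is_jost 0 s r A B ->
  exists u u' : R -> C, jost_solution 0 s r u u' /\ u x0 <> RtoC 0 /\
    outgoing alpha theta u /\
    forall v, outgoing alpha theta v -> forall x, (u x0 * v x = v x0 * u x)%C.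
Proof.
  intros HJ0.
  (* The choice is forced to return the given data at [sigma = 0], so that the limit of the chosen
     family is the prescribed Jost solution. *)
  assert (Hch : forall sg : R, exists F : (R -> C) * (R -> C) * (R -> C) * (R -> C),
     sg <= 0 -> is_jost sg (fst (fst (fst F))) (snd (fst (fst F))) (snd (fst F)) (snd F) /\
       (sg = 0 -> F = (s, r, A, B))).
  { intros sg. destruct (Req_dec sg 0) as [E|E].
    - exists (s, r, A, B). intros _. split; [rewrite E; exact HJ0|reflexivity].
    - destruct (Rle_dec sg 0) as [H|H].
      + destruct (is_jost_exists sg H) as [s1 [r1 [A1 [B1 H1]]]]. exists (s1, r1, A1, B1).
        intros _. split; [exact H1|]. intros; contradiction.
      + exists (s, r, A, B). intros; contradiction. }
  apply choice in Hch. destruct Hch as [F HF].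
  set (S := fun sg => fst (fst (fst (F sg)))). set (R1 := fun sg => snd (fst (fst (F sg)))).
  set (A1 := fun sg => snd (fst (F sg))). set (B1 := fun sg => snd (F sg)).
  assert (HJ : forall sg, sg <= 0 -> is_jost sg (S sg) (R1 sg) (A1 sg) (B1 sg)).
  { intros sg H. apply (proj1 (HF sg H)). }
  assert (HF0 : F 0 = (s, r, A, B)) by (apply (HF 0); [lra|reflexivity]).
  assert (HS0 : S 0 = s) by (unfold S; rewrite HF0; reflexivity).
  assert (HR0 : R1 0 = r) by (unfold R1; rewrite HF0; reflexivity).
  assert (HJ00 := HJ 0 (Rle_refl 0)).
  assert (Hch : forall sg : R, exists U : (R -> C) * (R -> C),
     sg <= 0 -> jost_solution sg (S sg) (R1 sg) (fst U) (snd U)).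
  { intros sg. destruct (Rle_dec sg 0) as [H|H].
    - destruct (jost_solution_exists sg _ _ _ _ (HJ sg H)) as [u [u' Hu]]. exists (u, u'). auto.
    - exists (s, s). intros; contradiction. }
  apply choice in Hch. destruct Hch as [U HU].
  set (u := fun sg => fst (U sg)). set (u' := fun sg => snd (U sg)).
  assert (Hu : forall sg, sg <= 0 -> ode alpha theta (zeta sg) (u sg) (u' sg)).
  { intros sg H. apply (proj1 (HU sg H)). }
  assert (Huw : forall sg, sg <= 0 -> forall x, x0 <= x -> u sg x = jost_wave sg (S sg) x /\
     u' sg x = jost_wave' sg (S sg) (R1 sg) x).
  { intros sg H. apply (proj2 (HU sg H)). }
  assert (Hcont := jost_continuity ph N a mu half_x0_pos phi_nondecreasing
    ltac:(generalize (phi_ge_id a) half_x0_pos; lra) N_bound mu_small (S 0) (R1 0) (A1 0) (B1 0) HJ00).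
  assert (Hax0 : a <= x0) by (unfold a; lra).
  assert (HlS : left_limit_0 (fun sg => S sg x0) (S 0 x0)).
  { intros e He. destruct (Hcont e He) as [d [Hd H]]. exists d. split; [exact Hd|].
    intros sg H1 H2. apply (H sg _ _ _ _ H1 H2 (HJ sg H2) x0 Hax0). }
  assert (HlR : left_limit_0 (fun sg => R1 sg x0) (R1 0 x0)).
  { intros e He. destruct (Hcont e He) as [d [Hd H]]. exists d. split; [exact Hd|].
    intros sg H1 H2. apply (H sg _ _ _ _ H1 H2 (HJ sg H2) x0 Hax0). }
  destruct (jost_wave_left_limit S R1 HlS HlR) as [Hl1 Hl2].
  assert (Hlu : left_limit_0 (fun sg => u sg x0) (u 0 x0)).
  { intros e He. destruct (Hl1 e He) as [d [Hd H]]. exists d. split; [exact Hd|].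
    intros sg H1 H2. rewrite (proj1 (Huw sg H2 x0 (Rle_refl x0))), (proj1 (Huw 0 (Rle_refl 0) x0 (Rle_refl x0))).
    now apply H. }
  assert (Hlu' : left_limit_0 (fun sg => u' sg x0) (u' 0 x0)).
  { intros e He. destruct (Hl2 e He) as [d [Hd H]]. exists d. split; [exact Hd|].
    intros sg H1 H2. rewrite (proj2 (Huw sg H2 x0 (Rle_refl x0))), (proj2 (Huw 0 (Rle_refl 0) x0 (Rle_refl x0))).
    now apply H. }
  assert (Hconv := fun lo hi => solutions_converge u u' lo hi Hu Hlu Hlu').
  assert (Hnz : u 0 x0 <> RtoC 0).
  { rewrite (proj1 (Huw 0 (Rle_refl 0) x0 (Rle_refl x0))). unfold jost_wave.
    apply Cmult_neq_0; [apply wave_neq_0|]. apply Cmult_neq_0.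
    - intros E. apply RtoC_inj in E. generalize (b_pos alpha theta x0). fold bb. lra.
    - assert (H := jost_amplitude_near_1 ph N a mu half_x0_pos phi_nondecreasing N_bound mu_small
        0 _ _ _ _ (Rle_refl 0) HJ00 x0 Hax0).
      intros E. rewrite E in H. replace (0 - 1)%C with (- RtoC 1)%C in H by ring.
      rewrite Cmod_opp, Cmod_1 in H. lra. }
  exists (u 0), (u' 0). split; [|split; [exact Hnz|split]].
  - assert (H := HU 0 (Rle_refl 0)). rewrite HS0, HR0 in H. exact H.
  - split; [|split].
    + apply (is_solution_ode alpha theta theta_pos). exists (u' 0).
      rewrite <- zeta_0. apply Hu. lra.
    + exists x0. exact Hnz.
    + set (sg := fun n : nat => - / (INR n + 1)).
      assert (Hsg : forall n, sg n < 0).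
      { intros n. unfold sg. assert (0 < / (INR n + 1)) by (apply Rinv_0_lt_compat; generalize (pos_INR n); lra). lra. }
      assert (Hsgl : is_lim_seq sg 0).
      { unfold sg. apply is_lim_seq_spec. intros e.
        destruct (nfloor_ex (/ e)) as [n0 [_ Hn0]]; [apply Rlt_le, Rinv_0_lt_compat, cond_pos|].
        exists n0. intros n Hn. rewrite Rminus_0_r, Rabs_Ropp.
        assert (INR n0 <= INR n) by (now apply le_INR).
        assert (0 < / e) by (apply Rinv_0_lt_compat, cond_pos).
        rewrite Rabs_right by (apply Rle_ge, Rlt_le, Rinv_0_lt_compat; lra).
        rewrite <- (Rinv_inv e). apply Rinv_lt_contravar; [apply Rmult_lt_0_compat|]; lra. }
      exists sg, (fun n => u (sg n)).
      split; [exact Hsg|]. split; [exact Hsgl|]. split; [|split].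
      * intros n. apply (is_solution_ode alpha theta theta_pos).
        exists (u' (sg n)). apply Hu. apply Rlt_le, Hsg.
      * intros lo hi e He. destruct (Hconv lo hi (e / 2) ltac:(lra)) as [d [Hd H]].
        destruct (proj1 (filterlim_locally _ _) Hsgl (mkposreal d Hd)) as [N0 HN0].
        exists N0. intros n Hn x Hx. specialize (HN0 n Hn).
        change (Rabs (sg n - 0) < d) in HN0. rewrite Rminus_0_r, Rabs_left in HN0 by apply Hsg.
        generalize (H (sg n) ltac:(lra) (Rlt_le _ _ (Hsg n)) x Hx). lra.
      * intros n. specialize (Hsg n).
        destruct (jost_wave_decay (sg n) _ _ _ _ (Rlt_le _ _ Hsg) (HJ _ (Rlt_le _ _ Hsg))) as [K [HK Hdec]].
        apply is_lim_spec. intros e.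
        destruct (pot_exp_decay alpha theta alpha_pos theta_pos (sg n) 2 (e / 2) x0 Hsg ltac:(lra)
          ltac:(generalize (cond_pos e); lra)) as [X [HX1 HX2]].
        exists X. intros x Hx. rewrite Rminus_0_r, Rabs_right by (apply Rle_ge, Cmod_ge_0).
        rewrite (proj1 (Huw (sg n) (Rlt_le _ _ Hsg) x ltac:(lra))).
        destruct (Hdec x ltac:(lra)) as [D1 _]. specialize (HX2 x ltac:(lra)).
        assert (HP1 := pot_ge_1 alpha theta theta_pos (x + 1)).
        assert (Hex := exp_pos (sg n * x)). generalize (cond_pos e). nra.
  - intros v [_ [_ [sg [V [Hsg [Hsgl [HV [HVc HVd]]]]]]]] x.
    assert (Hn : forall n, (u (sg n) x0 * V n x = V n x0 * u (sg n) x)%C).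
    { intros n. assert (Hs := Rlt_le _ _ (Hsg n)).
      destruct (proj1 (is_solution_ode alpha theta theta_pos _ _) (HV n)) as [V' HV'].
      apply (decaying_solution_unique (sg n) _ _ _ _ (u (sg n)) (u' (sg n)) (V n) V' (Hsg n)
        (HJ _ Hs) (HU _ Hs) HV' (HVd n)). }
    assert (Hux : forall y, left_limit_0 (fun s => u s y) (u 0 y)).
    { intros y e He. destruct (Hconv y y e He) as [d [Hd H]]. exists d. split; [exact Hd|].
      intros s1 H1 H2. apply H; lra. }
    assert (HVx : forall y e, 0 < e -> exists N0, forall n, (N0 <= n)%nat -> Cmod (V n y - v y)%C <= e).
    { intros y e He. destruct (HVc y y e He) as [N0 H]. exists N0. intros n Hn'.
      apply Rlt_le, H; [exact Hn'|lra]. }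
    assert (Hz : Cmod (u 0 x0 * v x - v x0 * u 0 x)%C <= 0).
    { apply le_epsilon. intros e He. rewrite Rplus_0_l.
      set (C0 := Cmod (u 0 x0) + Cmod (u 0 x) + Cmod (v x) + Cmod (v x0) + 2).
      assert (G1 := Cmod_ge_0 (u 0 x0)). assert (G2 := Cmod_ge_0 (u 0 x)).
      assert (G3 := Cmod_ge_0 (v x)). assert (G4 := Cmod_ge_0 (v x0)).
      assert (HC0 : 0 < C0) by (unfold C0; lra).
      set (e1 := Rmin 1 (e / C0)).
      assert (He1 : 0 < e1) by (apply Rmin_glb_lt; [lra|now apply Rdiv_lt_0_compat]).
      assert (He2 : e1 <= 1) by apply Rmin_l.
      assert (He3 : e1 * C0 <= e) by (apply Rle_div_r; [exact HC0|apply Rmin_r]).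
      destruct (left_limit_0_seq _ _ sg (Hux x0) Hsg Hsgl e1 He1) as [N1 HN1].
      destruct (left_limit_0_seq _ _ sg (Hux x) Hsg Hsgl e1 He1) as [N2 HN2].
      destruct (HVx x e1 He1) as [N3 HN3]. destruct (HVx x0 e1 He1) as [N4 HN4].
      set (n := (N1 + N2 + N3 + N4)%nat).
      specialize (HN1 n ltac:(lia)). specialize (HN2 n ltac:(lia)).
      specialize (HN3 n ltac:(lia)). specialize (HN4 n ltac:(lia)). specialize (Hn n).
      (* Subtracting the vanishing relation between [u (sg n)] and [V n], every remaining term
         contains one of the four small differences. *)
      replace (u 0 x0 * v x - v x0 * u 0 x)%C with
        (- (u (sg n) x0 - u 0 x0) * v x + - (u (sg n) x0 - u 0 x0) * (V n x - v x) - u 0 x0 * (V n x - v x)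
         + ((V n x0 - v x0) * u 0 x + (V n x0 - v x0) * (u (sg n) x - u 0 x) + v x0 * (u (sg n) x - u 0 x)))%C.
      2: { match goal with |- ?L = ?R0 =>
             transitivity (R0 - (u (sg n) x0 * V n x - V n x0 * u (sg n) x))%C; [ring|rewrite Hn; ring] end. }
      set (p1 := (u (sg n) x0 - u 0 x0)%C) in *. set (p2 := (u (sg n) x - u 0 x)%C) in *.
      set (p3 := (V n x - v x)%C) in *. set (p4 := (V n x0 - v x0)%C) in *.
      assert (Q1 := Cmod_ge_0 p1). assert (Q2 := Cmod_ge_0 p2).
      assert (Q3 := Cmod_ge_0 p3). assert (Q4 := Cmod_ge_0 p4).
      assert (T1 : Cmod (- p1 * v x + - p1 * p3 - u 0 x0 * p3)%C <= e1 * (Cmod (v x) + 1 + Cmod (u 0 x0))).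
      { apply Cmod_triangle_le. rewrite Cmod_opp.
        eapply Rle_trans; [apply Rplus_le_compat_r, Cmod_triangle|]. rewrite !Cmod_mult, !Cmod_opp.
        assert (Cmod p1 * Cmod (v x) <= e1 * Cmod (v x)) by (apply Rmult_le_compat_r; lra).
        assert (Cmod p1 * Cmod p3 <= e1 * 1) by (apply Rmult_le_compat; lra).
        assert (Cmod (u 0 x0) * Cmod p3 <= Cmod (u 0 x0) * e1) by (apply Rmult_le_compat_l; lra).
        lra. }
      assert (T2 : Cmod (p4 * u 0 x + p4 * p2 + v x0 * p2)%C <= e1 * (Cmod (u 0 x) + 1 + Cmod (v x0))).
      { apply Cmod_triangle_le.
        eapply Rle_trans; [apply Rplus_le_compat_r, Cmod_triangle|]. rewrite !Cmod_mult.
        assert (Cmod p4 * Cmod (u 0 x) <= e1 * Cmod (u 0 x)) by (apply Rmult_le_compat_r; lra).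
        assert (Cmod p4 * Cmod p2 <= e1 * 1) by (apply Rmult_le_compat; lra).
        assert (Cmod (v x0) * Cmod p2 <= Cmod (v x0) * e1) by (apply Rmult_le_compat_l; lra).
        lra. }
      apply Cmod_triangle_le. unfold C0 in He3. lra. }
    now apply Cmod_minus_le_0.
Qed.

(** * The function [S^>] and the ratio [k] *)

Lemma N_continuous (x : R) : continuous N x.
Proof. now apply M_ext_continuous. Qed.

Lemma ph_continuous (x : R) : continuous ph x.
Proof. now apply phi_continuous. Qed.

Lemma N_eq_M (x : R) : x0 <= x -> N x = M alpha theta x.
Proof. intros H. unfold N. apply M_ext_eq. lra. Qed.

Lemma mu_nonneg : 0 <= mu.
Proof. apply (mu_ge_0 N a mu N_bound). Qed.

Lemma mu_x0_small : 8 * mu * Rpower x0 (- / 2) <= 1.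
Proof.
  eapply Rle_trans; [|exact mu_small]. apply Rmult_le_compat_l; [generalize mu_nonneg; lra|].
  apply Rpower_opp_le; unfold a; lra.
Qed.

Lemma N_mult_bound (f : R -> C) (K x : R) : x0 <= x -> Cmod (f x) <= K ->
  Cmod (RtoC (N x) * f x)%C <= K * mu * Rpower x (- (1 + / 2)).
Proof.
  intros Hx Hf. apply (RtoC_N_mult_bound N a mu N_bound); [|exact Hf]. unfold a; lra.
Qed.

Lemma M_tail_lt_2 : M_tail alpha theta x0 < 2.
Proof.
  destruct (exists_primitive_vanishing (fun x => RtoC (Rabs (N x))) x0 (/ 2) mu) as [H [HH1 HH2]].
  - exact x0_pos.
  - lra.
  - intros y. apply cont_RC_RtoC, (continuous_comp N Rabs); [apply N_continuous|apply continuous_Rabs].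
  - intros x Hx. rewrite Cmod_R, Rabs_Rabsolu. apply N_bound. unfold a; lra.
  - assert (E : M_tail alpha theta x0 = minus 0 (Re (H x0))).
    { apply (is_RInt_gen_unique (V := R_CompleteNormedModule)).
      apply (is_RInt_gen_ext (V := R_CompleteNormedModule) (fun x => Rabs (N x))).
      { apply (Filter_prod _ _ _ (fun u => u = x0) (fun v => x0 < v)).
        - reflexivity.
        - exists x0. intros; assumption.
        - intros u v -> Hv y. simpl. rewrite Rmin_left by lra. intros Hy. rewrite N_eq_M by lra. reflexivity. }
      apply (is_RInt_gen_primitive (V := R_CompleteNormedModule) (fun x => Rabs (N x)) (fun x => Re (H x)));
        [typeclasses eauto|typeclasses eauto| | |].
      - apply (Filter_prod _ _ _ (fun u => u = x0) (fun v => x0 < v)).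
        + reflexivity.
        + exists x0. intros; assumption.
        + intros u v -> Hv y _. split.
          * exact (proj1 (proj1 (is_derive_RC_iff _ _ _) (HH1 y))).
          * apply (continuous_comp N Rabs); [apply N_continuous|apply continuous_Rabs].
      - intros Q HQ. apply (locally_singleton _ _ HQ).
      - apply filterlim_locally. intros eps.
        destruct (HH2 (eps / 2)) as [X HX]; [generalize (cond_pos eps); lra|].
        exists X. intros x Hx. change (Rabs (Re (H x) - 0) < eps). rewrite Rminus_0_r.
        specialize (HX x (Rlt_le _ _ Hx)). generalize (Cmod_Re (H x)) (cond_pos eps). lra. }
    rewrite E. change (minus 0 (Re (H x0))) with (0 - Re (H x0)).
    assert (HB : Cmod (H x0) <= mu / / 2 * Rpower x0 (- / 2)).
    { apply (tail_bound H (fun x => RtoC (Rabs (N x))) x0 (/ 2)); try lra.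
      - intros; apply HH1.
      - intros x Hx. rewrite Cmod_R, Rabs_Rabsolu. apply N_bound. unfold a; lra.
      - exact HH2. }
    generalize mu_x0_small (Cmod_Re (H x0)) (Rle_abs (- Re (H x0))). rewrite Rabs_Ropp.
    replace (mu / / 2) with (2 * mu) in HB by field. lra.
Qed.

Definition extend_left (S : R -> C) (x : R) : C := S (Rmax x x0).

Lemma extend_left_continuous (S : R -> C) :
  @continuous_on R_UniformSpace C_UniformSpace (fun x => x0 <= x) S ->
  forall x, cont_RC (extend_left S) x.
Proof.
  intros HS x. unfold cont_RC, continuous, extend_left.
  apply (filterlim_comp _ _ _ (fun x => Rmax x x0) S _ (within (fun y => x0 <= y) (locally (Rmax x x0)))).
  - intros Q HQ. unfold within in HQ. unfold filtermap.
    generalize (continuous_Rmax x0 x _ HQ). unfold filtermap. apply filter_imp.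
    intros y Hy. apply Hy, Rmax_r.
  - apply (HS (Rmax x x0)), Rmax_r.
Qed.

Lemma S_gt_primitives (S : R -> C) : is_S_gt alpha theta x0 S ->
  exists (K : R) (F G : R -> C),
    (forall x, Cmod (extend_left S x) <= K) /\
    (forall x, is_derive_RC F x (wave 0 2 (ph x) * (RtoC (N x) * extend_left S x))%C) /\
    (forall x, is_derive_RC G x (RtoC (N x) * extend_left S x)%C) /\ vanishes_at_infinity G /\
    forall x, x0 <= x -> S x = (cis (- 2 * ph x) + / (2 * Ci) *
       (cis (- 2 * ph x) * (F x - F x0) - G x))%C.
Proof.
  intros [[K HK] [HS Heq]].
  assert (Hc := extend_left_continuous S HS).
  assert (HK' : forall x, Cmod (extend_left S x) <= K) by (intros x; apply HK, Rmax_r).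
  assert (HNc : forall x, cont_RC (fun x => RtoC (N x) * extend_left S x)%C x).
  { intros x. apply cont_RC_mult; [apply cont_RC_RtoC, N_continuous|apply Hc]. }
  assert (HWc : forall x, cont_RC (fun x => wave 0 2 (ph x) * (RtoC (N x) * extend_left S x))%C x).
  { intros x. apply cont_RC_mult; [apply cont_RC_wave, ph_continuous|apply HNc]. }
  set (F := primitive_RC (fun x => wave 0 2 (ph x) * (RtoC (N x) * extend_left S x))%C).
  assert (HF : forall x, is_derive_RC F x (wave 0 2 (ph x) * (RtoC (N x) * extend_left S x))%C).
  { intros x. now apply is_derive_primitive_RC. }
  destruct (exists_primitive_vanishing (fun x => RtoC (N x) * extend_left S x)%C x0 (/ 2) (K * mu))
    as [G [HG1 HG2]]; [exact x0_pos|lra|exact HNc| |].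
  { intros x Hx. now apply N_mult_bound. }
  exists K, F, G. do 4 (split; [assumption|]).
  intros x Hx. rewrite Heq by exact Hx. fold ph.
  assert (Hext : forall y, x0 <= y -> extend_left S y = S y).
  { intros y Hy. unfold extend_left. now rewrite Rmax_left. }
  rewrite (RInt_RC_ext _ (fun y => cis (- 2 * ph x) * (wave 0 2 (ph y) * (RtoC (N y) * extend_left S y)))%C).
  2: { rewrite Rmin_left, Rmax_right by exact Hx. intros y Hy.
       rewrite Hext, N_eq_M, wave_imag by lra.
       replace (- 2 * (ph x - ph y)) with (- 2 * ph x + 2 * ph y) by ring. rewrite cis_plus. ring. }
  rewrite (RInt_RC_primitive _ (fun y => cis (- 2 * ph x) * F y)%C); [|exact Hx|].
  2: { intros y _. split.
       - eapply is_derive_RC_eq; [apply is_derive_RC_mult; [apply is_derive_RC_const|apply HF]|cbv beta; ring].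
       - apply cont_RC_mult; [apply cont_RC_const|apply HWc]. }
  rewrite (RInt_gen_tail_ext _ (fun y => RtoC (N y) * extend_left S y)%C G).
  - ring.
  - intros y Hy. rewrite Hext, N_eq_M by lra. reflexivity.
  - intros y _. split; [apply HG1|apply HNc].
  - exact HG2.
Qed.

(** The increment from [x0] to [x] and the tail from [x] together are at most [2 L mu x0^(-1/2)],
    because the terms at [x] cancel; halving with [eta = 0] then forces equality. *)
Lemma is_S_gt_unique (S1 S2 : R -> C) : is_S_gt alpha theta x0 S1 -> is_S_gt alpha theta x0 S2 ->
  forall x, x0 <= x -> S1 x = S2 x.
Proof.
  intros H1 H2.
  destruct (S_gt_primitives S1 H1) as [K1 [F1 [G1 [B1 [DF1 [DG1 [V1 E1]]]]]]].
  destruct (S_gt_primitives S2 H2) as [K2 [F2 [G2 [B2 [DF2 [DG2 [V2 E2]]]]]]].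
  assert (Hext : forall S y, x0 <= y -> extend_left S y = S y).
  { intros S y Hy. unfold extend_left. now rewrite Rmax_left. }
  assert (Hmu := mu_nonneg). assert (Hms := mu_x0_small).
  assert (Hz : forall x, x0 <= x -> Cmod (S1 x - S2 x)%C <= 2 * 0).
  { apply (halving_bound (fun x => Cmod (S1 x - S2 x)%C) x0 (K1 + K2)).
    - generalize (B1 x0) (B2 x0) (Cmod_ge_0 (extend_left S1 x0)) (Cmod_ge_0 (extend_left S2 x0)). lra.
    - lra.
    - intros x Hx. apply Cmod_triangle_le. rewrite Cmod_opp.
      rewrite <- (Hext S1), <- (Hext S2) by exact Hx. generalize (B1 x) (B2 x). lra.
    - intros L HL Hb x Hx. rewrite E1, E2 by exact Hx.
      set (dF := fun y => (F1 y - F2 y)%C). set (dG := fun y => (G1 y - G2 y)%C).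
      replace (cis (- 2 * ph x) + / (2 * Ci) * (cis (- 2 * ph x) * (F1 x - F1 x0) - G1 x) -
        (cis (- 2 * ph x) + / (2 * Ci) * (cis (- 2 * ph x) * (F2 x - F2 x0) - G2 x)))%C
        with (/ (2 * Ci) * (cis (- 2 * ph x) * (dF x - dF x0) + - dG x))%C by (unfold dF, dG; ring).
      assert (Hdb : forall y, x0 <= y -> Cmod (RtoC (N y) * (extend_left S1 y - extend_left S2 y))%C
         <= L * mu * Rpower y (- (1 + / 2))).
      { intros y Hy. apply (N_mult_bound (fun y => extend_left S1 y - extend_left S2 y)%C); [exact Hy|].
        rewrite !Hext by exact Hy. now apply Hb. }
      assert (T1 : Cmod (dG x) <= L * mu / / 2 * Rpower x (- / 2)).
      { apply (tail_bound dG (fun y => RtoC (N y) * (extend_left S1 y - extend_left S2 y))%C x0 (/ 2)); try lra.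
        - intros y _. eapply is_derive_RC_eq; [apply is_derive_RC_minus; [apply DG1|apply DG2]|ring].
        - exact Hdb.
        - now apply vanishes_minus. }
      assert (T2 : Cmod (dF x - dF x0)%C
         <= L * mu / / 2 * Rpower x0 (- / 2) - L * mu / / 2 * Rpower x (- / 2)).
      { apply (power_increment_bound dF (fun t => wave 0 2 (ph t) *
          (RtoC (N t) * (extend_left S1 t - extend_left S2 t)))%C); try lra.
        intros t Ht. split.
        - eapply is_derive_RC_eq; [apply is_derive_RC_minus; [apply DF1|apply DF2]|ring].
        - rewrite wave_imag, Cmod_mult, Cmod_cis, Rmult_1_l. apply Hdb. lra. }
      rewrite Cmod_mult, Cmod_inv_two_Ci.
      assert (T3 : Cmod (cis (- 2 * ph x) * (dF x - dF x0) + - dG x)%C <= L * mu / / 2 * Rpower x0 (- / 2)).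
      { apply Cmod_triangle_le. rewrite Cmod_opp, Cmod_mult, Cmod_cis. lra. }
      replace (L * mu / / 2 * Rpower x0 (- / 2)) with (L / 4 * (8 * mu * Rpower x0 (- / 2))) in T3 by field.
      nra. }
  intros x Hx. specialize (Hz x Hx).
  apply Cmod_minus_le_0. lra.
Qed.

Variables s r A B : R -> C.
Hypothesis HJ : is_jost 0 s r A B.

Lemma half_le_x0 : a <= x0.
Proof. unfold a; lra. Qed.

Lemma s_x0_near_1 : Cmod (s x0 - 1)%C <= / 2.
Proof.
  apply (jost_amplitude_near_1 ph N a mu half_x0_pos phi_nondecreasing N_bound mu_small 0 s r A B
    (Rle_refl 0) HJ x0 half_le_x0).
Qed.

Lemma r_x0_bound : Cmod (r x0) <= / 2.
Proof.
  eapply Rle_trans; [apply (jost_r_bound ph N a mu half_x0_pos phi_nondecreasing N_bound 0 s r A B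
    (Rle_refl 0) HJ x0 half_le_x0)|]. generalize mu_x0_small. lra.
Qed.

Lemma s_x0_lower : / 2 <= Cmod (s x0).
Proof.
  assert (H := s_x0_near_1). assert (T := Cmod_triangle (s x0) (- (s x0 - 1))%C).
  replace (s x0 + - (s x0 - 1))%C with (RtoC 1) in T by ring.
  rewrite Cmod_1, Cmod_opp in T. lra.
Qed.

Lemma s_x0_neq_0 : s x0 <> RtoC 0.
Proof. intros E. generalize s_x0_lower. rewrite E, Cmod_0. lra. Qed.

(** By the integral equation of [s] at [x0] this is [1 + A(x0) / (2 i)]: the constant left over when
    the integral of [N s] is taken from [x0], as in the equation of [S^>], in place of infinity. *)
Definition kappa_inv : C := (s x0 - r x0 / (2 * Ci))%C.

Lemma kappa_inv_neq_0 : kappa_inv <> RtoC 0.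
Proof.
  intros E.
  assert (T : Cmod (1 + - (s x0 - 1 + - (r x0 / (2 * Ci))))%C >= 0) by (apply Rle_ge, Cmod_ge_0).
  assert (E1 : RtoC 1 = (- (s x0 - 1) + r x0 * / (2 * Ci))%C).
  { transitivity (kappa_inv - (s x0 - 1) + r x0 * / (2 * Ci))%C; [|rewrite E; ring].
    unfold kappa_inv, Cdiv. ring. }
  assert (H : Cmod (RtoC 1) <= 3 / 4).
  { rewrite E1. apply Cmod_triangle_le.
    rewrite Cmod_opp, Cmod_mult, Cmod_inv_two_Ci. generalize s_x0_near_1 r_x0_bound. lra. }
  rewrite Cmod_1 in H. lra.
Qed.

Definition S_jost (x : R) : C := (/ kappa_inv * (cis (- 2 * ph x) * s x))%C.

Lemma wave_2_0 (e t : R) : wave (2 * 0) e t = cis (e * t).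
Proof. rewrite Rmult_0_r. apply wave_imag. Qed.

Lemma wave_opp_2_0 (e t : R) : wave (- (2 * 0)) e t = cis (e * t).
Proof. replace (- (2 * 0)) with 0 by ring. apply wave_imag. Qed.

Lemma jost_s_eq (x : R) : x0 <= x -> s x = (1 + / (2 * Ci) * (A x + r x))%C.
Proof.
  intros Hx. destruct HJ as [_ [_ [_ [_ [_ [_ [_ H]]]]]]]. rewrite H at 1 by (unfold a; lra).
  rewrite zeta_0. f_equal. f_equal. f_equal. ring.
Qed.

(** In the first integral the phases combine to the constant [exp(-2 i phi(x))], leaving the
    increment of [A]; the tail integral is that of [B], which is [-exp(-2 i phi) r]. The equation
    becomes that of [s] divided by [kappa_inv]. *)
Lemma S_jost_is_S_gt : is_S_gt alpha theta x0 S_jost.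
Proof.
  destruct HJ as [J1 [J2 [J3 [J4 [J5 [J6 [J7 _]]]]]]].
  assert (Hkn := kappa_inv_neq_0).
  assert (Hcis : forall z x, cont_RC (fun y => cis (z * ph y)) x).
  { intros z x. apply (cont_RC_cis (fun y => z * ph y)).
    apply continuous_scal_R, ph_continuous. }
  split; [|split].
  - exists (Cmod (/ kappa_inv)%C * 2). intros x _. unfold S_jost.
    rewrite Cmod_mult, (Cmod_mult (cis _)), Cmod_cis, Rmult_1_l.
    apply Rmult_le_compat_l; [apply Cmod_ge_0|apply J2].
  - intros x _. apply (filterlim_filter_le_1 (F := locally x)).
    + intros Q HQ. unfold within. revert HQ. apply filter_imp. auto.
    + assert (H : cont_RC S_jost x); [|exact H].
      apply cont_RC_mult; [apply cont_RC_const|]. apply cont_RC_mult; [apply Hcis|apply J1].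
  - intros x Hx. fold ph.
    assert (HNc : forall y, cont_RC (fun y => RtoC (N y) * s y)%C y).
    { intros y. apply cont_RC_mult; [apply cont_RC_RtoC, N_continuous|apply J1]. }
    rewrite (RInt_RC_ext _ (fun y => / kappa_inv * cis (- 2 * ph x) * (RtoC (N y) * s y))%C).
    2: { rewrite Rmin_left, Rmax_right by exact Hx. intros y Hy. rewrite N_eq_M by lra.
         unfold S_jost.
         transitivity (M alpha theta y * (/ kappa_inv * s y) * (cis (- 2 * ph y) * cis (- 2 * (ph x - ph y))))%C;
           [ring|].
         rewrite <- cis_plus. replace (- 2 * ph y + - 2 * (ph x - ph y)) with (- 2 * ph x) by ring. ring. }
    rewrite (RInt_RC_primitive _ (fun y => / kappa_inv * cis (- 2 * ph x) * A y)%C); [|exact Hx|].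
    2: { intros y _. split.
         - eapply is_derive_RC_eq; [apply is_derive_RC_mult; [apply is_derive_RC_const|apply J3]|cbv beta; ring].
         - apply cont_RC_mult; [apply cont_RC_const|apply HNc]. }
    rewrite (RInt_gen_tail_ext _ (fun y => / kappa_inv * (wave (2 * 0) (-2) (ph y) * (RtoC (N y) * s y)))%C
      (fun y => / kappa_inv * B y)%C).
    2: { intros y Hy. rewrite N_eq_M, wave_2_0 by lra. unfold S_jost. ring. }
    2: { intros y _. split.
         - eapply is_derive_RC_eq; [apply is_derive_RC_mult; [apply is_derive_RC_const|apply J5]|cbv beta; ring].
         - apply cont_RC_mult; [apply cont_RC_const|].
           apply cont_RC_mult; [apply cont_RC_wave, ph_continuous|apply HNc]. }
    2: { now apply vanishes_scal. }
    assert (HB : B x = (- (cis (- 2 * ph x) * r x))%C).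
    { rewrite J7, wave_opp_2_0.
      transitivity (cis (- 2 * ph x) * cis (2 * ph x) * B x)%C; [|ring].
      rewrite <- cis_plus. replace (- 2 * ph x + 2 * ph x) with 0 by ring. rewrite cis_0. ring. }
    rewrite HB. unfold S_jost. rewrite (jost_s_eq x Hx).
    assert (Hk : kappa_inv = (1 + / (2 * Ci) * A x0)%C).
    { unfold kappa_inv. rewrite (jost_s_eq x0) by lra. unfold Cdiv. ring. }
    set (e := cis (- 2 * ph x)). set (h := (/ (2 * Ci))%C) in *. set (k1 := kappa_inv) in *.
    transitivity (/ k1 * k1 * e + h * (/ k1 * e * (A x - A x0) + / k1 * e * r x))%C.
    + rewrite Hk at 3. ring.
    + rewrite Cinv_l by exact Hkn. ring.
Qed.

Lemma S_gt_spec : forall x, x0 <= x -> S_gt alpha theta x0 x = S_jost x.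
Proof.
  apply is_S_gt_unique; [|apply S_jost_is_S_gt].
  unfold S_gt. apply epsilon_spec. exists S_jost. apply S_jost_is_S_gt.
Qed.

(** At [x = x0] the first integral is empty, so the equation of [S^>] expresses [R_tail] through the
    value of [S^>] at [x0]. *)
Lemma R_tail_eq : R_tail alpha theta x0 = (cis (- 2 * ph x0) * (s x0 / kappa_inv - 1))%C.
Proof.
  assert (HS : is_S_gt alpha theta x0 (S_gt alpha theta x0)).
  { unfold S_gt. apply epsilon_spec. exists S_jost. apply S_jost_is_S_gt. }
  destruct HS as [_ [_ Heq]]. specialize (Heq x0 (Rle_refl x0)).
  rewrite S_gt_spec in Heq by lra.
  assert (H0 : RInt_RC (fun y => RtoC (M alpha theta y) * S_gt alpha theta x0 y *
     cis (- 2 * (phi alpha theta x0 - phi alpha theta y)))%C x0 x0 = RtoC 0).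
  { apply (@RInt_point C_R_CompleteNormedModule). }
  rewrite H0 in Heq. unfold R_tail.
  transitivity (S_jost x0 - cis (- 2 * ph x0))%C.
  - rewrite Heq. fold ph. ring.
  - unfold S_jost. fold ph. unfold Cdiv. ring.
Qed.

(** Logarithmic derivative of [s] in [t], divided by [i]: the one number through which the region
    beyond [x0] enters [q] and [R_tail]. *)
Definition xi : C := (r x0 / (Ci * s x0))%C.

Lemma Cmod_xi : Cmod xi <= 2 * Cmod (r x0).
Proof.
  unfold xi, Cdiv. rewrite Cmod_mult, Cmod_inv, Cmod_mult, Cmod_Ci, Rmult_1_l.
  - assert (H := s_x0_lower). rewrite Rmult_comm. apply Rmult_le_compat_r; [apply Cmod_ge_0|].
    rewrite <- (Rinv_inv 2). apply Rinv_le_contravar; lra.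
  - apply Cmult_neq_0; [apply Ci_neq_0|apply s_x0_neq_0].
Qed.

Lemma kappa_inv_xi : kappa_inv = (s x0 * (2 - xi) / 2)%C.
Proof.
  unfold kappa_inv, xi. field. split; [apply s_x0_neq_0|apply Ci_neq_0].
Qed.

Lemma two_minus_xi_neq_0 : (2 - xi)%C <> RtoC 0.
Proof.
  intros E. apply kappa_inv_neq_0. rewrite kappa_inv_xi, E. unfold Cdiv. ring.
Qed.

Lemma R_tail_xi : R_tail alpha theta x0 = (cis (- 2 * ph x0) * (xi / (2 - xi)))%C.
Proof.
  rewrite R_tail_eq, kappa_inv_xi. f_equal. field.
  split; [apply two_minus_xi_neq_0|apply s_x0_neq_0].
Qed.

Lemma q_den_eq : q_den alpha theta x0 = (cis (- ph x0) * (2 / (2 - xi)))%C.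
Proof.
  unfold q_den. rewrite R_tail_xi. fold ph.
  transitivity (cis (- 2 * ph x0) * cis (ph x0) * (xi / (2 - xi)) + cis (- ph x0))%C; [ring|].
  rewrite <- cis_plus. replace (- 2 * ph x0 + ph x0) with (- ph x0) by ring.
  field. apply two_minus_xi_neq_0.
Qed.

Lemma q_num_eq : q_num alpha theta x0 = (cis (- ph x0) * ((2 * xi - 2) / (2 - xi)))%C.
Proof.
  unfold q_num. rewrite R_tail_xi. fold ph.
  transitivity (cis (- 2 * ph x0) * cis (ph x0) * (xi / (2 - xi)) - cis (- ph x0))%C; [ring|].
  rewrite <- cis_plus. replace (- 2 * ph x0 + ph x0) with (- ph x0) by ring.
  field. apply two_minus_xi_neq_0.
Qed.

Lemma q_den_neq_0 : q_den alpha theta x0 <> RtoC 0.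
Proof.
  rewrite q_den_eq. apply Cmult_neq_0; [apply cis_neq_0|].
  intros E. apply two_neq_0. transitivity (2 / (2 - xi) * (2 - xi))%C.
  - field. apply two_minus_xi_neq_0.
  - rewrite E. ring.
Qed.

Lemma q_xi : q alpha theta x0 = (xi - 1)%C.
Proof.
  unfold q. rewrite q_num_eq, q_den_eq. field.
  split; [apply two_minus_xi_neq_0|apply cis_neq_0].
Qed.

(** Numerator of [k] once [q = xi - 1] is inserted; the denominator is [2 - psi], so smallness of
    [psi] makes [k] defined and small. *)
Definition psi : C := (xi - Ci * RtoC (bb' alpha theta x0))%C.

Lemma k_den_eq : k_den alpha theta x0 = (2 - psi)%C.
Proof. unfold k_den. rewrite q_xi. unfold psi. ring. Qed.

Lemma k_num_eq : k_num alpha theta x0 = psi.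
Proof. unfold k_num. rewrite q_xi. unfold psi. ring. Qed.

Lemma k_eq : k alpha theta x0 = (cis (- 2 * ph x0) * (psi / (2 - psi)))%C.
Proof. unfold k. now rewrite k_num_eq, k_den_eq. Qed.

(** The two amplitudes share the factor [b s / 2], so their quotient is [k]: this identifies the
    number defined through [S^>] with boundary data of the outgoing solution. *)
Lemma jost_amplitudes (u u' : R -> C) :
  jost_solution 0 s r u u' ->
  amp_gt alpha theta u u' x0 = (RtoC (b alpha theta x0) * s x0 / 2 * (2 - psi))%C /\
  amp_lt alpha theta u u' x0 = (RtoC (b alpha theta x0) * s x0 / 2 * (cis (- 2 * ph x0) * psi))%C.
Proof.
  intros [_ Hu]. destruct (Hu x0 (Rle_refl x0)) as [U1 U2].
  unfold amp_gt, amp_lt. rewrite U1, U2. unfold jost_wave, jost_wave'. fold ph.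
  assert (Hb := b_pos alpha theta x0).
  assert (Ho : sqrt (pot alpha theta x0) = / b alpha theta x0 * / b alpha theta x0) by apply bb_inv_om.
  cbv beta. rewrite Ho, Rinv_mult, Rinv_inv, zeta_0. unfold bb.
  rewrite !wave_imag. replace (-1 * ph x0) with (- ph x0) by ring.
  unfold psi, xi. rewrite bb'_eq by assumption. rewrite !RtoC_mult.
  replace (- 2 * ph x0) with (- ph x0 + - ph x0) by ring. rewrite cis_plus.
  rewrite RtoC_inv by lra.
  assert (Hc := cis_mult_opp (ph x0)).
  assert (Hbn : RtoC (b alpha theta x0) <> RtoC 0) by (intros E; apply RtoC_inj in E; lra).
  assert (Hii := Ci_sqr).
  assert (HCi : (/ Ci = - Ci)%C).
  { transitivity (/ Ci * (- (Ci * Ci)))%C; [rewrite Hii; ring|]. field. apply Ci_neq_0. }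
  assert (Hs := s_x0_neq_0).
  set (e := cis (ph x0)) in *. set (f := cis (- ph x0)) in *. set (be := RtoC (b alpha theta x0)) in *.
  set (d := RtoC (db alpha theta x0)).
  assert (Hxi : (r x0 / (Ci * s x0) = - (Ci * (r x0 / s x0)))%C).
  { transitivity (/ Ci * (r x0 / s x0))%C; [field; split; [exact Hs|apply Ci_neq_0]|rewrite HCi; ring]. }
  rewrite Hxi. split.
  - transitivity (e * f * (/ 2 * be * (s x0 + Ci * (be * d * s x0) + Ci * r x0 - (Ci * Ci) * s x0)))%C;
      [field; exact Hbn|].
    rewrite Hc, Hii. field. exact Hs.
  - transitivity (f * f * (/ 2 * be * (s x0 - Ci * (be * d * s x0) - Ci * r x0 + (Ci * Ci) * s x0)))%C;
      [field; exact Hbn|].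
    rewrite Hii. field. exact Hs.
Qed.

(** * The Volterra solution and the reflection coefficient *)

Let ps := psi.
Let x_i := xi.
Let vs := V_size alpha theta x0.
Let kk := k alpha theta x0.

Hypothesis psi_small : Cmod ps <= / 2.
(** The Volterra solution stays within [4 * vs] of its data; this keeps its first component within
    [1/2] of [1], hence away from [0]. *)
Hypothesis size_small : 8 * vs <= 1.

Lemma two_minus_lower (z : C) : Cmod z <= / 2 -> 1 <= Cmod (2 - z)%C.
Proof.
  intros Hz. assert (T := Cmod_triangle (2 - z)%C z).
  replace (2 - z + z)%C with (RtoC 2) in T by ring.
  rewrite Cmod_R, Rabs_right in T by lra. lra.
Qed.

Lemma two_minus_neq_0 (z : C) : Cmod z <= / 2 -> (2 - z)%C <> RtoC 0.
Proof. intros Hz E. generalize (two_minus_lower z Hz). rewrite E, Cmod_0. lra. Qed.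

Lemma k_defined_small : k_defined alpha theta x0.
Proof.
  split; [|split].
  - apply M_tail_lt_2.
  - apply q_den_neq_0.
  - rewrite k_den_eq.
    now apply two_minus_neq_0.
Qed.

Lemma Cmod_k_le : Cmod kk <= Cmod ps.
Proof.
  unfold kk. rewrite k_eq.
  fold ps. rewrite Cmod_mult, Cmod_cis, Rmult_1_l. unfold Cdiv.
  rewrite Cmod_mult, Cmod_inv by now apply two_minus_neq_0.
  assert (H := two_minus_lower ps psi_small).
  assert (/ Cmod (2 - ps)%C <= 1) by (rewrite <- Rinv_1; apply Rinv_le_contravar; lra).
  generalize (Cmod_ge_0 ps). nra.
Qed.

Definition constant_data : R -> C * C := fun _ => (RtoC 1, kk).

Let F := Id_sub_V_inv alpha theta x0 constant_data.

Lemma vs_pos : 0 < vs.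
Proof. now apply V_size_pos. Qed.

Lemma size_small_4 : 4 * vs <= 1.
Proof. generalize vs_pos. lra. Qed.

Lemma constant_data_continuous : continuous_seg x0 constant_data.
Proof.
  intros x _. unfold constant_data.
  apply (filterlim_const (F := within (fun x => 0 <= x <= x0) (locally x))).
Qed.

Lemma Id_sub_V_inv_solves : solves_Id_sub_V alpha theta x0 constant_data F.
Proof.
  unfold F, Id_sub_V_inv. apply epsilon_spec.
  destruct (Id_sub_V_invertible_small alpha theta x0 alpha_pos theta_pos x0_pos size_small_4
    constant_data constant_data_continuous) as [H _]. exact H.
Qed.

Lemma Id_sub_V_inv_bound (x : R) : 0 <= x <= x0 -> Cmod (fst (F x)) <= 2 /\ Cmod (snd (F x)) <= 2.
Proof.
  intros Hx.
  destruct (solves_Id_sub_V_exists alpha theta x0 alpha_pos theta_pos x0_pos size_small_4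
    constant_data 1 constant_data_continuous ltac:(lra)) as [G [HG HGb]].
  { intros [j y]. unfold components, constant_data. simpl. destruct j.
    - rewrite Cmod_1. lra.
    - generalize Cmod_k_le. lra. }
  rewrite (solves_Id_sub_V_unique alpha theta x0 alpha_pos theta_pos x0_pos size_small_4
    constant_data F G Id_sub_V_inv_solves HG x Hx).
  specialize (HGb x Hx). lra.
Qed.

Let f := components x0 F.

Lemma Id_sub_V_inv_continuous (j : bool) (x : R) : cont_RC (fun y => f (j, y)) x.
Proof. apply components_continuous; [exact x0_pos|apply Id_sub_V_inv_solves]. Qed.

Lemma Id_sub_V_inv_components (x : R) : 0 <= x <= x0 -> F x = (f (true, x), f (false, x)).
Proof. apply components_eq. Qed.

Lemma Id_sub_V_inv_eq (x : R) : 0 <= x <= x0 ->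
  F x = ((1 + V_components alpha theta x0 f (true, x))%C, (kk + V_components alpha theta x0 f (false, x))%C).
Proof.
  intros Hx. destruct Id_sub_V_inv_solves as [_ H]. rewrite (H x Hx).
  rewrite (V_eq_components alpha theta x0 alpha_pos theta_pos x0_pos F f x Hx).
  - reflexivity.
  - intros y Hy. apply Id_sub_V_inv_components. lra.
  - apply Id_sub_V_inv_continuous.
Qed.

Lemma V_components_Id_sub_V_inv_bound (jx : bool * R) : Cmod (V_components alpha theta x0 f jx) <= 4 * vs.
Proof.
  set (z := fun _ : bool * R => RtoC 0).
  assert (Hz : V_components alpha theta x0 z jx = RtoC 0).
  { unfold V_components. apply (V_prim_zero_diff alpha theta x0 alpha_pos theta_pos).
    - intros y. destruct (fst jx); unfold V_gt_row, V_lt_row, z; ring.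
    - apply clamp_range; lra. }
  replace (V_components alpha theta x0 f jx)
    with (V_components alpha theta x0 f jx - V_components alpha theta x0 z jx)%C
    by (rewrite Hz; ring).
  replace (4 * vs) with (2 * 2 * vs) by ring.
  apply V_components_diff; try assumption.
  - apply Id_sub_V_inv_continuous.
  - intros; apply cont_RC_const.
  - intros j x Hx. unfold z. replace (f (j, x) - 0)%C with (f (j, x)) by ring.
    generalize (Id_sub_V_inv_bound x Hx). rewrite (Id_sub_V_inv_components x Hx). simpl. destruct j; tauto.
Qed.

Lemma Id_sub_V_inv_near_data (x : R) : 0 <= x <= x0 ->
  Cmod (f (true, x) - 1)%C <= 4 * vs /\ Cmod (f (false, x) - kk)%C <= 4 * vs.
Proof.
  intros Hx. assert (E := Id_sub_V_inv_eq x Hx). rewrite (Id_sub_V_inv_components x Hx) in E. injection E as E1 E2.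
  rewrite E1, E2. split.
  - replace (1 + V_components alpha theta x0 f (true, x) - 1)%C
      with (V_components alpha theta x0 f (true, x)) by ring. apply V_components_Id_sub_V_inv_bound.
  - replace (kk + V_components alpha theta x0 f (false, x) - kk)%C
      with (V_components alpha theta x0 f (false, x)) by ring. apply V_components_Id_sub_V_inv_bound.
Qed.

Lemma fst_Id_sub_V_inv_0_lower : / 2 <= Cmod (fst (F 0)).
Proof.
  rewrite (Id_sub_V_inv_components 0) by lra. simpl.
  destruct (Id_sub_V_inv_near_data 0 ltac:(lra)) as [H _].
  assert (T := Cmod_triangle (f (true, 0)) (- (f (true, 0) - 1))%C).
  replace (f (true, 0) + - (f (true, 0) - 1))%C with (RtoC 1) in T by ring.
  rewrite Cmod_1, Cmod_opp in T. lra.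
Qed.

Lemma fst_Id_sub_V_inv_0_neq_0 : fst (F 0) <> RtoC 0.
Proof. intros E. generalize fst_Id_sub_V_inv_0_lower. rewrite E, Cmod_0. lra. Qed.

Lemma amp_scal (z : C) (u u' : R -> C) (x : R) :
  amp_gt alpha theta (fun y => z * u y)%C (fun y => z * u' y)%C x = (z * amp_gt alpha theta u u' x)%C /\
  amp_lt alpha theta (fun y => z * u y)%C (fun y => z * u' y)%C x = (z * amp_lt alpha theta u u' x)%C.
Proof. unfold amp_gt, amp_lt. split; ring. Qed.

(** Divided by its first amplitude [w] at [x0], the outgoing solution has boundary data [(1, k)];
    its amplitudes then solve the same Volterra equation as [F], and uniqueness identifies them. *)
Lemma jost_amplitudes_at_0 (u u' : R -> C) : jost_solution 0 s r u u' ->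
  exists w, w <> RtoC 0 /\ amp_gt alpha theta u u' 0 = (w * fst (F 0))%C /\
    amp_lt alpha theta u u' 0 = (w * snd (F 0))%C.
Proof.
  intros Hu.
  destruct (jost_amplitudes u u' Hu) as [G1 G2]. fold ps ph in G1, G2.
  set (w := amp_gt alpha theta u u' x0).
  assert (Hps := two_minus_neq_0 ps psi_small).
  assert (Hw : w <> RtoC 0).
  { unfold w. rewrite G1. apply Cmult_neq_0; [|exact Hps].
    assert (H1 := s_x0_neq_0).
    assert (H2 : RtoC (b alpha theta x0) <> RtoC 0).
    { intros E. apply RtoC_inj in E. generalize (b_pos alpha theta x0). lra. }
    intros E. apply (Cmult_neq_0 _ _ H2 H1).
    transitivity (2 * (RtoC (b alpha theta x0) * s x0 / 2))%C; [field|]. rewrite E. ring. }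
  assert (Hk : amp_lt alpha theta u u' x0 = (w * kk)%C).
  { unfold w. rewrite G1, G2. unfold kk.
    rewrite k_eq.
    fold ps ph. field. exact Hps. }
  set (v := fun y => (/ w * u y)%C). set (v' := fun y => (/ w * u' y)%C).
  destruct Hu as [Hu _].
  assert (Hv : forall x, is_derive_RC v x (v' x) /\ is_derive_RC v' x (- (RtoC (P x) * v x))%C).
  { intros x. destruct (Hu x) as [D1 D2]. split.
    - eapply is_derive_RC_eq; [apply is_derive_RC_mult; [apply is_derive_RC_const|exact D1]|].
      unfold v'. ring.
    - eapply is_derive_RC_eq; [apply is_derive_RC_mult; [apply is_derive_RC_const|exact D2]|].
      unfold potential_term. rewrite zeta_0. fold P. unfold v. ring. }
  set (G := fun x => (amp_gt alpha theta v v' x, amp_lt alpha theta v v' x)).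
  assert (HG : solves_Id_sub_V alpha theta x0 constant_data G).
  { split.
    - apply (continuous_seg_of_components x0 (fun jx : bool * R =>
        if fst jx then amp_gt alpha theta v v' (snd jx) else amp_lt alpha theta v v' (snd jx))).
      intros j x.
      destruct (amplitudes_continuous alpha theta alpha_pos theta_pos v v' x
        (is_derive_RC_continuous _ _ _ (proj1 (Hv x))) (is_derive_RC_continuous _ _ _ (proj2 (Hv x))))
        as [C1 C2]. destruct j; [exact C1|exact C2].
    - intros x Hx.
      rewrite (solution_amplitudes alpha theta alpha_pos theta_pos x0 v v' G x0_pos Hv (fun _ _ => eq_refl) x Hx).
      f_equal. unfold G, constant_data, v, v'.
      destruct (amp_scal (/ w)%C u u' x0) as [-> ->]. rewrite Hk. fold w.
      f_equal; field; exact Hw. }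
  assert (E := solves_Id_sub_V_unique alpha theta x0 alpha_pos theta_pos x0_pos size_small_4
    constant_data F G Id_sub_V_inv_solves HG 0 ltac:(lra)).
  exists w. split; [exact Hw|]. rewrite E. unfold G, v, v'. simpl.
  destruct (amp_scal (/ w)%C u u' 0) as [-> ->]. split; field; exact Hw.
Qed.

(** On the negative axis [w^>] is [exp(-i x)] and [w^<] is [exp(i x)], so [A] is the amplitude along
    [w^<]; hence the second component is the numerator of [R]. The identity follows from equality of
    Cauchy data at [0]. *)
Lemma free_region (u u' : R -> C) : ode alpha theta 1%C u u' -> forall x, x < 0 ->
  u x = (amp_lt alpha theta u u' 0 * cis x + amp_gt alpha theta u u' 0 * cis (- x))%C.
Proof.
  intros Hu x Hx.
  set (a1 := amp_lt alpha theta u u' 0). set (a2 := amp_gt alpha theta u u' 0).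
  set (e := fun y => (a1 * cis y + a2 * cis (- y))%C).
  set (e' := fun y => (Ci * (a1 * cis y - a2 * cis (- y)))%C).
  assert (Hii := Ci_sqr).
  assert (D1 : forall y, is_derive_RC (fun y => cis y) y (Ci * cis y)%C).
  { intros y. eapply is_derive_RC_eq.
    - apply (is_derive_RC_cis (fun y => y) y 1). apply @is_derive_id.
    - ring. }
  assert (D2 : forall y, is_derive_RC (fun y => cis (- y)) y (- (Ci * cis (- y)))%C).
  { intros y. eapply is_derive_RC_eq.
    - apply (is_derive_RC_cis (fun y => - y) y (- 1)). auto_derive; [exact Logic.I|ring].
    - replace (RtoC (- 1)) with (- RtoC 1)%C by (apply C_eta; simpl; ring). ring. }
  destruct (amplitudes_wave_pair alpha theta theta_pos u u' 0) as [W1 W2].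
  assert (P0 : sqrt (pot alpha theta 0) = 1) by (rewrite pot_nonpos by lra; apply sqrt_1).
  cbv beta in W2. rewrite P0 in W2. rewrite phi_0, Ropp_0, cis_0 in W1, W2.
  apply (ode_unique_on alpha theta alpha_pos theta_pos 1%C x 0 0 u u' e e'); try lra.
  - intros y _. apply Hu.
  - intros y Hy. split.
    + eapply is_derive_RC_eq.
      * apply is_derive_RC_plus; (apply is_derive_RC_mult; [apply is_derive_RC_const|]); [apply D1|apply D2].
      * unfold e'. cbv beta. ring.
    + eapply is_derive_RC_eq.
      * apply is_derive_RC_mult; [apply is_derive_RC_const|].
        apply is_derive_RC_minus; (apply is_derive_RC_mult; [apply is_derive_RC_const|]); [apply D1|apply D2].
      * unfold potential_term, e. cbv beta. rewrite pot_nonpos by lra.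
        transitivity (Ci * Ci * (a1 * cis y + a2 * cis (- y)))%C; [ring|]. rewrite Hii. ring.
  - rewrite W1. unfold e. rewrite Ropp_0, cis_0. unfold a1, a2. ring.
  - rewrite W2. unfold e'. rewrite Ropp_0, cis_0. unfold a1, a2. ring.
Qed.

Lemma reflection_coefficient_unique :
  unique (is_reflection_coefficient alpha theta) (snd (F 0) / fst (F 0))%C.
Proof.
  destruct (outgoing_characterization s r A B HJ) as [u [u' [Hu [Hnz [Hout Hchar]]]]].
  destruct (jost_amplitudes_at_0 u u' Hu) as [w [Hw [E1 E2]]].
  assert (HF := fst_Id_sub_V_inv_0_neq_0).
  assert (Hode : ode alpha theta 1%C u u').
  { destruct Hu as [Hu _]. rewrite zeta_0 in Hu. exact Hu. }
  assert (Hfree := free_region u u' Hode). rewrite E1, E2 in Hfree.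
  split.
  - exists u, (w * snd (F 0))%C, (w * fst (F 0))%C.
    split; [exact Hout|]. split; [exact Hfree|]. split; [now apply Cmult_neq_0|].
    field. split; assumption.
  - intros rr [v [Av [Bv [Hv [Hvf [HB ->]]]]]].
    assert (Hpr : forall x, v x = (v x0 / u x0 * u x)%C).
    { intros x. transitivity (/ u x0 * (u x0 * v x))%C; [field; exact Hnz|].
      rewrite (Hchar v Hv x). field. exact Hnz. }
    set (l := (v x0 / u x0)%C) in *.
    destruct (plane_waves_independent Av Bv (l * (w * snd (F 0)))%C (l * (w * fst (F 0)))%C) as [EA EB].
    { intros x Hx. rewrite <- (Hvf x Hx), Hpr, (Hfree x Hx). ring. }
    assert (Hl : l <> RtoC 0) by (intros El; apply HB; rewrite EB, El; ring).
    rewrite EA, EB. field. repeat split; assumption.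
Qed.

(** * First order expansion of the reflection coefficient *)

Definition born_integral : C :=
  RInt_gen_RC (fun y => RtoC (Derive (b alpha theta) y / b alpha theta y) * cis (- 2 * ph y))%C
    (at_right 0) (at_point x0).

Let e (y : R) : C := cis (- 2 * ph y).

Lemma e_continuous (x : R) : cont_RC e x.
Proof.
  apply (cont_RC_cis (fun y => - 2 * ph y)).
  apply continuous_scal_R. now apply phi_continuous.
Qed.

(** The sign in [b' / b = - V_weight] reverses the orientation: the integral from [0] to [x0] is the
    second component at [0] of [V] applied to the constant [(1, 0)]. *)
Lemma born_integral_eq : born_integral = (V_prim alpha theta e 0 - V_prim alpha theta e x0)%C.
Proof.
  assert (Hw : forall y, 0 < y -> RtoC (Derive (b alpha theta) y / b alpha theta y) = (- RtoC (V_weight alpha theta y))%C).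
  { intros y Hy. rewrite Derive_b, db_over_b, RtoC_opp by assumption. reflexivity. }
  unfold born_integral.
  rewrite (RInt_gen_at_right_primitive x0 _ (fun y => - V_prim alpha theta e y)%C x0_pos).
  - ring.
  - intros y Hy. split.
    + eapply is_derive_RC_eq.
      * apply is_derive_RC_opp. apply is_derive_V_prim; [exact alpha_pos|exact theta_pos|apply e_continuous|exact Hy].
      * rewrite Hw by exact Hy. unfold e. ring.
    + apply (cont_RC_ext_loc (fun y => - (RtoC (V_weight alpha theta y) * e y))%C).
      * generalize (locally_gt 0 y Hy). apply filter_imp. intros t Ht. rewrite Hw by exact Ht. unfold e. ring.
      * apply cont_RC_opp, cont_RC_mult; [apply cont_RC_RtoC; now apply V_weight_continuous|apply e_continuous].
  - apply cont_RC_opp. apply V_prim_continuous; [exact alpha_pos|exact theta_pos|apply e_continuous].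
Qed.

Lemma Cmod_born_integral : Cmod born_integral <= vs.
Proof.
  rewrite born_integral_eq.
  assert (Hz := V_prim_zero_diff alpha theta x0 alpha_pos theta_pos (fun _ => RtoC 0) 0
    (fun _ => eq_refl) ltac:(lra)).
  replace (V_prim alpha theta e 0 - V_prim alpha theta e x0)%C
    with (V_prim alpha theta e 0 - V_prim alpha theta e x0 -
      (V_prim alpha theta (fun _ => RtoC 0) 0 - V_prim alpha theta (fun _ => RtoC 0) x0))%C
    by (rewrite Hz; ring).
  replace vs with (1 * vs) by ring.
  apply V_prim_diff_bound; try assumption; try lra.
  - apply e_continuous.
  - intros; apply cont_RC_const.
  - intros x _. replace (e x - 0)%C with (e x) by ring. unfold e. rewrite Cmod_cis. lra.
Qed.

(** Replacing the solution by [(1, 0)] inside [V] costs [|f_1 - 1| + |f_2|], at most [4 vs] plus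
    [4 vs + |k|], times the mass [vs]. *)
Lemma snd_Id_sub_V_inv_0_estimate :
  Cmod (snd (F 0) - (kk + born_integral))%C <= (8 * vs + Cmod ps) * vs.
Proof.
  rewrite (Id_sub_V_inv_eq 0) by lra. simpl. unfold V_components. simpl. rewrite clamp_id by lra.
  rewrite born_integral_eq.
  set (h := V_lt_row alpha theta f).
  match goal with |- Cmod (kk + ?p - (kk + ?p'))%C <= _ =>
    replace (kk + p - (kk + p'))%C with (p - p')%C by ring end.
  apply V_prim_diff_bound; try assumption; try lra.
  - intros x. apply (proj2 (V_rows_continuous alpha theta alpha_pos theta_pos f x (fun j => Id_sub_V_inv_continuous j x))).
  - apply e_continuous.
  - intros x Hx. unfold h, V_lt_row. fold ph. fold (e x).
    destruct (Id_sub_V_inv_near_data x Hx) as [H1 H2].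
    replace (e x * f (true, x) - f (false, x) - e x)%C
      with (e x * (f (true, x) - 1) + - (f (false, x) - kk + kk))%C by ring.
    apply Cmod_triangle_le. rewrite Cmod_opp, Cmod_mult. unfold e. rewrite Cmod_cis.
    generalize (Cmod_triangle (f (false, x) - kk)%C kk) Cmod_k_le. lra.
Qed.

Lemma reflection_first_order :
  Cmod (snd (F 0) / fst (F 0) - (kk + born_integral))%C
  <= 2 * ((8 * vs + Cmod ps) * vs + (Cmod ps + vs) * (4 * vs)).
Proof.
  assert (HF := fst_Id_sub_V_inv_0_neq_0).
  (* The identity [n / d - m = (n - m - m (d - 1)) / d] with [|1 / d| <= 2]: both terms in the
     numerator are of second order. *)
  replace (snd (F 0) / fst (F 0) - (kk + born_integral))%C
    with ((snd (F 0) - (kk + born_integral) - (kk + born_integral) * (fst (F 0) - 1)) * / fst (F 0))%C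
    by (field; exact HF).
  rewrite Cmod_mult, Cmod_inv by exact HF. rewrite Rmult_comm.
  assert (HL := fst_Id_sub_V_inv_0_lower).
  apply Rmult_le_compat; try apply Cmod_ge_0.
  - apply Rlt_le, Rinv_0_lt_compat. lra.
  - rewrite <- (Rinv_inv 2). apply Rinv_le_contravar; lra.
  - apply Cmod_triangle_le. rewrite Cmod_opp, Cmod_mult.
    apply Rplus_le_compat; [apply snd_Id_sub_V_inv_0_estimate|].
    apply Rmult_le_compat; try apply Cmod_ge_0.
    + apply Cmod_triangle_le. generalize Cmod_k_le Cmod_born_integral. lra.
    + rewrite (Id_sub_V_inv_components 0) by lra. simpl. apply Id_sub_V_inv_near_data. lra.
Qed.

(** Expand [z / (2 - z) = z / 2 + z^2 / (2 (2 - z))] at [psi] and at [xi]. The difference of the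
    linear terms is [(psi - xi) / 2 = b b' / (2 i)], and [|2 - z| >= 1] controls the rest. *)
Lemma k_second_order (xi_small : Cmod x_i <= / 2) :
  Cmod (kk - (R_tail alpha theta x0 + RtoC (bb' alpha theta x0) / (2 * Ci) * cis (- 2 * ph x0)))%C
  <= Cmod ps * Cmod ps + Cmod x_i * Cmod x_i.
Proof.
  unfold kk. rewrite k_eq.
  rewrite R_tail_xi.
  fold ph ps x_i. assert (Hps := two_minus_neq_0 ps psi_small).
  assert (Hxi := two_minus_neq_0 x_i xi_small).
  assert (Hii := Ci_sqr).
  assert (HCi : (/ (2 * Ci) = - Ci / 2)%C).
  { transitivity (/ (2 * Ci) * (- (Ci * Ci)))%C; [rewrite Hii; ring|]. field. apply Ci_neq_0. }
  assert (Hb : (RtoC (bb' alpha theta x0) / (2 * Ci) = (ps - x_i) / 2)%C).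
  { unfold Cdiv at 1. rewrite HCi. unfold ps, psi, x_i. field. }
  rewrite Hb.
  replace (cis (- 2 * ph x0) * (ps / (2 - ps)) - (cis (- 2 * ph x0) * (x_i / (2 - x_i)) + (ps - x_i) / 2 * cis (- 2 * ph x0)))%C
    with (cis (- 2 * ph x0) * (/ 2 * (ps * ps * / (2 - ps) + - (x_i * x_i * / (2 - x_i)))))%C.
  2: { field. split; assumption. }
  rewrite Cmod_mult, Cmod_cis, Rmult_1_l, Cmod_mult, Cmod_inv, Cmod_R, Rabs_right by (lra || apply two_neq_0).
  assert (Hq : forall z, Cmod z <= / 2 -> Cmod (z * z * / (2 - z))%C <= Cmod z * Cmod z).
  { intros z Hz. rewrite Cmod_mult, Cmod_inv, Cmod_mult by now apply two_minus_neq_0.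
    assert (H := two_minus_lower z Hz).
    assert (/ Cmod (2 - z)%C <= 1) by (rewrite <- Rinv_1; apply Rinv_le_contravar; lra).
    assert (0 <= Cmod z * Cmod z) by (apply Rmult_le_pos; apply Cmod_ge_0). nra. }
  assert (H1 := Hq ps psi_small). assert (H2 := Hq x_i xi_small).
  assert (H3 := Cmod_triangle (ps * ps * / (2 - ps))%C (- (x_i * x_i * / (2 - x_i)))%C).
  rewrite Cmod_opp in H3.
  assert (0 <= Cmod (ps * ps * / (2 - ps) + - (x_i * x_i * / (2 - x_i)))%C) by apply Cmod_ge_0.
  lra.
Qed.

End Scattering.

(** * Smallness in [theta] and conclusion *)

Lemma bb'_small (alpha x0 : R) : 0 < alpha -> 0 < x0 -> exists K, 0 <= K /\
  forall theta, 0 < theta -> Rabs (bb' alpha theta x0) <= K * theta.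
Proof.
  intros Ha Hx. exists (alpha * Rpower x0 (alpha - 1)). split.
  { apply Rmult_le_pos; [lra|apply Rlt_le, exp_pos]. }
  intros theta Ht. rewrite bb'_eq by assumption.
  assert (HP := pot_ge_1 alpha theta Ht x0).
  assert (Hp : 0 < Rpower (pot alpha theta x0) (- (5 / 4)) <= 1).
  { apply Rpower_opp_le_1; lra. }
  assert (Hb := b_pos alpha theta x0). assert (Hb1 := b_le_1 alpha theta Ht x0).
  assert (Hd : 0 < dpot alpha theta x0).
  { unfold dpot. repeat apply Rmult_lt_0_compat; try assumption. apply exp_pos. }
  unfold db.
  replace (b alpha theta x0 * (- / 4 * dpot alpha theta x0 * Rpower (pot alpha theta x0) (- (5 / 4))))
    with (- (b alpha theta x0 * (/ 4 * dpot alpha theta x0 * Rpower (pot alpha theta x0) (- (5 / 4))))) by ring.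
  rewrite Rabs_Ropp, Rabs_right.
  2: { apply Rle_ge, Rmult_le_pos; [lra|]. apply Rmult_le_pos; lra. }
  replace (alpha * Rpower x0 (alpha - 1) * theta) with (1 * (dpot alpha theta x0 * 1)) by (unfold dpot; ring).
  apply Rmult_le_compat; try lra.
  - apply Rmult_le_pos; lra.
  - apply Rmult_le_compat; lra.
Qed.

(** Collects every smallness condition below one threshold. The bound [mu] and the Jost data depend
    on [theta], whereas [Cp] does not; this makes the final constant uniform. *)
Lemma small_theta_data (alpha x0 : R) : 0 < alpha -> 0 < x0 ->
  exists theta1 Cp : R, 0 < theta1 /\ 0 <= Cp /\
  forall theta, 0 < theta < theta1 ->
  exists (mu : R) (s r A B : R -> C),
    (forall x, x0 / 2 <= x -> Rabs (M_ext alpha x0 theta x) <= mu * Rpower x (- (1 + / 2))) /\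
    8 * mu * Rpower (x0 / 2) (- / 2) <= 1 /\
    jost (phi alpha theta) (M_ext alpha x0 theta) (x0 / 2) 0 s r A B /\
    Cmod (psi alpha theta x0 s r) <= Cp * theta /\ Cmod (xi x0 s r) <= Cp * theta /\
    Cp * theta <= / 2 /\ 8 * V_size alpha theta x0 <= 1.
Proof.
  intros Ha Hx0.
  destruct (jost_r_small alpha x0 Ha Hx0) as [C1 [t1 [HC1 [Ht1 Hr]]]].
  destruct (M_bound alpha x0 Ha Hx0) as [KM [HKM HM]].
  destruct (bb'_small alpha x0 Ha Hx0) as [Kb [HKb Hb]].
  destruct (Rpower_small (8 * KM * Rpower (x0 / 2) (- / 2)) (/ (2 * alpha + 1)) 1) as [t2 [Ht2 Hs2]].
  { apply Rmult_le_pos; [lra|apply Rlt_le, exp_pos]. }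
  { apply Rinv_0_lt_compat; lra. }
  { lra. }
  (* [|xi| <= 2 |r(x0)|] contributes [2 * C1], and [b b'] in [psi] contributes [Kb]. *)
  set (Cp := 2 * C1 + Kb).
  set (Cv := Rpower x0 alpha). assert (HCv : 0 < Cv) by apply exp_pos.
  assert (H3 : 0 < / (2 * Cv)) by (apply Rinv_0_lt_compat; lra).
  assert (H4 : 0 < / (2 * (Cp + 1))) by (apply Rinv_0_lt_compat; unfold Cp; lra).
  (* In order: [r(x0) = O(theta)]; the Jost contraction; [8 * V_size <= 1], where
     [V_size = Cv * theta / 4]; and [Cp * theta <= 1/2]. *)
  exists (Rmin (Rmin t1 t2) (Rmin (/ (2 * Cv)) (/ (2 * (Cp + 1))))), Cp.
  split; [repeat apply Rmin_glb_lt; lra|]. split; [unfold Cp; lra|].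
  intros theta [Ht0 Ht].
  assert (Hall : theta < t1 /\ theta < t2 /\ theta < / (2 * Cv) /\ theta < / (2 * (Cp + 1))).
  { generalize (Rmin_l (Rmin t1 t2) (Rmin (/ (2 * Cv)) (/ (2 * (Cp + 1)))))
      (Rmin_r (Rmin t1 t2) (Rmin (/ (2 * Cv)) (/ (2 * (Cp + 1)))))
      (Rmin_l t1 t2) (Rmin_r t1 t2) (Rmin_l (/ (2 * Cv)) (/ (2 * (Cp + 1))))
      (Rmin_r (/ (2 * Cv)) (/ (2 * (Cp + 1)))). lra. }
  destruct Hall as [A1 [A2 [A3 A4]]].
  set (mu := KM * Rpower theta (/ (2 * alpha + 1))).
  assert (HN : forall x, x0 / 2 <= x -> Rabs (M_ext alpha x0 theta x) <= mu * Rpower x (- (1 + / 2))).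
  { intros x Hx. rewrite M_ext_eq by exact Hx. apply HM; lra. }
  assert (Hmu : 8 * mu * Rpower (x0 / 2) (- / 2) <= 1).
  { eapply Rle_trans; [|apply (Hs2 theta); lra]. unfold mu. apply Req_le. ring. }
  destruct (is_jost_exists alpha theta x0 mu Ha Ht0 Hx0 HN Hmu 0 (Rle_refl 0)) as [s [r [A [B HJ]]]].
  exists mu, s, r, A, B. split; [exact HN|]. split; [exact Hmu|]. split; [exact HJ|].
  assert (Hxi : Cmod (xi x0 s r) <= 2 * (C1 * theta)).
  { eapply Rle_trans; [apply (Cmod_xi alpha theta x0 mu Ha Ht0 Hx0 HN Hmu s r A B HJ)|].
    apply Rmult_le_compat_l; [lra|]. apply (Hr theta (conj Ht0 A1) s r A B HJ). }
  specialize (Hb theta Ht0).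
  assert (Hc : 0 <= C1 * theta /\ 0 <= Kb * theta) by (split; apply Rmult_le_pos; lra).
  split; [|split; [|split]].
  - unfold psi. apply Cmod_triangle_le.
    rewrite Cmod_opp, Cmod_mult, Cmod_Ci, Cmod_R. unfold Cp. lra.
  - unfold Cp. lra.
  - apply Rmult_lt_compat_r with (r := 2 * (Cp + 1)) in A4; [|unfold Cp; lra].
    rewrite Rinv_l in A4 by (unfold Cp; lra). lra.
  - apply Rmult_lt_compat_r with (r := 2 * Cv) in A3; [|lra].
    rewrite Rinv_l in A3 by lra. unfold V_size. fold Cv. lra.
Qed.

Theorem proposition4p3 : forall alpha x0 : R, 0 < alpha -> 0 < x0 ->
  (forall theta : R, 0 < theta ->
     forall u a_gt a_lt : R -> C,
       is_solution alpha theta 1%C u ->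
       is_wave_pair alpha theta x0 u a_gt a_lt ->
       forall y : R, 0 <= y <= x0 ->
         (a_gt y, a_lt y)
         = add2 (a_gt x0, a_lt x0)
             (V alpha theta x0 (fun t => (a_gt t, a_lt t)) y))
  /\
  exists theta1 : R, 0 < theta1 /\
    (forall theta : R, 0 < theta < theta1 ->
       k_defined alpha theta x0 /\
       Id_sub_V_invertible alpha theta x0 /\
       let F := Id_sub_V_inv alpha theta x0
                  (fun _ => (RtoC 1, k alpha theta x0)) in
       fst (F 0) <> 0%C /\
       unique (is_reflection_coefficient alpha theta)
         (snd (F 0) / fst (F 0))%C)
    /\
    exists K : R, forall theta0 : R, 0 < theta0 ->
      (forall theta : R, 0 < theta < theta0 -> M_tail alpha theta x0 < 2) ->
      forall theta : R, 0 < theta < Rmin theta0 theta1 ->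
      forall r : C, is_reflection_coefficient alpha theta r ->
        Cmod (r - (R_tail alpha theta x0
                   + RtoC (bb' alpha theta x0) / (2 * Ci)
                     * cis (- 2 * phi alpha theta x0)
                   + RInt_gen_RC
                       (fun y => RtoC (Derive (b alpha theta) y / b alpha theta y)
                                 * cis (- 2 * phi alpha theta y))
                       (at_right 0) (at_point x0)))%C
        <= K * theta ^ 2.
Proof.
  intros alpha x0 Ha Hx0. split.
  { intros theta Ht u a_gt a_lt. now apply wave_pair_equation. }
  destruct (small_theta_data alpha x0 Ha Hx0) as [theta1 [Cp [Ht1 [HCp Hdata]]]].
  exists theta1. split; [exact Ht1|]. split.
  - intros theta Ht. destruct (Hdata theta Ht) as [mu [s [r [A [B [HN [Hmu [HJ [Hpsi [_ [Hcp Hvs]]]]]]]]]]].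
    destruct Ht as [Ht0 _]. assert (Hps := Rle_trans _ _ _ Hpsi Hcp). split; [|split].
    + apply (k_defined_small alpha theta x0 mu Ha Ht0 Hx0 HN Hmu s r A B HJ Hps).
    + apply Id_sub_V_invertible_small; try assumption.
      generalize (V_size_pos alpha theta x0 Ht0). lra.
    + split.
      * apply (fst_Id_sub_V_inv_0_neq_0 alpha theta x0 mu Ha Ht0 Hx0 HN Hmu s r A B HJ Hps Hvs).
      * apply (reflection_coefficient_unique alpha theta x0 mu Ha Ht0 Hx0 HN Hmu s r A B HJ Hps Hvs).
  - set (Cv := Rpower x0 alpha / 4).
    assert (HCv : 0 < Cv) by (apply Rdiv_lt_0_compat; [apply exp_pos|lra]).
    (* Sum of the bounds of [reflection_first_order] and [k_second_order] with [V_size = Cv * theta]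
       and with [|psi|], [|xi|] at most [Cp * theta]. *)
    exists (2 * ((8 * Cv + Cp) * Cv + (Cp + Cv) * (4 * Cv)) + 2 * (Cp * Cp)).
    intros theta0 _ _ theta [Ht0 Htm] rr Hrr.
    assert (Ht : 0 < theta < theta1) by (generalize (Rmin_r theta0 theta1); lra).
    destruct (Hdata theta Ht) as [mu [s [r [A [B [HN [Hmu [HJ [Hpsi [Hxi [Hcp Hvs]]]]]]]]]]].
    assert (Hps := Rle_trans _ _ _ Hpsi Hcp).
    destruct (reflection_coefficient_unique alpha theta x0 mu Ha Ht0 Hx0 HN Hmu s r A B HJ Hps Hvs)
      as [_ Hun].
    rewrite <- (Hun rr Hrr).
    assert (H1 := reflection_first_order alpha theta x0 mu Ha Ht0 Hx0 HN Hmu s r A B HJ Hps Hvs).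
    assert (H2 := k_second_order alpha theta x0 mu Ha Ht0 Hx0 HN Hmu s r A B HJ Hps
      (Rle_trans _ _ _ Hxi Hcp)).
    unfold born_integral in H1. unfold constant_data in H1 |- *.
    match type of H1 with Cmod (?q1 - (?k1 + ?i1))%C <= _ =>
      match goal with |- Cmod (_ - (?a1 + ?b1 + _))%C <= _ =>
        (* The intermediate value is [k] plus the integral term: the Volterra part is compared with
           it first, and [k] is then expanded. *)
        replace (q1 - (a1 + b1 + i1))%C with ((q1 - (k1 + i1)) + (k1 - (a1 + b1)))%C by ring
      end end.
    eapply Rle_trans; [apply Cmod_triangle|].
    set (p := Cmod (psi alpha theta x0 s r)) in *. set (y := Cmod (xi x0 s r)) in *.
    assert (Hp : 0 <= p) by apply Cmod_ge_0. assert (Hy : 0 <= y) by apply Cmod_ge_0.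
    replace (V_size alpha theta x0) with (Cv * theta) in * by (unfold V_size, Cv; field).
    assert (Hct : 0 <= Cv * theta) by (apply Rmult_le_pos; lra).
    assert (B1 : (8 * (Cv * theta) + p) * (Cv * theta) <= (8 * Cv + Cp) * theta * (Cv * theta))
      by (apply Rmult_le_compat_r; lra).
    assert (B2 : (p + Cv * theta) * (4 * (Cv * theta)) <= (Cp + Cv) * theta * (4 * (Cv * theta)))
      by (apply Rmult_le_compat_r; lra).
    assert (B3 : p * p <= Cp * theta * (Cp * theta)) by (apply Rmult_le_compat; lra).
    assert (B4 : y * y <= Cp * theta * (Cp * theta)) by (apply Rmult_le_compat; lra).
    replace ((2 * ((8 * Cv + Cp) * Cv + (Cp + Cv) * (4 * Cv)) + 2 * (Cp * Cp)) * theta ^ 2)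
      with (2 * ((8 * Cv + Cp) * theta * (Cv * theta) + (Cp + Cv) * theta * (4 * (Cv * theta)))
        + 2 * (Cp * theta * (Cp * theta))) by ring.
    lra.
Qed.
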